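(* Let $D$ be a regular domain in $\mathbb R^n$ and $p>1$. For every $\phi\in L^p(\partial D,\mu_{x_0})$ the function $$h_\phi(x)=P\phi(x)=\int_{\partial D}\phi(\zeta)P(x,\zeta)\,d\mu_{x_0}(\zeta)$$ is harmonic on $D$, belongs to $\mathcal S^p(D)$, has boundary values equal to $\phi$, and satisfies $\|h_\phi\|_{\mathcal S^p(D)}\le\|\phi\|_{L^p(\partial D,\mu_{x_0})}$. Moreover, $h_\phi$ is the unique harmonic function in $\mathcal S^p(D)$ with boundary values $\phi$.
   Context: A bounded domain $D\subset\mathbb R^n$ is regular if every $\phi\in C(\partial D)$ has a harmonic extension to $D$ continuous on $\overline D$ and equal to $\phi$ on $\partial D$. For $x\in D$, $\mu_x$ denotes harmonic measure of $D$ at $x$. Fix $x_0\in D$ and put $\mu=\mu_{x_0}$. $P(x,\zeta)\ge0$ is a Borel function on $D\times\partial D$ (the Poisson kernel relative to $x_0$) such that $\mu_x=P(x,\cdot)\mu_{x_0}$ for every $x\in D$ and $P(\cdot,\zeta)$ is harmonic on $D$ for $\mu$-a.e. $\zeta$. $D$ is exhausted by regular domains $D_r$, $r<0$, with $x_0\in D_r$, $D_r\Subset D_s$ for $r<s<0$, $\bigcup_{r<0}D_r=D$; $S_r=\partial D_r$, and $\mu_r$ is the harmonic measure of $D_r$ at $x_0$ (these converge weak-* in $C(\overline D)^*$ to $\mu$ as $r\to0^-$). $\mathcal S^p(D)$ is the space of continuous subharmonic functions $u$ on $D$ with $\|u\|_{\mathcal S^p(D)}^p=\limsup_{r\to0^-}\int_{S_r}|u|^p\,d\mu_r<\infty$.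 Boundary values: for a sequence $r_j\nearrow0$ and functions $\phi_j$ on $\operatorname{supp}\mu_{r_j}$, $\{\phi_j\}$ has strong limit values $\phi^*$ (a real $\mu$-measurable function on $K_0=\operatorname{supp}\mu$) if for all real $a<b$ and $\varepsilon,\delta>0$ there are $j_0$ and an open set $O\subset\overline D$ containing $\{x\in K_0:a\le\phi^*(x)<b\}$ with $\mu_{r_j}(\{\phi_j<a-\varepsilon\}\cap O)+\mu_{r_j}(\{\phi_j>b+\varepsilon\}\cap O)<\delta$ for $j\ge j_0$; a function $u$ on $D$ has boundary values $u^*$ if for every sequence $r_j\nearrow0$ the sequence $\{u|_{\operatorname{supp}\mu_{r_j}}\}$ has strong limit values equal to $u^*$ ($\mu$-a.e.). *)

(* Defs.v *)
(* Ambient space R^n is 'rV[R]_n (its max-norm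
   topology coincides with the Euclidean one). *)
From mathcomp Require Import all_boot all_order all_algebra.
From mathcomp Require Import all_classical all_reals all_analysis.
Import Order.TTheory GRing.Theory Num.Theory.
Import numFieldNormedType.Exports.
Set Implicit Arguments. Unset Strict Implicit. Unset Printing Implicit Defensive.
Local Open Scope classical_set_scope.
Local Open Scope ring_scope.

Section Potential.
Variables (R : realType) (n : nat).
Local Notation V := 'rV[R]_n.

Definition Bor := g_sigma_algebraType (@open V).

Definition ebasis (i : 'I_n) : V := delta_mx 0 i.

Definition harmonic_on (D : set V) (f : V -> R) : Prop :=
  open D /\
  (forall x, D x -> {for x, continuous f} /\
     forall i j : 'I_n,
       derivable f x (ebasis j) /\ {for x, continuous ('D_(ebasis j) f)} /\
       derivable ('D_(ebasis j) f) x (ebasis i) /\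
       {for x, continuous ('D_(ebasis i) ('D_(ebasis j) f))}) /\
  (forall x, D x -> \sum_(i < n) 'D_(ebasis i) ('D_(ebasis i) f) x = 0).

Definition is_domain (D : set V) : Prop := open D /\ connected D /\ D !=set0.

(* boundary of an open set *)
Definition bdry (D : set V) : set V := closure D `\` D.

Definition regular_domain (D : set V) : Prop :=
  is_domain D /\ bounded_set D /\
  forall phi : V -> R, {within bdry D, continuous phi} ->
    exists h : V -> R, harmonic_on D h /\ {within closure D, continuous h} /\
      forall z, bdry D z -> h z = phi z.

Definition harm_measure_at (D : set V) (x : V)
    (m : {measure set Bor -> \bar R}) : Prop :=
  m (~` bdry D) = 0%E /\
  forall h : V -> R, harmonic_on D h -> {within closure D, continuous h} ->
    (h x)%:E = (\int[m]_(z in bdry D) (h z)%:E)%E.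

(* continuous subharmonic (Perron's definition, comparison with harmonic_on
   functions on relatively compact open subsets) *)
Definition subharmonic (D : set V) (u : V -> R) : Prop :=
  forall G : set V, open G -> bounded_set G -> closure G `<=` D ->
  forall h : V -> R, harmonic_on G h -> {within closure G, continuous h} ->
    (forall z, bdry G z -> u z <= h z) -> forall x, G x -> u x <= h x.

Definition msupp (m : {measure set Bor -> \bar R}) : set V :=
  [set x | forall U : set V, open U -> U x -> (0 < m U)%E].

Definition limsup_left0 (F : R -> \bar R) : \bar R :=
  ereal_inf [set ereal_sup [set F r | r in `]- d, 0[] | d in [set d : R | 0 < d]].

Definition Sp_pow (Dr : R -> set V) (mur : R -> {measure set Bor -> \bar R})
  (p : R) (u : V -> R) : \bar R :=
  limsup_left0 (fun r => \int[mur r]_(z in bdry (Dr r)) (`|u z| `^ p)%:E)%E.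

Definition Sp_norm Dr mur p u : \bar R := poweR (Sp_pow Dr mur p u) p^-1.

Definition in_Sp (D : set V) Dr mur p (u : V -> R) : Prop :=
  (forall x, D x -> {for x, continuous u}) /\ subharmonic D u /\
  (Sp_pow Dr mur p u < +oo)%E.

Definition in_Lp (m : {measure set Bor -> \bar R}) (A : set V) (p : R)
  (phi : V -> R) : Prop :=
  measurable_fun (A : set Bor) phi /\
  (\int[m]_(z in A) (`|phi z| `^ p)%:E < +oo)%E.

Definition Lp_norm (m : {measure set Bor -> \bar R}) (A : set V) (p : R)
  (phi : V -> R) : \bar R :=
  poweR (\int[m]_(z in A) (`|phi z| `^ p)%:E)%E p^-1.

Definition strong_limit (D : set V) (mu : {measure set Bor -> \bar R})
  (mur : R -> {measure set Bor -> \bar R}) (rs : nat -> R) (u phis : V -> R)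
  : Prop :=
  forall a b : R, a < b -> forall eps delta : R, 0 < eps -> 0 < delta ->
  exists j0 : nat, exists O : set V,
    (exists U : set V, open U /\ O = U `&` closure D) /\
    [set x | msupp mu x /\ a <= phis x < b] `<=` O /\
    forall j : nat, (j0 <= j)%N ->
      (mur (rs j) ([set x | msupp (mur (rs j)) x /\ (u x < a - eps)%R] `&` O) +
       mur (rs j) ([set x | msupp (mur (rs j)) x /\ (b + eps < u x)%R] `&` O)
       < delta%:E)%E.

Definition has_boundary_values (D : set V) (mu : {measure set Bor -> \bar R})
  (mur : R -> {measure set Bor -> \bar R}) (u phi : V -> R) : Prop :=
  forall rs : nat -> R, (forall j, rs j < 0) ->
    {homo rs : i j / (i <= j)%N >-> i <= j} -> rs @ \oo --> (0 : R) ->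
    exists phis : V -> R, strong_limit D mu mur rs u phis /\
      {ae mu, forall x : Bor, phis x = phi x}.

Definition poisson_int (D : set V) (mu : {measure set Bor -> \bar R})
  (P : V -> V -> R) (phi : V -> R) (x : V) : R :=
  fine (\int[mu]_(z in bdry D) (phi z * P x z)%:E)%E.

End Potential.

(* Main.v *)
(* Everything rests on the maximum principle. Comparing the odd part of a harmonic function in
   one coordinate with a quadratic barrier on a half cube bounds its gradient by its supremum;
   applied to difference quotients this also bounds second derivatives, so locally uniform
   limits of harmonic functions are harmonic. The same gradient bound, together with the
   barrier |x|^(-2n), yields Harnack's inequality, without any mean value formula.

   An integrable function f on the boundary is approximated, everywhere, by a continuous psi
   with |f - psi| <= sup_k g_k, where the g_k are continuous, nonnegative, increasing and of
   small integral (Vitali-Caratheodory). The harmonic extensions G_k of the g_k satisfy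
   |P f - Psi| <= sup_k G_k on D, with G_k(x0) small. By Harnack sup_k G_k is locally uniformly
   small, so P f is harmonic; and as the integral of G_k against mu_r is G_k(x0), Markov's
   inequality makes sup_k G_k small outside a set of small mu_r-measure, uniformly in r, which
   gives the boundary values. The norm bound is Jensen's inequality for mu_x. For uniqueness,
   equality of boundary values makes v = u - P f tend to 0 in mu_r-measure, the bound in S^p
   upgrades this to the L^1-norms, and |v(x)| <= C int |v| dmu_r by Harnack applied to the
   solution of the Dirichlet problem in D_r with boundary data |v|. *)
Require Import Defs.
From mathcomp Require Import finmap.
From mathcomp Require Import all_boot all_order all_algebra.
From mathcomp Require Import all_classical all_reals all_analysis.
From mathcomp Require Import measurable_realfun ring lra.
Import Order.TTheory GRing.Theory Num.Theory.
Import numFieldNormedType.Exports.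
Local Open Scope classical_set_scope.
Local Open Scope ring_scope.
Set Implicit Arguments. Unset Strict Implicit. Unset Printing Implicit Defensive.

(** * The maximum principle for second differences *)

Section Metric.
Variables (R : realType) (n : nat).
Local Notation V := 'rV[R]_n.
Implicit Types (x y : V) (A G : set V) (f : V -> R).

(** Harmonicity is stated with iterated partial derivatives, but the comparison arguments subtract
    reflections, translates and barriers. They are therefore run for [weakly_harmonic] functions,
    where only symmetric second differences matter; derivatives return when limits are taken.

    The majorant [sup_k G_k] may be infinite and is never formed: it is kept as an increasing
    sequence and read through its superlevel sets. Domination is arranged at every point, not almost
    everywhere for one measure, because it is then integrated against every [mux x].

    For uniqueness, a strong limit controls [u] only inside neighbourhoods of level sets of the
    boundary function. What such neighbourhoods miss is a closed set of small harmonic measure, and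
    it must also be small for [mur r] with [r] near 0. This share of weak convergence is
    [exhaustion_usc]. Passing from convergence in measure to convergence in L^1 is uniform
    integrability, where the exponent [p > 1] acts. *)

Lemma nbhs_normP x A :
  nbhs x A <-> exists2 r : R, 0 < r & forall y, `|y - x| < r -> A y.
Proof.
split=> [/nbhs_ballP[r /= r0 rA]|[r r0 rA]]; last apply/nbhs_ballP;
  exists r => //= y.
  by move=> yx; apply: rA; rewrite -ball_normE /ball_/= distrC.
by rewrite -ball_normE /ball_/= distrC; exact: rA.
Qed.

Lemma open_normP A :
  open A <-> forall x, A x -> exists2 r : R, 0 < r & forall y, `|y - x| < r -> A y.
Proof.
rewrite openE; split=> [oA x /oA/nbhs_normP//|oA x /oA/nbhs_normP]; exact.
Qed.

Lemma closure_normP A x :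
  closure A x <-> forall e : R, 0 < e -> exists2 y, A y & `|y - x| < e.
Proof.
split=> [cA e e0|cA B /nbhs_normP[r r0 rB]].
  have /cA[y [Ay /= yx]] : nbhs x [set y | `|y - x| < e].
    by apply/nbhs_normP; exists e.
  by exists y.
by have [y Ay yx] := cA r r0; exists y; split=> //; exact: rB.
Qed.

Lemma cont_normP f x : {for x, continuous f} <->
  forall e : R, 0 < e -> exists2 d : R, 0 < d & forall y, `|y - x| < d -> `|f y - f x| < e.
Proof.
split=> [/cvgrPdist_lt cf e e0|cf].
  have /nbhs_normP[d d0 dP] := cf e e0; exists d => // y /dP.
  by rewrite distrC.
apply/(@cvgrPdist_lt _ R^o V (nbhs x) (nbhs_filter x)) => e e0.
have [d d0 dP] := cf e e0.
by apply/nbhs_normP; exists d => // y /dP; rewrite distrC.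
Qed.

Lemma within_normP A f : {within A, continuous f} <->
  forall x, A x -> forall e : R, 0 < e ->
  exists2 d : R, 0 < d & forall y, A y -> `|y - x| < d -> `|f y - f x| < e.
Proof.
split=> [/subspace_continuousP cf x Ax e e0|cf].
  have /cvgrPdist_lt/(_ e e0) := cf x Ax.
  rewrite /within/= => /nbhs_normP[d d0 dP]; exists d => // y Ay /dP/(_ Ay).
  by rewrite distrC.
apply/subspace_continuousP => x Ax; apply/cvgrPdist_lt => e e0.
have [d d0 dP] := cf x Ax e e0.
by apply/nbhs_normP; exists d => // y yx Ay; rewrite distrC; exact: dP.
Qed.

Lemma coord_le_norm x i : `|x 0 i| <= `|x|.
Proof.
rewrite [leRHS]/Num.norm/= mx_normrE.
exact: (@le_bigmax _ _ _ 0 (fun ij => `|x ij.1 ij.2|) (0, i)).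
Qed.

Lemma norm_le_coord x (r : R) : 0 <= r -> (forall i, `|x 0 i| <= r) -> `|x| <= r.
Proof.
move=> r0 xr; rewrite [leLHS]/Num.norm/= mx_normrE.
by apply/bigmax_leP; split=> // -[i j] _ /=; rewrite ord1.
Qed.

Lemma norm_eq_coord x : 0 < `|x| -> exists i, `|x 0 i| = `|x|.
Proof.
move=> x0; have [|[i j] /= ij] := @mx_norm_neq0 _ _ _ x; first by rewrite gt_eqF.
by exists j; rewrite [RHS]ij ord1.
Qed.

Lemma norm_ebasis i : `|ebasis R i : V| = 1.
Proof.
apply/eqP; rewrite eq_le; apply/andP; split; last first.
  by have := coord_le_norm (ebasis R i) i; rewrite mxE !eqxx normr1.
apply: norm_le_coord => // j; rewrite mxE /=.
by case: (j == i); rewrite ?normr1 ?normr0.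
Qed.

Lemma bounded_setP A : bounded_set A <-> exists C : R, forall x, A x -> `|x| <= C.
Proof.
split=> [[M [_ MA]]|[C CA]].
  by exists (M + 1) => x; apply: MA; rewrite ltrDl.
by exists C; split; [exact: num_real|move=> N CN x /CA /le_trans]; apply; exact: ltW.
Qed.

Lemma closure_norm_le A (c : V) (C : R) :
  (forall x, A x -> `|x - c| <= C) -> forall x, closure A x -> `|x - c| <= C.
Proof.
move=> AC x /closure_normP cx; apply/ler_addgt0Pr => e e0.
have [y Ay yx] := cx e e0.
have -> : x - c = (y - c) + (x - y) by rewrite [RHS]addrC addrA subrK.
rewrite (le_trans (ler_normD _ _))// lerD ?AC//.
by rewrite distrC; exact: ltW.
Qed.

Lemma bounded_closure A : bounded_set A -> bounded_set (closure A).
Proof.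
move=> /bounded_setP[C CA]; apply/bounded_setP; exists C => x cx.
rewrite -[x]subr0; apply: closure_norm_le cx => y; rewrite subr0; exact: CA.
Qed.

Lemma compact_closure_bounded A : bounded_set A -> compact (closure A).
Proof.
move=> bA; apply: bounded_closed_compact; first exact: bounded_closure.
exact: closed_closure.
Qed.

Lemma bdry_or A x : closure A x -> A x \/ bdry A x.
Proof. by move=> cx; have [|] := pselect (A x); [left|right]. Qed.

Lemma closed_bdry A : open A -> closed (bdry A).
Proof.
by move=> oA; apply: closedI; [exact: closed_closure|exact: open_closedC].
Qed.

Lemma withinS A B f : A `<=` B -> {within B, continuous f} -> {within A, continuous f}.
Proof. by move=> AB; exact: continuous_subspaceW. Qed.

Lemma within_cont A f : (forall x, A x -> {for x, continuous f}) -> {within A, continuous f}.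
Proof.
move=> cf; apply/within_normP => x Ax e e0.
by have /cont_normP/(_ e e0)[d d0 dP] := cf x Ax; exists d => // y _; exact: dP.
Qed.

Lemma withinD A f g : {within A, continuous f} -> {within A, continuous g} ->
  {within A, continuous (fun x => f x + g x)}.
Proof. by move=> cf cg x; apply: cvgD; [exact: cf|exact: cg]. Qed.

Lemma withinZ A f (k : R) : {within A, continuous f} ->
  {within A, continuous (fun x => k * f x)}.
Proof. by move=> cf x; apply: cvgM; [exact: cvg_cst|exact: cf]. Qed.

Lemma withinN A f : {within A, continuous f} -> {within A, continuous (fun x => - f x)}.
Proof. by move=> cf x; apply: cvgN; exact: cf. Qed.

Lemma withinB A f g : {within A, continuous f} -> {within A, continuous g} ->
  {within A, continuous (fun x => f x - g x)}.
Proof. by move=> cf cg x; apply: cvgB; [exact: cf|exact: cg]. Qed.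

Lemma within_norm A f : {within A, continuous f} -> {within A, continuous (fun x => `|f x|)}.
Proof. by move=> cf x; apply: cvg_norm; exact: cf. Qed.

End Metric.

(** * Symmetric second differences and the Laplacian they define *)

Section SecondDifference.
Variables (R : realType) (n : nat).
Local Notation V := 'rV[R]_n.
Implicit Types (x y : V) (A G : set V) (f g : V -> R).
Local Notation "''e_' i" := (ebasis R i) (at level 8, i at level 2, format "''e_' i").

(** [a] is the symmetric (Schwarz) second derivative along the axis [i], multiplied out by [t ^+ 2].
    The difference is even in [t], so positive [t] suffice, and no first derivative has to exist. *)
Definition sd2 f x (i : 'I_n) (a : R) := forall e, 0 < e -> exists2 d : R, 0 < d &
  forall t, 0 < t -> t < d ->
  `|f (x + t *: 'e_i) + f (x - t *: 'e_i) - 2 * f x - a * t ^+ 2| <= e * t ^+ 2.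

Definition laplacian_at f x (L : R) :=
  exists2 a : 'I_n -> R, (forall i, sd2 f x i (a i)) & \sum_i a i = L.

(** A pointwise notion, not the distributional one. It is visibly stable under sums, translations
    and coordinate reflections, and it is all that the maximum principle asks of a function. *)
Definition weakly_harmonic G f :=
  open G /\ forall x, G x -> {for x, continuous f} /\ laplacian_at f x 0.

Lemma sd2_quad f x i a (r : R) : 0 < r ->
  (forall t, 0 < t -> t < r -> f (x + t *: 'e_i) + f (x - t *: 'e_i) - 2 * f x = a * t ^+ 2) ->
  sd2 f x i a.
Proof.
move=> r0 h e e0; exists r => // t t0 td; rewrite h// subrr normr0.
by rewrite mulr_ge0 ?sqr_ge0// ltW.
Qed.

Lemma sd2_ext f g x i a (r : R) : 0 < r -> (forall y, `|y - x| < r -> f y = g y) ->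
  sd2 f x i a -> sd2 g x i a.
Proof.
move=> r0 fg sf e e0; have [d d0 dP] := sf e e0.
exists (Num.min d r); first by rewrite lt_min d0.
move=> t t0; rewrite lt_min => /andP[td tr]; have := dP t t0 td.
have nt s : `|s| < r -> `|x + s *: 'e_i - x| < r.
  by move=> sr; rewrite addrC addKr normrZ norm_ebasis mulr1.
rewrite !fg ?subrr ?normr0// -?scaleNr nt// ?normrN gtr0_norm//.
Qed.

Lemma sd2D f g x i a b : sd2 f x i a -> sd2 g x i b ->
  sd2 (fun y => f y + g y) x i (a + b).
Proof.
move=> sf sg e e0; have e20 : 0 < e / 2 by rewrite divr_gt0.
have [d d0 dP] := sf _ e20; have [d' d0' dP'] := sg _ e20.
exists (Num.min d d'); first by rewrite lt_min d0.
move=> t t0; rewrite lt_min => /andP[td td'].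
rewrite (_ : _ - _ = (f (x + t *: 'e_i) + f (x - t *: 'e_i) - 2 * f x - a * t ^+ 2) +
  (g (x + t *: 'e_i) + g (x - t *: 'e_i) - 2 * g x - b * t ^+ 2)); last by ring.
apply: le_trans (ler_normD _ _) _; rewrite [in leRHS](splitr e) [leRHS]mulrDl.
by apply: lerD; [exact: dP|exact: dP'].
Qed.

Lemma sd2Z f k x i a : sd2 f x i a -> sd2 (fun y => k * f y) x i (k * a).
Proof.
move=> sf e e0; have k0 : 0 < `|k| + 1 by rewrite ltr_wpDl.
have [d d0 dP] := sf (e / (`|k| + 1)) (divr_gt0 e0 k0).
exists d => // t t0 td.
rewrite (_ : _ - _ = k * (f (x + t *: 'e_i) + f (x - t *: 'e_i) - 2 * f x - a * t ^+ 2));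
  last by ring.
rewrite normrM; apply: le_trans (ler_wpM2l (normr_ge0 _) (dP t t0 td)) _.
rewrite mulrA; apply: ler_wpM2r; first exact: sqr_ge0.
rewrite mulrCA ger_pMr// ler_pdivrMr// mul1r lerDl; exact: ler01.
Qed.

Lemma lapD f g x a b : laplacian_at f x a -> laplacian_at g x b ->
  laplacian_at (fun y => f y + g y) x (a + b).
Proof.
move=> [c sc <-] [d sd <-]; exists (fun i => c i + d i); last by rewrite big_split.
by move=> i; exact: sd2D.
Qed.

Lemma lapZ f k x a : laplacian_at f x a -> laplacian_at (fun y => k * f y) x (k * a).
Proof.
move=> [c sc <-]; exists (fun i => k * c i); last by rewrite mulr_sumr.
by move=> i; exact: sd2Z.
Qed.

Lemma lap_ext f g x L (r : R) : 0 < r -> (forall y, `|y - x| < r -> f y = g y) ->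
  laplacian_at f x L -> laplacian_at g x L.
Proof.
by move=> r0 fg [c sc <-]; exists c => // i; exact: sd2_ext fg (sc i).
Qed.

Lemma lapB f g x a b : laplacian_at f x a -> laplacian_at g x b ->
  laplacian_at (fun y => f y - g y) x (a - b).
Proof.
move=> sf sg; have := lapD sf (lapZ (-1) sg); rewrite mulN1r.
by apply: (lap_ext ltr01) => y _; rewrite mulN1r.
Qed.

Lemma sd2_shift f x c i a : sd2 f (x + c) i a -> sd2 (fun y => f (y + c)) x i a.
Proof.
move=> sf e e0; have [d d0 dP] := sf e e0; exists d => // t t0 td.
by rewrite (addrAC x (t *: _) c) (addrAC x (- (t *: _)) c); exact: dP.
Qed.

Lemma lap_shift f x c L : laplacian_at f (x + c) L -> laplacian_at (fun y => f (y + c)) x L.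
Proof. by move=> [a sa <-]; exists a => // i; exact: sd2_shift. Qed.

Lemma sd2_coord_sqr (c : V) x i j :
  sd2 (fun y => (y 0 i - c 0 i) ^+ 2) x j (2 * (i == j)%:R).
Proof.
apply: (@sd2_quad _ _ _ _ 1) => // t _ _; rewrite !mxE eqxx/=.
by case: (i == j); rewrite /=; ring.
Qed.

Lemma lap_coord_sqr (c : V) x i : laplacian_at (fun y => (y 0 i - c 0 i) ^+ 2) x 2.
Proof.
exists (fun j => 2 * (i == j)%:R); first by move=> j; exact: sd2_coord_sqr.
rewrite (bigD1 i)//= eqxx mulr1 big1 ?addr0// => j.
by rewrite eq_sym => /negbTE ->; rewrite mulr0.
Qed.

Lemma lap_affine (k c : R) x i : laplacian_at (fun y => k * y 0 i + c) x 0.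
Proof.
exists (fun=> 0); last by rewrite big1.
move=> j; apply: (@sd2_quad _ _ _ _ 1) => // t _ _; rewrite !mxE; ring.
Qed.

Lemma sd2_max f x i a (r : R) : 0 < r -> (forall y, `|y - x| < r -> f y <= f x) ->
  sd2 f x i a -> a <= 0.
Proof.
move=> r0 fx sf; apply/ler_addgt0Pr => e e0; rewrite add0r.
have [d d0 dP] := sf e e0.
pose t := Num.min d r / 2.
have m0 : 0 < Num.min d r by rewrite lt_min d0.
have t0 : 0 < t by rewrite divr_gt0.
have : t < Num.min d r by rewrite /t; lra.
rewrite lt_min => /andP[td tr].
have nt s : `|s| < r -> `|x + s *: 'e_i - x| < r.
  by move=> sr; rewrite addrC addKr normrZ norm_ebasis mulr1.
have := dP t t0 td.
have nt1 : `|t| < r by rewrite gtr0_norm.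
have h1 := fx _ (nt _ nt1).
have h2 := fx (x - t *: 'e_i); rewrite -scaleNr nt ?normrN// scaleNr in h2.
have {}h2 := h2 isT.
rewrite ler_norml => /andP[h3 _].
have t20 : 0 < t ^+ 2 by rewrite exprn_gt0.
rewrite -(ler_pM2r t20); lra.
Qed.

Lemma cont_coord_sqr (c : V) i : continuous (fun y : V => (y 0 i - c 0 i) ^+ 2).
Proof.
move=> x; have h : {for x, continuous (fun y : V => y 0 i - c 0 i)}.
  apply/cont_normP => e e0; exists e => // y yx; apply: le_lt_trans yx.
  have -> : y 0 i - c 0 i - (x 0 i - c 0 i) = (y - x) 0 i by rewrite !mxE; ring.
  exact: coord_le_norm.
exact: (cvgM h h).
Qed.

(* Perturbing by a multiple of one squared coordinate makes the Laplacian strictly positive. *)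
Lemma max_principle (i0 : 'I_n) G f (M : R) : open G -> bounded_set G ->
  {within closure G, continuous f} ->
  (forall x, G x -> exists2 L, 0 <= L & laplacian_at f x L) ->
  (forall z, bdry G z -> f z <= M) -> forall x, G x -> f x <= M.
Proof.
move=> oG bG cf lf fM x Gx; rewrite leNgt; apply/negP => Mfx.
have [C CG] := (bounded_setP _).1 (bounded_closure bG).
pose q (y : V) := (y 0 i0 - (0 : V) 0 i0) ^+ 2.
have q0 y : 0 <= q y by exact: sqr_ge0.
have C0 : 0 <= C by apply: le_trans (normr_ge0 x) (CG x _); exact: subset_closure.
have qC y : closure G y -> q y <= C ^+ 2.
  move=> /CG yC; rewrite /q mxE subr0 -real_normK ?num_real//.
  rewrite ler_sqr ?nnegrE//; exact: le_trans (coord_le_norm _ _) yC.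
(* Small enough that on the boundary [F <= M + e * C ^+ 2] stays below [f x], so that the maximum of
   [F] lies inside; the [+ 1] keeps the divisor positive. *)
pose e := (f x - M) / (2 * (C ^+ 2 + 1)).
have C1 : 0 < C ^+ 2 + 1 by rewrite ltr_wpDl ?sqr_ge0.
have e0 : 0 < e by rewrite divr_gt0 ?mulr_gt0// subr_gt0.
have eC : e * (C ^+ 2 + 1) = (f x - M) / 2 by rewrite /e; field; rewrite gt_eqF.
pose F y := f y + e * q y.
have cF : {within closure G, continuous F}.
  apply: withinD => //; apply: withinZ; apply: within_cont => y _.
  exact: cont_coord_sqr.
have [||z] := @EVT_max_rV _ _ F (closure G) _ _ cF.
- by exists x; exact: subset_closure.
- exact: compact_closure_bounded.
rewrite inE => cz zmax.
have Fx : F x <= F z by apply: zmax; rewrite inE; exact: subset_closure.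
have eqC : e * q z <= e * C ^+ 2 by apply: ler_wpM2l; [exact: ltW|exact: qC].
have eqx : 0 <= e * q x by rewrite mulr_ge0// ltW.
have [Gz|/fM fz] := bdry_or cz; last first.
  by move: Fx; rewrite /F; lra.
have [L L0 fL] := lf z Gz.
have [a sa La] : laplacian_at F z (L + e * 2).
  by apply: lapD => //; apply: lapZ; exact: lap_coord_sqr.
have [r r0 rG] := (open_normP _).1 oG z Gz.
have : \sum_i a i <= 0.
  apply: sumr_le0 => i _; apply: (@sd2_max F z i _ r) => // y yz.
  by apply: zmax; rewrite inE; apply: subset_closure; exact: rG.
by rewrite La; lra.
Qed.

(** The index [i0] witnesses that the dimension is positive and is the coordinate used for the
    perturbation in [max_principle]. *)
Lemma wh_max_principle (i0 : 'I_n) G f g : bounded_set G ->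
  weakly_harmonic G f -> weakly_harmonic G g ->
  {within closure G, continuous f} -> {within closure G, continuous g} ->
  (forall z, bdry G z -> f z <= g z) -> forall x, G x -> f x <= g x.
Proof.
move=> bG [oG wf] [_ wg] cf cg fg x Gx; rewrite -subr_le0.
apply: (@max_principle i0 G (fun y => f y - g y)) => //.
- exact: withinB.
- move=> y Gy; exists 0 => //; rewrite -[0]subr0.
  by apply: lapB; [have [] := wf y Gy|have [] := wg y Gy].
- by move=> z /fg; rewrite subr_le0.
Qed.

End SecondDifference.

(** * Gradient and Hessian bounds *)

Section Derivatives.
Variables (R : realType).

Lemma is_derive_epsP (W : normedModType R) (f : W -> R) (x v : W) (a : R) :
  is_derive x v f a <-> forall e, 0 < e -> exists2 d : R, 0 < d &
    forall h, `|h| < d -> `|f (x + h *: v) - f x - h * a| <= e * `|h|.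
Proof.
pose q h := h^-1 *: (f (h *: v + x) - f x).
have qE h b : h != 0 -> `|f (x + h *: v) - f x - h * b| = `|h| * `|b - q h|.
  move=> h0; have qh : h * q h = f (x + h *: v) - f x.
    by rewrite /q -[_ *: _]/(_ * _) mulrA divff// mul1r [x + _]addrC.
  by rewrite -qh -mulrBr normrM distrC.
split=> [[df <-] e e0|H].
  have /cvgrPdist_le/(_ e e0) : q h @[h --> 0^'] --> 'D_v f x by exact: df.
  rewrite /= => /nbhs_ballP[d /= d0 dP]; exists d => // h hd.
  have [->|h0] := eqVneq h 0.
    by rewrite scale0r addr0 subrr mul0r subrr normr0 mulr0.
  rewrite qE// mulrC ler_pM2r ?normr_gt0//.
  by apply: dP => //; rewrite /ball/= sub0r normrN.
have cq : q h @[h --> 0^'] --> a.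
  apply/cvgrPdist_le => e e0; have [d d0 dP] := H e e0.
  apply/nbhs_ballP; exists d => // h; rewrite /ball/= sub0r normrN => hd h0.
  by have := dP h hd; rewrite qE// mulrC ler_pM2r ?normr_gt0.
split; first by apply/cvg_ex; exists a.
exact: cvg_lim cq.
Qed.

Lemma is_derive_line (W : normedModType R) (f : W -> R) (x v : W) (t a : R) :
  is_derive (x + t *: v) v f a -> is_derive t 1 (fun s => f (x + s *: v)) a.
Proof.
move=> /is_derive_epsP H; apply/is_derive_epsP => e /H[d d0 dP].
exists d => // h hd; have := dP h hd.
by rewrite -[h *: 1]/(h * 1) mulr1 scalerDl addrA.
Qed.

Lemma is_derive_le (W : normedModType R) (f : W -> R) (x v : W) (a r C : R) : 0 < r ->
  (forall t, 0 < t -> t < r -> `|f (x + t *: v) - f (x - t *: v)| <= 2 * C * t) ->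
  is_derive x v f a -> `|a| <= C.
Proof.
move=> r0 fC /is_derive_epsP H; apply/ler_addgt0Pr => e e0.
have [d d0 dP] := H e e0.
pose t := Num.min d r / 2.
have m0 : 0 < Num.min d r by rewrite lt_min d0.
have t0 : 0 < t by rewrite divr_gt0.
have : t < Num.min d r by rewrite /t; lra.
rewrite lt_min => /andP[td tr].
have := fC t t0 tr; have := dP t; have := dP (- t).
rewrite normrN gtr0_norm// scaleNr => /(_ td) + /(_ td).
rewrite !ler_norml => /andP[h1 h2] /andP[h3 h4] /andP[h5 h6].
by apply/andP; split; rewrite -(ler_pM2r t0); lra.
Qed.

Lemma is_derive_lipschitz (W : normedModType R) (f : W -> R) (x v : W) (a r C : R) : 0 < r ->
  (forall t, 0 < t -> t < r -> `|f (x + t *: v) - f x| <= C * t) ->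
  is_derive x v f a -> `|a| <= C.
Proof.
move=> r0 fC /is_derive_epsP H; apply/ler_addgt0Pr => e e0.
have [d d0 dP] := H e e0.
pose t := Num.min d r / 2.
have m0 : 0 < Num.min d r by rewrite lt_min d0.
have t0 : 0 < t by rewrite divr_gt0.
have : t < Num.min d r by rewrite /t; lra.
rewrite lt_min => /andP[td tr].
have := fC t t0 tr; have := dP t; rewrite gtr0_norm// => /(_ td).
rewrite !ler_norml => /andP[h1 h2] /andP[h3 h4].
by apply/andP; split; rewrite -(ler_pM2r t0); lra.
Qed.

(** The mean value theorem for [F s = g s + g (- s) - a * s ^+ 2] on [[0, t]] leaves
    [t * (g1 c - g1 (- c) - 2 * a * c)], and differentiability of [g1] at the single point 0 makes
    the factor small compared with [c]. *)
Lemma second_diff (g g1 : R -> R) (a r : R) : 0 < r ->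
  (forall t : R, `|t| < r -> is_derive t 1 g (g1 t)) -> is_derive (0 : R) 1 g1 a ->
  forall e, 0 < e -> exists2 d : R, 0 < d & forall t, 0 < t -> t < d ->
  `|g t + g (- t) - 2 * g 0 - a * t ^+ 2| <= e * t ^+ 2.
Proof.
move=> r0 dg /is_derive_epsP dg1 e e0.
have [d d0 dP] := dg1 (e / 2) (divr_gt0 e0 (ltr0n _ 2)).
exists (Num.min d r); first by rewrite lt_min d0.
move=> t t0; rewrite lt_min => /andP[td tr].
pose F s := g s + g (- s) - a * s ^+ 2.
pose F1 s := g1 s - g1 (- s) - a * (2 * s).
have dF (s : R) : `|s| < r -> is_derive s 1 F (F1 s).
  move=> sr; have := dg s sr; have : is_derive (- s) 1 g (g1 (- s)) by apply: dg; rewrite normrN.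
  move=> /is_derive_epsP h1 /is_derive_epsP h2; apply/is_derive_epsP => e' e'0.
  (* Two errors of size [k] times the increment come from [g] at [s] and at [- s]; the square
     contributes a third one, which is linear in [k] because the increment is below [k]. *)
  pose k := e' / (2 + `|a|).
  have a0 : 0 < 2 + `|a| by rewrite ltr_wpDr.
  have k0 : 0 < k by rewrite divr_gt0.
  have [d1 d10 d1P] := h1 k k0; have [d2 d20 d2P] := h2 k k0.
  exists (Num.min k (Num.min d1 d2)); first by rewrite !lt_min k0 d10.
  move=> h; rewrite !lt_min => /and3P[hk h1d h2d].
  have := d1P (- h); rewrite normrN => /(_ h1d) {}d1P; have {}d2P := d2P h h2d.
  rewrite -[_ *: 1]/(_ * 1) mulr1 in d1P; rewrite -[_ *: 1]/(_ * 1) mulr1 in d2P.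
  rewrite /F /F1 -[_ *: 1]/(_ * 1) mulr1.
  rewrite (_ : _ - _ = (g (s + h) - g s - h * g1 s) + (g (- s - h) - g (- s) - - h * g1 (- s))
     - a * h * h); last by rewrite opprD; ring.
  apply: le_trans (ler_normB _ _) _.
  apply: le_trans (lerD (ler_normD _ _) (lexx _)) _.
  have : `|a * h * h| <= `|a| * k * `|h|.
    by rewrite !normrM ler_wpM2r// ler_wpM2l// ltW.
  have -> : e' = k * (2 + `|a|) by rewrite /k divfK// gt_eqF.
  lra.
have [||c] := @MVT R F F1 0 t t0.
- move=> s; rewrite in_itv/= => /andP[s0 st]; apply: dF; rewrite gtr0_norm//; exact: lt_trans tr.
- apply: continuous_in_subspaceT => s; rewrite inE/= in_itv/= => /andP[s0 st].
  have sr : `|s| < r by rewrite ger0_norm//; exact: le_lt_trans tr.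
  have [df _] := dF s sr.
  exact/differentiable_continuous/derivable1_diffP.
rewrite in_itv/= => /andP[c0 ct]; rewrite subr0 /F oppr0 expr0n/= mulr0 subr0 => Fc.
have -> : g t + g (- t) - 2 * g 0 - a * t ^+ 2 = F1 c * t by rewrite -Fc; ring.
rewrite normrM (gtr0_norm t0) [t ^+ 2]expr2 mulrA ler_pM2r//.
have cd : `|c| < d by rewrite gtr0_norm//; exact: lt_trans td.
have := dP c cd; have := dP (- c); rewrite normrN => /(_ cd).
rewrite -![_ *: 1]/(_ * 1) !mulr1 !add0r (gtr0_norm c0) !ler_norml /F1.
have : e * c <= e * t by rewrite ler_pM2l// ltW.
by move=> h0 /andP[h1 h2] /andP[h3 h4]; lra.
Qed.

End Derivatives.

(** * Interior estimates for first and second derivatives *)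

Section Gradient.
Variables (R : realType) (n : nat).
Local Notation V := 'rV[R]_n.
Implicit Types (x y : V) (A G : set V) (f g : V -> R).
Local Notation "''e_' i" := (ebasis R i) (at level 8, i at level 2, format "''e_' i").

Lemma contD f g x : {for x, continuous f} -> {for x, continuous g} ->
  {for x, continuous (fun y => f y + g y)}.
Proof. by move=> cf cg; exact: (cvgD cf cg). Qed.

Lemma contB f g x : {for x, continuous f} -> {for x, continuous g} ->
  {for x, continuous (fun y => f y - g y)}.
Proof. by move=> cf cg; exact: (cvgB cf cg). Qed.

Lemma contN f x : {for x, continuous f} -> {for x, continuous (fun y => - f y)}.
Proof. by move=> cf; exact: (cvgN cf). Qed.

Lemma contZ f (k : R) x : {for x, continuous f} -> {for x, continuous (fun y => k * f y)}.
Proof. by move=> cf; exact: (cvgM (cvg_cst k) cf). Qed.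

Lemma cont_normr f x : {for x, continuous f} -> {for x, continuous (fun y => `|f y|)}.
Proof. by move=> cf; exact: (cvg_norm cf). Qed.

Lemma cont_cst (k : R) x : {for x, continuous (fun _ : V => k)}.
Proof. by apply/cont_normP => e e0; exists 1 => // y _; rewrite subrr normr0. Qed.

Lemma cont_sum (F : 'I_n -> V -> R) x : (forall i, {for x, continuous (F i)}) ->
  {for x, continuous (fun y => \sum_i F i y)}.
Proof.
move=> cF; suff : forall s : seq 'I_n, {for x, continuous (fun y => \sum_(i <- s) F i y)}.
  exact.
elim=> [|i s IH].
  rewrite (_ : (fun y : V => _) = fun=> 0); first exact: cont_cst.
  by apply/funext => y; rewrite big_nil.
rewrite (_ : (fun y : V => _) = fun y => F i y + \sum_(j <- s) F j y); first exact: contD.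
by apply/funext => y; rewrite big_cons.
Qed.

Lemma harmonic_derive G f x i : harmonic_on G f -> G x ->
  is_derive x 'e_i f ('D_('e_i) f x).
Proof. by move=> [_ [h _]] Gx; have [_ /(_ i i)[df _]] := h x Gx; exact/derivableP. Qed.

Lemma harmonic_derive2 G f x i j : harmonic_on G f -> G x ->
  is_derive x 'e_i ('D_('e_j) f) ('D_('e_i) ('D_('e_j) f) x).
Proof.
by move=> [_ [h _]] Gx; have [_ /(_ i j)[_ [_ [df _]]]] := h x Gx; exact/derivableP.
Qed.

Lemma shift_ball_ebasis x i (r t : R) : `|t| < r -> `|x + t *: 'e_i - x| < r.
Proof. by move=> tr; rewrite addrC addKr normrZ norm_ebasis mulr1. Qed.

Lemma harmonic_weak G f : harmonic_on G f -> weakly_harmonic G f.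
Proof.
move=> hf; have [oG [h1 h2]] := hf; split => // x Gx; split; first by have [] := h1 x Gx.
exists (fun i => 'D_('e_i) ('D_('e_i) f) x); last exact: h2.
move=> i e e0; have [r r0 rG] := (open_normP _).1 oG x Gx.
have [||d d0 dP] := @second_diff _ (fun t => f (x + t *: 'e_i))
   (fun t => 'D_('e_i) f (x + t *: 'e_i)) ('D_('e_i) ('D_('e_i) f) x) r r0 _ _ e e0.
- move=> t tr; apply: is_derive_line; apply: harmonic_derive hf _.
  by apply: rG; exact: shift_ball_ebasis.
- by apply: (@is_derive_line _ _ ('D_('e_i) f) x); rewrite scale0r addr0; exact: harmonic_derive2 hf _.
exists d => // t t0 td; have := dP t t0 td.
by rewrite scaleNr scale0r addr0.
Qed.

Lemma weakly_harmonicS A G f : open A -> A `<=` G -> weakly_harmonic G f -> weakly_harmonic A f.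
Proof. by move=> oA AG [_ wf]; split=> // x /AG/wf. Qed.

Lemma harmonic_onS A G f : open A -> A `<=` G -> harmonic_on G f -> harmonic_on A f.
Proof.
by move=> oA AG [_ [h1 h2]]; split=> //; split=> x /AG; [exact: h1|exact: h2].
Qed.

Lemma weakly_harmonicB G f g : weakly_harmonic G f -> weakly_harmonic G g ->
  weakly_harmonic G (fun x => f x - g x).
Proof.
move=> [oG wf] [_ wg]; split=> // x Gx; have [cf lf] := wf x Gx; have [cg lg] := wg x Gx.
by split; [exact: contB|rewrite -[0]subr0; exact: lapB].
Qed.

Lemma weakly_harmonicN G f : weakly_harmonic G f -> weakly_harmonic G (fun x => - f x).
Proof.
move=> [oG wf]; split=> // x Gx; have [cf lf] := wf x Gx.
split; first exact: contN.
have := lapZ (-1) lf; rewrite mulr0; apply: (lap_ext ltr01) => y _.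
by rewrite mulN1r.
Qed.

Lemma cont_shift f c x : {for x + c, continuous f} -> {for x, continuous (fun y => f (y + c))}.
Proof.
move=> /cont_normP cf; apply/cont_normP => e /cf[d d0 dP]; exists d => // y yx.
by apply: dP; rewrite opprD addrACA subrr addr0.
Qed.

Lemma lap_sum (F : 'I_n -> V -> R) (L : 'I_n -> R) x :
  (forall i, laplacian_at (F i) x (L i)) ->
  laplacian_at (fun y => \sum_i F i y) x (\sum_i L i).
Proof.
move=> FL; suff : forall s : seq 'I_n,
    laplacian_at (fun y => \sum_(i <- s) F i y) x (\sum_(i <- s) L i) by exact.
elim=> [|i s IH].
  exists (fun=> 0); last by rewrite big_nil big1.
  move=> j; apply: (@sd2_quad _ _ _ _ _ _ 1) => // t _ _.
  by rewrite !big_nil; ring.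
rewrite big_cons; have := lapD (FL i) IH.
by apply: (lap_ext ltr01) => y _; rewrite big_cons.
Qed.

Definition reflect_coord (c : V) i y : V := y - (2 * (y 0 i - c 0 i)) *: 'e_i.

Lemma reflect_coordE c i y j : reflect_coord c i y 0 j =
  if j == i then 2 * c 0 i - y 0 i else y 0 j.
Proof.
by rewrite !mxE eqxx/=; case: eqVneq => [->|_] /=; ring.
Qed.

Lemma reflect_coord_norm c i y z :
  `|reflect_coord c i y - reflect_coord c i z| <= `|y - z|.
Proof.
apply: norm_le_coord => // j.
have -> : (reflect_coord c i y - reflect_coord c i z) 0 j =
   reflect_coord c i y 0 j - reflect_coord c i z 0 j by rewrite !mxE.
rewrite !reflect_coordE; have [ji|_] := eqVneq j i.
  rewrite (_ : _ - _ = - (y - z) 0 i) ?normrN ?coord_le_norm// !mxE; ring.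
by rewrite (_ : _ - _ = (y - z) 0 j) ?coord_le_norm// !mxE.
Qed.

Lemma reflect_coordD c i y (t : R) j : reflect_coord c i (y + t *: 'e_j) =
  reflect_coord c i y + (if j == i then - t else t) *: 'e_j.
Proof.
apply/rowP => k; rewrite reflect_coordE [RHS]mxE reflect_coordE !mxE eqxx/=.
have [ki|ki] := eqVneq k i; have [ji|ji] := eqVneq j i; rewrite ?ki ?ji;
  rewrite ?eqxx/= ?(negbTE ki)//= ?mulr0 ?addr0 ?mulr1//; try ring.
- by rewrite eq_sym (negbTE ji) !mulr0 !addr0.
Qed.

(** Along the reflected axis [t] becomes [- t], and second differences are even in [t]; the other
    axes are untouched. *)
Lemma lap_reflect f c i x L : laplacian_at f (reflect_coord c i x) L ->
  laplacian_at (fun y => f (reflect_coord c i y)) x L.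
Proof.
move=> [a sa <-]; exists a => // j e e0; have [d d0 dP] := sa j e e0.
exists d => // t t0 td; have := dP t t0 td.
rewrite -!scaleNr !reflect_coordD; case: eqP => _ //.
by rewrite opprK [f _ + f _]addrC.
Qed.

(** The odd part [f y - f (reflect_coord c i y)] vanishes on the hyperplane through [c] and is at
    most [2 * M] on the cube. On the half cube it is dominated by [2 * B], and on the axis [B] grows
    linearly from 0. *)
Lemma wh_one_sided G f c (d M t : R) i : weakly_harmonic G f -> 0 < d ->
  (forall y, `|y - c| <= d -> G y) -> (forall y, `|y - c| <= d -> `|f y| <= M) ->
  0 < t -> t < d -> f (c + t *: 'e_i) - f (c - t *: 'e_i) <= 2 * (n%:R * M / d) * t.
Proof.
move=> [oG wf] d0 dG fM t0 td.
have M0 : 0 <= M.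
  by apply: le_trans (normr_ge0 _) (fM c _); rewrite subrr normr0 ltW.
pose q (y : V) := \sum_j (y 0 j - c 0 j) ^+ 2.
(* With [s = y 0 i - c 0 i] this is [M / d ^+ 2 * (q + n * s * (d - s))]. The Laplacians [2 n] of
   [q] and of [n * s ^+ 2] cancel. Both summands are nonnegative on the half cube, and [q >= d ^+ 2]
   on the faces at distance [d], whence [B >= M] there. *)
pose B y := M / d ^+ 2 * (q y - n%:R * (y 0 i - c 0 i) ^+ 2 +
                          (n%:R * d * y 0 i + (- (n%:R * d * c 0 i)))).
pose w y := (f y - f (reflect_coord c i y)) - 2 * B y.
pose Om := [set y : V | `|y - c| < d /\ 0 < y 0 i - c 0 i].
have rc y : `|y - c| <= d -> `|reflect_coord c i y - c| <= d.
  have cE : reflect_coord c i c = c by rewrite /reflect_coord subrr mulr0 scale0r subr0.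
  by move=> yc; rewrite -[X in _ - X]cE; exact: le_trans (reflect_coord_norm _ _ _ _) yc.
have clOm z : closure Om z -> `|z - c| <= d /\ 0 <= z 0 i - c 0 i.
  move=> cz; split; first by apply: closure_norm_le cz => y [/ltW].
  rewrite leNgt; apply/negP => zi.
  have [|y [_ yi] yz] := (closure_normP _ _).1 cz (- (z 0 i - c 0 i)).
    by rewrite oppr_gt0.
  have := le_lt_trans (coord_le_norm (y - z) i) yz.
  by rewrite !mxE ltr_norml => /andP[_]; lra.
have cw y : `|y - c| <= d -> {for y, continuous w}.
  move=> yc; have [cf _] := wf y (dG y yc); have [cfr _] := wf _ (dG _ (rc y yc)).
  have cr : {for y, continuous (fun y => f (reflect_coord c i y))}.
    move/cont_normP : cfr => cfr; apply/cont_normP => e /cfr[r r0 rP]; exists r => // z zy.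
    by apply: rP; exact: le_lt_trans (reflect_coord_norm _ _ _ _) zy.
  have cB : {for y, continuous B}.
    apply: contZ; apply: contD.
      apply: contB; last by apply: contZ; exact: cont_coord_sqr.
      by apply: cont_sum => j; exact: cont_coord_sqr.
    apply: contD; last exact: cont_cst.
    by apply: contZ; exact: coord_continuous.
  by apply: contB; [exact: contB|exact: contZ].
have lB y : laplacian_at B y 0.
  have := lapZ (M / d ^+ 2) (lapD (lapB (lap_sum (fun j => lap_coord_sqr c y j))
     (lapZ n%:R (lap_coord_sqr c y i)))
    (lap_affine (n%:R * d) (- (n%:R * d * c 0 i)) y i)).
  by rewrite sumr_const card_ord addr0 -[2 *+ n]mulr_natl subrr mulr0.
have := @max_principle R n i Om w 0.
have oOm : open Om.
  apply/open_normP => y [yc yi].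
  exists (Num.min (d - `|y - c|) (y 0 i - c 0 i)); first by rewrite lt_min yi subr_gt0 yc.
  move=> z; rewrite lt_min => /andP[z1 z2]; split.
    rewrite -(subrK y z) -addrA; apply: le_lt_trans (ler_normD _ _) _; lra.
  have := le_lt_trans (coord_le_norm (z - y) i) z2.
  by rewrite !mxE ltr_norml => /andP[]; lra.
move=> /(_ oOm) mp.
have {mp}mp : forall z, Om z -> w z <= 0.
  apply: mp.
  - apply/bounded_setP; exists (d + `|c|) => y [yc _].
    by rewrite -(subrK c y); apply: le_trans (ler_normD _ _) _; rewrite lerD2r ltW.
  - by apply: within_cont => y /clOm[/cw].
  - move=> y [/ltW yc _]; exists 0 => //.
    have [_ l1] := wf y (dG y yc); have [_ l2] := wf _ (dG _ (rc y yc)).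
    have := lapB (lapB l1 (lap_reflect l2)) (lapZ 2 (lB y)).
    by rewrite mulr0 !subr0.
  move=> z [/clOm[zc zi] zOm].
  have zi' : z 0 i - c 0 i <= d.
    by apply: le_trans zc; apply: le_trans (coord_le_norm _ i); rewrite !mxE ler_norm.
  have q0 : 0 <= q z by apply: sumr_ge0 => j _; exact: sqr_ge0.
  have BE : B z = M / d ^+ 2 * (q z + n%:R * ((z 0 i - c 0 i) * (d - (z 0 i - c 0 i)))).
    by rewrite /B; congr (_ * _); ring.
  have p0 : 0 <= n%:R * ((z 0 i - c 0 i) * (d - (z 0 i - c 0 i))).
    by rewrite !mulr_ge0// subr_ge0.
  have Md0 : 0 <= M / d ^+ 2 by rewrite divr_ge0// sqr_ge0.
  have [zlt|dz] := ltP `|z - c| d.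
    have z0 : z 0 i - c 0 i = 0.
      apply/eqP; rewrite eq_le zi andbT leNgt; apply/negP => z0; exact: zOm.
    rewrite /w /reflect_coord z0 mulr0 scale0r subr0 subrr sub0r oppr_le0.
    by rewrite BE mulr_ge0// mulr_ge0// addr_ge0.
  have zd : `|z - c| = d by apply/eqP; rewrite eq_le zc.
  have [j] : exists j, `|(z - c) 0 j| = `|z - c| by apply: norm_eq_coord; rewrite zd.
  rewrite zd !mxE => jd.
  have qd : d ^+ 2 <= q z.
    rewrite /q (bigD1 j)//= -[(z 0 j - _) ^+ 2]real_normK ?num_real// jd lerDl.
    by apply: sumr_ge0 => k _; exact: sqr_ge0.
  have MB : M <= B z.
    have {1}-> : M = M / d ^+ 2 * d ^+ 2 by rewrite divfK// gt_eqF// exprn_gt0.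
    by rewrite BE; apply: ler_wpM2l => //; lra.
  have := fM z zc; have := fM _ (rc z zc).
  rewrite !ler_norml /w => /andP[h1 h2] /andP[h3 h4]; lra.
have Omt : Om (c + t *: 'e_i).
  split; first by apply: shift_ball_ebasis; rewrite gtr0_norm.
  by rewrite !mxE !eqxx/= mulr1 addrAC subrr add0r.
have := mp _ Omt; rewrite /w subr_le0.
have -> : reflect_coord c i (c + t *: 'e_i) = c - t *: 'e_i.
  by rewrite reflect_coordD eqxx /reflect_coord subrr mulr0 scale0r subr0 scaleNr.
move=> /le_trans; apply; rewrite -mulrA ler_pM2l//.
have si : (c + t *: 'e_i) 0 i - c 0 i = t by rewrite !mxE !eqxx/= mulr1 addrAC subrr add0r.
have qt : q (c + t *: 'e_i) = t ^+ 2.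
  rewrite /q (bigD1 i)//= si big1 ?addr0// => j ji.
  by rewrite !mxE (negbTE ji) andbF mulr0 addr0 subrr expr0n.
have -> : B (c + t *: 'e_i) = M / d ^+ 2 * (t ^+ 2 - n%:R * t ^+ 2 + n%:R * d * t).
  have yi : (c + t *: 'e_i) 0 i = c 0 i + t by rewrite !mxE !eqxx/= mulr1.
  by rewrite /B qt yi; congr (_ * _); ring.
have n1 : 1 <= n%:R :> R by rewrite ler1n (leq_trans _ (ltn_ord i)).
have -> : n%:R * M / d * t = M / d ^+ 2 * (n%:R * d * t) by field; rewrite gt_eqF.
apply: ler_wpM2l; first by rewrite divr_ge0// sqr_ge0.
by have := sqr_ge0 t; nra.
Qed.

Lemma wh_lip G f c (d M t : R) i : weakly_harmonic G f -> 0 < d ->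
  (forall y, `|y - c| <= d -> G y) -> (forall y, `|y - c| <= d -> `|f y| <= M) ->
  0 < t -> t < d -> `|f (c + t *: 'e_i) - f (c - t *: 'e_i)| <= 2 * (n%:R * M / d) * t.
Proof.
move=> wf d0 dG fM t0 td; rewrite ler_norml; apply/andP; split; last exact: wh_one_sided dG fM _ _.
have fMN y : `|y - c| <= d -> `|- f y| <= M by move=> /fM; rewrite normrN.
have := wh_one_sided i (weakly_harmonicN wf) d0 dG fMN t0 td.
by rewrite opprK lerNl opprB addrC.
Qed.

Lemma wh_grad G f c (d M a : R) i : weakly_harmonic G f -> 0 < d ->
  (forall y, `|y - c| <= d -> G y) -> (forall y, `|y - c| <= d -> `|f y| <= M) ->
  is_derive c 'e_i f a -> `|a| <= n%:R * M / d.
Proof.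
move=> wf d0 dG fM; apply: (is_derive_le d0) => t t0 td.
exact: wh_lip wf d0 dG fM t0 td.
Qed.

(** Stated for a difference of two functions because its use is to show that derivatives of a
    convergent sequence are Cauchy. *)
Lemma harmonic_grad_dist G u v c (d M : R) i : harmonic_on G u -> harmonic_on G v -> 0 < d ->
  (forall y, `|y - c| <= d -> G y) -> (forall y, `|y - c| <= d -> `|u y - v y| <= M) ->
  `|'D_('e_i) u c - 'D_('e_i) v c| <= n%:R * M / d.
Proof.
move=> hu hv d0 dG uvM; have Gc : G c by apply: dG; rewrite subrr normr0 ltW.
have wuv := weakly_harmonicB (harmonic_weak hu) (harmonic_weak hv).
apply: (wh_grad wuv d0 dG uvM (i := i)).
by apply: is_deriveB; [exact: harmonic_derive hu Gc|exact: harmonic_derive hv Gc].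
Qed.

(** The increment of [w = u - v] over a step [s] along axis [i] is weakly harmonic on a cube of
    radius [d / 2] and bounded there by [2 * n * M * s / d]. The gradient bound on radius [d / 4]
    multiplies this by [4 * n / d]; dividing by [s] gives the constant. *)
Lemma harmonic_hess_dist G u v c (d M : R) i j : harmonic_on G u -> harmonic_on G v -> 0 < d ->
  (forall y, `|y - c| <= d -> G y) -> (forall y, `|y - c| <= d -> `|u y - v y| <= M) ->
  `|'D_('e_i) ('D_('e_j) u) c - 'D_('e_i) ('D_('e_j) v) c| <= 8 * n%:R ^+ 2 * M / d ^+ 2.
Proof.
move=> hu hv d0 dG uvM; have Gc : G c by apply: dG; rewrite subrr normr0 ltW.
pose w y := u y - v y.
have ww : weakly_harmonic G w := weakly_harmonicB (harmonic_weak hu) (harmonic_weak hv).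
have M0 : 0 <= M.
  by apply: le_trans (normr_ge0 _) (uvM c _); rewrite subrr normr0 ltW.
have tri (x y z : V) (r1 r2 r3 : R) : `|x - y| <= r1 -> `|y - z| <= r2 -> r1 + r2 <= r3 -> `|x - z| <= r3.
  by move=> h1 h2; apply: le_trans; rewrite -(subrK y x) -addrA; apply: le_trans (ler_normD _ _) (lerD _ _).
have shift_le x k (s : R) : `|x + s *: 'e_k - x| <= `|s|.
  by rewrite addrC addKr normrZ norm_ebasis mulr1.
have key s : 0 < s -> s < d / 4 -> forall x, `|x - c| <= d / 4 ->
    `|w (x + s *: 'e_i) - w x| <= 2 * n%:R * M * s / d.
  (* The symmetric Lipschitz bound is centred at the midpoint, so that it controls the one-sided
     increment from [x]. *)
  move=> s0 sd x xc; pose z := x + (s / 2) *: 'e_i.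
  have s20 : 0 < s / 2 by rewrite divr_gt0.
  have zc : `|z - c| <= d / 2.
    apply: (@tri z x c (s / 2) (d / 4)) => //; last by lra.
    by apply: le_trans (shift_le _ _ _) _; rewrite gtr0_norm.
  have d20 : 0 < d / 2 by rewrite divr_gt0.
  have zG y : `|y - z| <= d / 2 -> `|y - c| <= d by move=> yz; apply: tri yz zc _; lra.
  have := @wh_lip G w z (d / 2) M (s / 2) i ww d20.
  move=> /(_ (fun y yz => dG y (zG y yz)) (fun y yz => uvM y (zG y yz)) s20).
  have -> : z + (s / 2) *: 'e_i = x + s *: 'e_i.
    by rewrite /z -addrA -scalerDl -splitr.
  have -> : z - (s / 2) *: 'e_i = x by rewrite /z addrK.
  have s2d : s / 2 < d / 2 by lra.
  move=> /(_ s2d) /le_trans; apply; rewrite le_eqVlt; apply/orP; left; apply/eqP.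
  by field; rewrite gt_eqF.
pose Dw y := 'D_('e_j) u y - 'D_('e_j) v y.
have dw x : G x -> is_derive x 'e_j w (Dw x).
  by move=> Gx; apply: is_deriveB; [exact: harmonic_derive hu Gx|exact: harmonic_derive hv Gx].
have d40 : 0 < d / 4 by rewrite divr_gt0.
have Dws s : 0 < s -> s < d / 4 -> `|Dw (c + s *: 'e_i) - Dw c| <= 8 * n%:R ^+ 2 * M / d ^+ 2 * s.
  move=> s0 sd; pose Om := [set x : V | `|x - c| < d / 2].
  have cs : `|c + s *: 'e_i - c| <= d / 4.
    by apply: le_trans (shift_le _ _ _) _; rewrite gtr0_norm// ltW.
  have Om1 x : Om x -> `|x + s *: 'e_i - c| <= d.
    move=> /ltW xc; apply: (tri _ x _ (d / 4)) xc _; last by lra.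
    by apply: le_trans (shift_le _ _ _) _; rewrite gtr0_norm// ltW.
  have wOm : weakly_harmonic Om (fun x => w (x + s *: 'e_i) - w x).
    have oOm : open Om.
      apply/open_normP => y yc; exists (d / 2 - `|y - c|); first by rewrite subr_gt0.
      move=> z zy; rewrite /Om/= -(subrK y z) -addrA.
      by apply: le_lt_trans (ler_normD _ _) _; lra.
    apply: weakly_harmonicB; split => // x Omx; last first.
      by apply: ww.2; apply: dG; move/ltW : Omx => /le_trans; apply; lra.
    have [cw lw] := ww.2 _ (dG _ (Om1 x Omx)).
    by split; [exact: cont_shift|exact: lap_shift].
  have -> : 8 * n%:R ^+ 2 * M / d ^+ 2 * s = n%:R * (2 * n%:R * M * s / d) / (d / 4).
    by field; rewrite gt_eqF.
  apply: (wh_grad (i := j) wOm d40).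
  - by move=> y yc; rewrite /Om/=; apply: (le_lt_trans yc); lra.
  - by move=> y /key; exact.
  - apply: is_deriveB; last exact: dw.
    have Gcs : G (c + s *: 'e_i) by apply: dG; apply: le_trans cs _; lra.
    have /is_derive_epsP H := dw _ Gcs; apply/is_derive_epsP => e /H[r r0 rP].
    by exists r => // h hr; rewrite (addrAC c); exact: rP.
have dD : is_derive c 'e_i Dw ('D_('e_i) ('D_('e_j) u) c - 'D_('e_i) ('D_('e_j) v) c).
  by apply: is_deriveB; [exact: harmonic_derive2 hu Gc|exact: harmonic_derive2 hv Gc].
exact: (is_derive_lipschitz d40 Dws dD).
Qed.

End Gradient.

(** * Locally uniform limits of harmonic functions *)

Section Limits.
Variables (R : realType) (n : nat).
Local Notation V := 'rV[R]_n.
Implicit Types (x y : V) (A G : set V) (f g : V -> R).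
Local Notation "''e_' i" := (ebasis R i) (at level 8, i at level 2, format "''e_' i").

Lemma cauchy_real (a : nat -> R) :
  (forall e, 0 < e -> exists K, forall k l, (K <= k)%N -> (K <= l)%N -> `|a k - a l| <= e) ->
  forall e, 0 < e -> exists K, forall k, (K <= k)%N -> `|a k - lim (a @ \oo)| <= e.
Proof.
move=> ca; have cva : cvg (a @ \oo).
  apply: cauchy_cvg; apply/cauchy_ballP => e e0; rewrite near_simpl.
  have [K KP] := ca (e / 2) (divr_gt0 e0 (ltr0n _ 2)).
  exists ([set k | (K <= k)%N], [set k | (K <= k)%N]) => /=.
    by split; exists K.
  move=> [k l] /= [Kk Kl]; rewrite -ball_normE /ball_/=.
  by apply: le_lt_trans (KP k l Kk Kl) _; lra.
move=> e e0; have /cvgrPdist_le/(_ e e0)[K _ KP] := cva.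
by exists K => k /KP; rewrite distrC.
Qed.

(** [lim] has a default value where the sequence diverges; this function is relied upon only where
    the sequence is Cauchy. *)
Definition limfun (g : nat -> V -> R) y : R := lim ((fun k => g k y) @ \oo).

Definition unif_lim A (g : nat -> V -> R) F := forall e, 0 < e ->
  exists K, forall k, (K <= k)%N -> forall y, A y -> `|g k y - F y| <= e.

Lemma unif_cauchy A (g : nat -> V -> R) :
  (forall e, 0 < e -> exists K, forall k l, (K <= k)%N -> (K <= l)%N ->
     forall y, A y -> `|g k y - g l y| <= e) -> unif_lim A g (limfun g).
Proof.
move=> cg e e0; have [K KP] := cg (e / 2) (divr_gt0 e0 (ltr0n _ 2)).
exists K => k Kk y Ay.
have [|L LP] := @cauchy_real (fun k => g k y) _ (e / 2) (divr_gt0 e0 (ltr0n _ 2)).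
  by move=> e' /cg[K' K'P]; exists K' => i j Ki Kj; exact: K'P.
rewrite (splitr e); apply: le_trans (ler_distD (g (maxn K L) y) _ _) _.
by apply: lerD; [apply: KP => //; exact: leq_maxl|apply: LP; exact: leq_maxr].
Qed.

Lemma unif_limS A B (g : nat -> V -> R) F : A `<=` B -> unif_lim B g F -> unif_lim A g F.
Proof. by move=> AB uB e /uB[K KP]; exists K => k Kk y /AB; exact: KP. Qed.

Lemma unif_lim_cont x (r : R) (g : nat -> V -> R) F : 0 < r ->
  (forall k, {for x, continuous (g k)}) -> unif_lim [set y | `|y - x| < r] g F ->
  {for x, continuous F}.
Proof.
move=> r0 cg ug; apply/cont_normP => e e0; have e40 : 0 < e / 4 by rewrite divr_gt0.
have [K KP] := ug _ e40; have {}KP := KP K (leqnn K).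
have [d d0 dP] := (cont_normP _ _).1 (cg K) _ e40.
exists (Num.min d r); first by rewrite lt_min d0.
move=> y; rewrite lt_min => /andP[yd yr].
have h1 := KP y yr; have h2 := dP y yd.
have := KP x; rewrite /= subrr normr0 => /(_ r0) h3.
move: h1 h2 h3; rewrite !ler_norml !ltr_norml.
by move=> /andP[? ?] /andP[? ?] /andP[? ?]; apply/andP; split; lra.
Qed.

Lemma mvt_bound (F F1 : R -> R) (h C : R) :
  (forall s : R, `|s| <= `|h| -> is_derive s 1 F (F1 s)) ->
  (forall s, `|s| <= `|h| -> `|F1 s| <= C) -> `|F h - F 0| <= C * `|h|.
Proof.
move=> dF FC.
have cF (a b : R) : (forall s, s \in `[a, b] -> `|s| <= `|h|) -> {within `[a, b], continuous F}.
  move=> ab; apply: continuous_in_subspaceT => s; rewrite inE/= => sab.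
  have [df _] := dF s (ab s sab).
  exact/differentiable_continuous/derivable1_diffP.
have [h0|h0|->] := ltgtP h 0; last by rewrite subrr normr0 mulr0.
- have hs s : s \in `[h, 0] -> `|s| <= `|h|.
    by rewrite in_itv/= => /andP[hs s0]; rewrite (ltr0_norm h0) (ler0_norm s0) lerN2.
  have [||c ch] := @MVT R F F1 h 0 h0; [|exact: cF|].
    by move=> s sh; apply: dF; apply: hs; exact: subset_itv_oo_cc.
  move=> E; rewrite distrC E sub0r normrM normrN ler_wpM2r// FC// hs//.
  exact: subset_itv_oo_cc.
- have hs s : s \in `[0, h] -> `|s| <= `|h|.
    by rewrite in_itv/= => /andP[s0 sh]; rewrite (gtr0_norm h0) (ger0_norm s0).
  have [||c ch] := @MVT R F F1 0 h h0; [|exact: cF|].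
    by move=> s sh; apply: dF; apply: hs; exact: subset_itv_oo_cc.
  move=> ->; rewrite subr0 normrM ler_wpM2r// FC// hs//.
  exact: subset_itv_oo_cc.
Qed.

(** The mean value theorem for [f K - f l] on the segment turns uniform closeness of the derivatives
    into closeness of the increments, with a bound independent of [l]; the functions themselves need
    only converge pointwise. *)
Lemma unif_lim_derive x (r : R) (f g : nat -> V -> R) F w i :
  (forall k y, `|y - x| < r -> is_derive y 'e_i (f k) (g k y)) ->
  (forall y, `|y - x| < r -> unif_lim [set y] f F) ->
  unif_lim [set y | `|y - x| < r] g w ->
  forall y, `|y - x| < r -> is_derive y 'e_i F (w y).
Proof.
move=> df fF gw y yr; apply/is_derive_epsP => e e0.
have e80 : 0 < e / 8 by rewrite divr_gt0.
have [K KP] := gw _ e80.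
have /is_derive_epsP/(_ _ e80)[d d0 dP] := df K y yr.
exists (Num.min d (r - `|y - x|)); first by rewrite lt_min d0 subr_gt0.
move=> h; rewrite lt_min => /andP[hd hr].
have near_y (s : R) : `|s| <= `|h| -> `|y + s *: 'e_i - x| < r.
  move=> sh; rewrite addrAC; apply: le_lt_trans (ler_normD _ _) _.
  by rewrite normrZ norm_ebasis mulr1; lra.
have step l : (K <= l)%N ->
    `|(f K (y + h *: 'e_i) - f l (y + h *: 'e_i)) - (f K y - f l y)| <= e / 4 * `|h|.
  move=> Kl; pose p s := f K (y + s *: 'e_i) - f l (y + s *: 'e_i).
  have := @mvt_bound p (fun s => g K (y + s *: 'e_i) - g l (y + s *: 'e_i)) h (e / 4).
  rewrite /p scale0r addr0; apply.
    by move=> s /near_y ys; apply: is_deriveB; apply: is_derive_line; exact: df.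
  move=> s /near_y ys; have := KP K (leqnn K) _ ys; have := KP l Kl _ ys.
  by rewrite !ler_norml => /andP[? ?] /andP[? ?]; apply/andP; split; lra.
(* Here [l] tends to infinity with [K] fixed; it has to be large only for the two endpoints of the
   segment. *)
have stepF : `|(f K (y + h *: 'e_i) - F (y + h *: 'e_i)) - (f K y - F y)| <= e / 4 * `|h|.
  apply/ler_addgt0Pr => e' e'0; have e'20 : 0 < e' / 2 by rewrite divr_gt0.
  have [K1 K1P] := fF _ (near_y h (lexx _)) _ e'20.
  have [K2 K2P] := fF y yr _ e'20.
  pose l := maxn K (maxn K1 K2).
  have Kl : (K <= l)%N by rewrite leq_maxl.
  have K1l : (K1 <= l)%N by rewrite /l maxnCA leq_maxl.
  have K2l : (K2 <= l)%N by rewrite /l maxnA leq_maxr.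
  have := step l Kl; have := K1P l K1l _ erefl; have := K2P l K2l _ erefl.
  by rewrite !ler_norml => /andP[? ?] /andP[? ?] /andP[? ?]; apply/andP; split; lra.
have := dP h hd; have := KP K (leqnn K) y yr => gKw.
have : `|h * (g K y - w y)| <= `|h| * (e / 8) by rewrite normrM ler_wpM2l.
move: stepF; rewrite !ler_norml => /andP[? ?] /andP[? ?] /andP[? ?].
by apply/andP; split; lra.
Qed.

Lemma small_factor (c e : R) : 0 <= c -> 0 < e -> 0 < e / (c + 1) /\ c * (e / (c + 1)) <= e.
Proof.
move=> c0 e0; have c1 : 0 < c + 1 by rewrite ltr_wpDl.
split; first exact: divr_gt0.
by rewrite mulrCA ger_pMr// ler_pdivrMr// mul1r lerDl.
Qed.

Lemma sum_dist (a b : 'I_n -> R) (c : R) : \sum_i a i = 0 ->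
  (forall i, `|a i - b i| <= c) -> `|\sum_i b i| <= n%:R * c.
Proof.
move=> a0 ab; have -> : \sum_i b i = - \sum_i (a i - b i) by rewrite sumrB a0 sub0r opprK.
rewrite normrN; apply: le_trans (ler_norm_sum _ _ _) _.
apply: (@le_trans _ _ (\sum_(i < n) c)); first by apply: ler_sum => i _; exact: ab.
by rewrite sumr_const card_ord -[leLHS]mulr_natl.
Qed.

(** The estimates for [u k - u l] make the first and second partial derivatives locally uniformly
    Cauchy. Two applications of [unif_lim_derive] identify their limits with derivatives of [v], and
    the vanishing trace passes to the limit as a finite sum. *)
Theorem harmonic_limit G (u : nat -> V -> R) v : open G ->
  (forall k, harmonic_on G (u k)) ->
  (forall x, G x -> exists2 r : R, 0 < r & unif_lim [set y | `|y - x| < r] u v) ->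
  harmonic_on G v.
Proof.
move=> oG hu uv.
pose Dv j := limfun (fun k => 'D_('e_j) (u k)).
pose DDv i j := limfun (fun k => 'D_('e_i) ('D_('e_j) (u k))).
have main x : G x -> exists2 r : R, 0 < r & [/\ forall y, `|y - x| < r -> G y,
    unif_lim [set y | `|y - x| < r] u v,
    forall j, unif_lim [set y | `|y - x| < r] (fun k => 'D_('e_j) (u k)) (Dv j) &
    forall i j, unif_lim [set y | `|y - x| < r]
      (fun k => 'D_('e_i) ('D_('e_j) (u k))) (DDv i j)].
  move=> Gx; have [r1 r10 ru] := uv x Gx; have [r2 r20 rG] := (open_normP _).1 oG x Gx.
  pose r := Num.min r1 r2.
  have r0 : 0 < r by rewrite lt_min r10.
  have rr1 : r <= r1 by rewrite ge_min lexx.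
  have rr2 : r <= r2 by rewrite ge_min lexx orbT.
  have r40 : 0 < r / 4 by rewrite divr_gt0.
  have r2r : r / 2 < r by lra.
  (* A point of the half ball keeps a closed ball of radius [r / 4] inside the ball of radius [r];
     the gradient and Hessian estimates are applied on it. *)
  have ball2 y : `|y - x| < r / 2 -> forall z, `|z - y| <= r / 4 -> `|z - x| < r.
    move=> yx z zy; rewrite -(subrK y z) -addrA; apply: le_lt_trans (ler_normD _ _) _.
    lra.
  have uC e : 0 < e -> exists K, forall k l, (K <= k)%N -> (K <= l)%N ->
      forall y, `|y - x| < r -> `|u k y - u l y| <= e.
    move=> e0; have [K KP] := ru (e / 2) (divr_gt0 e0 (ltr0n _ 2)).
    exists K => k l Kk Kl y yr; have yr1 := lt_le_trans yr rr1.
    have := KP k Kk y yr1; have := KP l Kl y yr1.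
    by rewrite !ler_norml => /andP[? ?] /andP[? ?]; apply/andP; split; lra.
  exists (r / 2); first by rewrite divr_gt0.
  split.
  - by move=> y yr; apply: rG; lra.
  - by apply: unif_limS ru => y /= yr; lra.
  - move=> j; apply: unif_cauchy => e e0.
    have c0 : 0 <= n%:R / (r / 4) by rewrite divr_ge0// ltW.
    have [e'0 e'e] := small_factor c0 e0.
    have [K KP] := uC _ e'0.
    exists K => k l Kk Kl y /= yr.
    apply: le_trans (harmonic_grad_dist j (hu k) (hu l) r40 _ _) _.
    + by move=> z /(ball2 y yr) zx; apply: rG; lra.
    + by move=> z /(ball2 y yr); exact: KP.
    by rewrite mulrAC.
  - move=> i j; apply: unif_cauchy => e e0.
    have c0 : 0 <= 8 * n%:R ^+ 2 / (r / 4) ^+ 2 by rewrite divr_ge0 ?sqr_ge0// mulr_ge0 ?sqr_ge0.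
    have [e'0 e'e] := small_factor c0 e0.
    have [K KP] := uC _ e'0.
    exists K => k l Kk Kl y /= yr.
    apply: le_trans (harmonic_hess_dist i j (hu k) (hu l) r40 _ _) _.
    + by move=> z /(ball2 y yr) zx; apply: rG; lra.
    + by move=> z /(ball2 y yr); exact: KP.
    by rewrite mulrAC.
have ptw A (g : nat -> V -> R) F y : A y -> unif_lim A g F -> unif_lim [set y] g F.
  by move=> Ay; apply: unif_limS => z ->.
have dv x i : G x -> is_derive x 'e_i v (Dv i x).
  move=> Gx; have [r r0 [rG ru rD _]] := main x Gx.
  apply: (@unif_lim_derive x r u (fun k => 'D_('e_i) (u k)) v (Dv i) i) => //.
  - by move=> k y /rG Gy; exact: harmonic_derive (hu k) Gy.
  - by move=> y yr; exact: (ptw _ _ _ _ yr ru).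
  - by rewrite subrr normr0.
have DvE x i : G x -> 'D_('e_i) v x = Dv i x by move=> Gx; have [_ ->] := dv x i Gx.
have ulE A (g : nat -> V -> R) F F' : (forall y, A y -> F' y = F y) -> unif_lim A g F -> unif_lim A g F'.
  by move=> E H e /H[K KP]; exists K => k Kk y Ay; rewrite E//; exact: KP.
have ddv x i j : G x -> is_derive x 'e_i ('D_('e_j) v) (DDv i j x).
  move=> Gx; have [r r0 [rG ru rD rDD]] := main x Gx.
  apply: (@unif_lim_derive x r (fun k => 'D_('e_j) (u k))
           (fun k => 'D_('e_i) ('D_('e_j) (u k))) ('D_('e_j) v) (DDv i j) i) => //.
  - by move=> k y /rG Gy; exact: harmonic_derive2 (hu k) Gy.
  - move=> y yr; apply: (ulE _ _ (Dv j)); first by move=> z ->; apply: DvE; exact: rG.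
    exact: (ptw _ _ _ _ yr (rD j)).

  - by rewrite subrr normr0.
have DDvE x i j : G x -> 'D_('e_i) ('D_('e_j) v) x = DDv i j x.
  by move=> Gx; have [_ ->] := ddv x i j Gx.
split => //; split => x Gx; have [r r0 [rG ru rD rDD]] := main x Gx.
  split.
    by apply: (unif_lim_cont r0 _ ru) => k; have [_ [/(_ x Gx)[]]] := hu k.
  move=> i j; have [dj _] := dv x j Gx; have [dij _] := ddv x i j Gx.
  split; first exact: dj.
  split; last (split; first exact: dij).
  - apply: (unif_lim_cont r0 (g := fun k => 'D_('e_j) (u k))).
      by move=> k; have [_ [/(_ x Gx)[_ /(_ i j)[_ []]]]] := hu k.
    by apply: ulE (rD j) => y /rG; exact: DvE.
  - apply: (unif_lim_cont r0 (g := fun k => 'D_('e_i) ('D_('e_j) (u k)))).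
      by move=> k; have [_ [/(_ x Gx)[_ /(_ i j)[_ [_ []]]]]] := hu k.
    by apply: ulE (rDD i j) => y /rG; exact: DDvE.
apply/eqP; rewrite -normr_le0; apply/ler_addgt0Pr => e e0; rewrite add0r.
have [e'0 e'e] := small_factor (ler0n R n) e0.
have [K KP] : exists K, forall k, (K <= k)%N -> forall i,
    `|'D_('e_i) ('D_('e_i) (u k)) x - DDv i i x| <= e / (n%:R + 1).
  have H i : exists K, forall k, (K <= k)%N ->
      `|'D_('e_i) ('D_('e_i) (u k)) x - DDv i i x| <= e / (n%:R + 1).
    have [K KP] := rDD i i _ e'0; exists K => k Kk; apply: KP => //=.
    by rewrite subrr normr0.
  have /choice[K KP] := H.
  exists (\max_i K i)%N => k Kk i; apply: KP; apply: leq_trans Kk.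
  exact: leq_bigmax.
have [_ [_ /(_ x Gx) s0]] := hu K.
apply: le_trans e'e; apply: (sum_dist s0) => i.
by rewrite DDvE//; exact: KP.
Qed.

End Limits.

(** * Harnack's inequality *)

Section Harnack.
Variables (R : realType) (n : nat).
Local Notation V := 'rV[R]_n.
Implicit Types (x y : V) (A G : set V) (f g : V -> R).
Local Notation "''e_' i" := (ebasis R i) (at level 8, i at level 2, format "''e_' i").

Lemma norm_dist_triangle (x y z : V) (r1 r2 : R) :
  `|x - y| <= r1 -> `|y - z| <= r2 -> `|x - z| <= r1 + r2.
Proof.
move=> h1 h2; rewrite -(subrK y x) -addrA.
by apply: le_trans (ler_normD _ _) (lerD _ _).
Qed.

Lemma contM f g x : {for x, continuous f} -> {for x, continuous g} ->
  {for x, continuous (fun y => f y * g y)}.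
Proof. by move=> cf cg; exact: (cvgM cf cg). Qed.

Lemma contX f k x : {for x, continuous f} -> {for x, continuous (fun y => f y ^+ k)}.
Proof.
move=> cf; elim: k => [|k IH].
  by apply/cont_normP => e e0; exists 1 => // y _; rewrite !expr0 subrr normr0.
rewrite (_ : (fun y : V => _) = (fun y => f y * f y ^+ k)); first exact: contM.
by apply/funext => y; rewrite exprS.
Qed.

Lemma wh_lip_signed G f c (d M t : R) i : weakly_harmonic G f -> 0 < d ->
  (forall y, `|y - c| <= d -> G y) -> (forall y, `|y - c| <= d -> `|f y| <= M) ->
  `|t| < d -> `|f (c + t *: 'e_i) - f (c - t *: 'e_i)| <= 2 * (n%:R * M / d) * `|t|.
Proof.
move=> wf d0 dG fM; have [t0|t0|->] := ltgtP t 0.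
- rewrite (ltr0_norm t0) => td.
  have := wh_lip i wf d0 dG fM _ td; rewrite oppr_gt0 => /(_ t0).
  by rewrite scaleNr opprK distrC.
- by rewrite (gtr0_norm t0) => td; exact: wh_lip wf d0 dG fM t0 td.
- by rewrite scale0r subr0 addr0 subrr !normr0 mulr0.
Qed.

Definition mix_coords (c y : V) (k : nat) : V := \row_i (if (i < k)%N then y 0 i else c 0 i).

(** The path from [c] to [y] changes one coordinate at a time, through the points
    [mix_coords c y k]. Each of the [n] steps is estimated from its midpoint, which lies within [d]
    of [c]; hence the radius [d + d] in the hypotheses. *)
Lemma wh_lipschitz G f c (d M : R) : weakly_harmonic G f -> 0 < d ->
  (forall y, `|y - c| <= d + d -> G y) -> (forall y, `|y - c| <= d + d -> `|f y| <= M) ->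
  forall y, `|y - c| <= d -> `|f y - f c| <= n%:R * ((n%:R * M / d) * `|y - c|).
Proof.
move=> wf d0 dG fM y yc.
have step (i : 'I_n) : `|f (mix_coords c y i.+1) - f (mix_coords c y i)|
    <= (n%:R * M / d) * `|y - c|.
  pose s := y 0 i - c 0 i; pose z := mix_coords c y i + (s / 2) *: 'e_i.
  have sy : `|s| <= `|y - c|.
    by apply: le_trans (coord_le_norm (y - c) i); rewrite !mxE.
  have s2 : `|s / 2| = `|s| / 2 by rewrite normrM (gtr0_norm (x := 2^-1))// invr_gt0.
  have s2d : `|s / 2| < d by rewrite s2; have := normr_ge0 s; lra.
  have zc : `|z - c| <= d.
    apply: le_trans yc; apply: norm_le_coord => // j; rewrite !mxE eqxx/=.
    have [ji|ji] := eqVneq j i.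
      by rewrite ji ltnn mulr1 addrAC subrr add0r s2; have := normr_ge0 s; lra.
    rewrite mulr0 addr0; case: ifPn => _; last by rewrite subrr normr0.
    by apply: le_trans (coord_le_norm (y - c) j); rewrite !mxE.
  have zball w : `|w - z| <= d -> `|w - c| <= d + d by move=> /norm_dist_triangle; apply.
  have := wh_lip_signed i wf d0 (fun w wz => dG w (zball w wz))
    (fun w wz => fM w (zball w wz)) s2d.
  have -> : z - (s / 2) *: 'e_i = mix_coords c y i by rewrite /z addrK.
  have -> : z + (s / 2) *: 'e_i = mix_coords c y i.+1.
    rewrite /z -addrA -scalerDl -splitr; apply/rowP => j; rewrite !mxE eqxx/=.
    have -> : (j < i.+1)%N = (j == i) || (j < i)%N by rewrite ltnS leq_eqVlt.
    have [ji|ji] := eqVneq j i; first by rewrite ji /= ltnn mulr1 addrC subrK.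
    by rewrite mulr0 addr0.
  move=> /le_trans; apply; rewrite s2.
  have K0 : 0 <= n%:R * M / d.
    rewrite divr_ge0 ?mulr_ge0// ?(ltW d0)//.
    by apply: le_trans (normr_ge0 _) (fM c _); rewrite subrr normr0 addr_ge0// ltW.
  have := ler_wpM2l K0 sy; lra.
have -> : f y - f c = \sum_(i < n) (f (mix_coords c y i.+1) - f (mix_coords c y i)).
  rewrite -(big_mkord xpredT (fun i => f (mix_coords c y i.+1) - f (mix_coords c y i))).
  rewrite telescope_sumr//; congr (f _ - f _); apply/rowP => i; rewrite mxE.
    by rewrite ltn_ord.
  by rewrite ltn0.
apply: le_trans (ler_norm_sum _ _ _) _.
apply: le_trans (ler_sum _ (fun i _ => step i)) _.
by rewrite sumr_const card_ord -[leLHS]mulr_natl.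
Qed.

(** The squared Euclidean distance. The ambient norm is the max norm, whereas radial barriers with a
    computable Laplacian need this one; the two are compared just below. *)
Definition sqdist (c y : V) : R := \sum_j (y 0 j - c 0 j) ^+ 2.

Lemma sqdist_ge0 c y : 0 <= sqdist c y.
Proof. by apply: sumr_ge0 => j _; exact: sqr_ge0. Qed.

Lemma norm_sqr_le_sqdist c y : `|y - c| ^+ 2 <= sqdist c y.
Proof.
have [->|yc] := eqVneq `|y - c| 0; first by rewrite expr0n/= sqdist_ge0.
have [j jE] : exists j, `|(y - c) 0 j| = `|y - c|.
  by apply: norm_eq_coord; rewrite lt_neqAle eq_sym yc normr_ge0.
rewrite -jE real_normK ?num_real// !mxE /sqdist (bigD1 j)//= lerDl.
by apply: sumr_ge0 => k _; exact: sqr_ge0.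
Qed.

Lemma sqdist_le_norm_sqr c y : sqdist c y <= n%:R * `|y - c| ^+ 2.
Proof.
apply: (@le_trans _ _ (\sum_(j < n) `|y - c| ^+ 2)).
  apply: ler_sum => j _; rewrite -real_normK ?num_real// lerXn2r ?nnegrE//.
  by apply: le_trans (coord_le_norm (y - c) j); rewrite !mxE.
by rewrite sumr_const card_ord -[leLHS]mulr_natl.
Qed.

Lemma cont_sqdist c : continuous (sqdist c).
Proof. by move=> y; apply: cont_sum => j; exact: cont_coord_sqr. Qed.

Lemma sqdist_line c y i (t : R) :
  sqdist c (y + t *: 'e_i) = sqdist c y + 2 * (y 0 i - c 0 i) * t + t ^+ 2.
Proof.
rewrite /sqdist (bigD1 i)//= [in RHS](bigD1 i)//=.
rewrite (eq_bigr (fun j => (y 0 j - c 0 j) ^+ 2)).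
  by rewrite !mxE !eqxx/=; ring.
by move=> j ji; rewrite !mxE (negbTE ji) andbF mulr0 addr0.
Qed.

(** On the line through [x] along axis [i] the squared distance is the quadratic
    [P t = Q + 2 * z * t + t ^+ 2], and the stated value is the second derivative at 0 of [P] to the
    power [- m.+1]. *)
Lemma sd2_inv_sqdist c x i (m : nat) : 0 < sqdist c x ->
  sd2 (fun y => (sqdist c y)^-1 ^+ m.+1) x i
    ((sqdist c x)^-1 ^+ m.+2 * (m.+1%:R * (4 * m.+2%:R * (x 0 i - c 0 i) ^+ 2 *
       (sqdist c x)^-1 - 2))).
Proof.
set Q := sqdist c x; set z := x 0 i - c 0 i => Q0.
pose P (t : R) : R := Q + 2 * z * t + t ^+ 2.
pose J (t : R) : R := (P t)^-1.
(* The second bound ensures [2 * |z| * |t| < Q], so that [P] stays positive. *)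
pose r := Num.min 1 (Q / (2 * `|z| + 1)).
have z1 : 0 < 2 * `|z| + 1 by rewrite ltr_wpDl// mulr_ge0.
have r0 : 0 < r by rewrite lt_min ltr01 divr_gt0.
have P0 t : `|t| < r -> 0 < P t.
  rewrite lt_min => /andP[t1]; rewrite ltr_pdivlMr// => tz.
  have : `|2 * z * t| <= 2 * `|z| * `|t| by rewrite !normrM (gtr0_norm (x := 2)).
  rewrite ler_norml => /andP[h _]; rewrite /P; have := sqr_ge0 t.
  have := normr_ge0 t; nra.
have dP (t : R) : is_derive t 1 P (2 * z + 2 * t).
  apply/is_derive_epsP => e e0; exists e => // h he.
  rewrite -[h *: 1]/(h * 1) mulr1 /P.
  rewrite (_ : _ - _ = h * h); last by ring.
  by rewrite normrM ler_wpM2r// ltW.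
have dJ (t : R) : `|t| < r -> is_derive t 1 J (- (J t ^+ 2 * (2 * z + 2 * t))).
  move=> /P0 Pt; have := @is_deriveV _ P t (2 * z + 2 * t) 1.
  rewrite gt_eqF// => /(_ isT (dP t)).
  by rewrite -[_ *: _]/(_ * _) mulNr -exprVn.
have dX (t : R) k : `|t| < r ->
    is_derive t 1 (fun t => J t ^+ k.+1) (- (k.+1%:R * J t ^+ k.+2 * (2 * z + 2 * t))).
  move=> tr; have := is_deriveX k.+1 (dJ t tr).
  have -> : J ^+ k.+1 = (fun t => J t ^+ k.+1).
    by apply/funext => u; elim: (k.+1) => [//|j IH]; rewrite !exprS -IH.
  rewrite -[_ *: _]/(_ * _) /= (_ : _ * - _ = - (k.+1%:R * J t ^+ k.+2 * (2 * z + 2 * t)))//.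
  by rewrite !exprS; ring.
pose g1 (t : R) : R := - (m.+1%:R * J t ^+ m.+2 * (2 * z + 2 * t)).
have dL : is_derive (0 : R) 1 (fun t : R => 2 * z + 2 * t) 2.
  apply/is_derive_epsP => e e0; exists 1 => // h _.
  rewrite -[h *: 1]/(h * 1) mulr1 (_ : _ - _ = 0); last by ring.
  by rewrite normr0 mulr_ge0// ltW.
have zr : `|0 : R| < r by rewrite normr0.
have dg1 : is_derive (0 : R) 1 g1
   (Q^-1 ^+ m.+2 * (m.+1%:R * (4 * m.+2%:R * z ^+ 2 * Q^-1 - 2))).
  have := is_deriveM (dX 0 m.+1 zr) dL.
  move=> /(@is_deriveZ _ _ _ _ (- m.+1%:R)).
  have -> : (- m.+1%:R) \*: ((fun t => J t ^+ m.+2) * (fun t : R => 2 * z + 2 * t)) = g1.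
    apply/funext => t; rewrite /g1 -!mulrA -mulNr; reflexivity.
  have JQ : J 0 = Q^-1 by rewrite /J /P mulr0 expr0n/= !addr0.
  rewrite -![_ *: _]/(_ * _) mulr0 addr0 JQ.
  rewrite (_ : - m.+1%:R * _ = Q^-1 ^+ m.+2 * (m.+1%:R * (4 * m.+2%:R * z ^+ 2 * Q^-1 - 2)))//.
  rewrite [Q^-1 ^+ m.+3]exprS; ring.
move=> e e0.
have [d d0 dH] := second_diff (g := fun t => J t ^+ m.+1) r0 (fun t tr => dX t m tr) dg1 e0.
exists d => // t t0 td; have := dH t t0 td.
have -> : x - t *: 'e_i = x + (- t) *: 'e_i by rewrite scaleNr.
rewrite !sqdist_line -/Q -/z /J /P.
by rewrite mulr0 expr0n/= !addr0.
Qed.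

(** Since the squares of the coordinates sum to [Q], the Laplacian is a nonnegative multiple of
    [4 * (n + 1) - 2 * n]. Subharmonicity suffices for the barrier, so the exponent [n] replaces
    that of the fundamental solution: it is natural and treats all dimensions alike. *)
Lemma lap_inv_sqdist c x : 0 < sqdist c x ->
  exists2 L, 0 <= L & laplacian_at (fun y => (sqdist c y)^-1 ^+ n) x L.
Proof.
move=> Q0; case: (posnP n) => [n0|n0].
  exists 0 => //; exists (fun=> 0); last by rewrite big1.
  by move=> i; have := ltn_ord i; rewrite {2}n0.
pose m := n.-1; have nE : n = m.+1 by rewrite prednK.
pose a i := ((sqdist c x)^-1 ^+ m.+2 * (m.+1%:R * (4 * m.+2%:R * (x 0 i - c 0 i) ^+ 2 *
       (sqdist c x)^-1 - 2))).
have nR : n%:R = m.+1%:R :> R by rewrite -nE.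
have -> : (fun y => (sqdist c y)^-1 ^+ n) = (fun y => (sqdist c y)^-1 ^+ m.+1) by rewrite -nE.
exists (\sum_i a i).
  rewrite /a -mulr_sumr -mulr_sumr sumrB -mulr_suml -mulr_sumr -/(sqdist c x).
  rewrite mulfK ?gt_eqF// sumr_const card_ord -[2 *+ n]mulr_natl nR.
  apply: mulr_ge0; first by rewrite exprn_ge0// invr_ge0 ltW.
  apply: mulr_ge0 => //; rewrite subr_ge0 [m.+2%:R]mulrSr.
  have : 0 <= m.+1%:R :> R by []. lra.
by exists a => // i; exact: sd2_inv_sqdist.
Qed.

(** Comparison on the cube of half-side [r] with the Euclidean ball of squared radius [s] removed.
    On the sphere the barrier is at most [m]; on the faces of the cube [sqdist >= r ^+ 2], so it is
    at most 0. *)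
Lemma wh_lower_barrier (i0 : 'I_n) G f c (r s m : R) : weakly_harmonic G f -> 0 < r -> 0 < s ->
  0 <= m -> (forall y, `|y - c| <= r -> G y) -> (forall y, `|y - c| <= r -> 0 <= f y) ->
  (forall y, `|y - c| <= r -> sqdist c y <= s -> m <= f y) ->
  forall y, `|y - c| < r -> s < sqdist c y ->
  m * s ^+ n * ((sqdist c y)^-1 ^+ n - (r ^+ 2)^-1 ^+ n) <= f y.
Proof.
move=> [oG wf] r0 s0 m0 rG f0 fm y yr ys.
pose Om := [set z : V | `|z - c| < r /\ s < sqdist c z].
pose B z := (sqdist c z)^-1 ^+ n.
pose k := m * s ^+ n.
have k0 : 0 <= k by rewrite mulr_ge0// exprn_ge0// ltW.
have clOm z : closure Om z -> `|z - c| <= r /\ s <= sqdist c z.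
  move=> cz; split; first by apply: closure_norm_le cz => w [/ltW].
  rewrite leNgt; apply/negP => zs.
  have [|d d0 dP] := (cont_normP _ _).1 (@cont_sqdist c z) (s - sqdist c z).
    by rewrite subr_gt0.
  have [w [_ ws] wz] := (closure_normP _ _).1 cz d d0.
  by have := dP w wz; rewrite ltr_norml => /andP[_]; lra.
have oOm : open Om.
  apply/open_normP => z [zr zs].
  have [|d d0 dP] := (cont_normP _ _).1 (@cont_sqdist c z) (sqdist c z - s).
    by rewrite subr_gt0.
  exists (Num.min (r - `|z - c|) d); first by rewrite lt_min d0 subr_gt0 zr.
  move=> w; rewrite lt_min => /andP[w1 w2]; split.
    rewrite -(subrK z w) -addrA; apply: le_lt_trans (ler_normD _ _) _; lra.
  by have := dP w w2; rewrite ltr_norml => /andP[+ _]; lra.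
have cB z : 0 < sqdist c z -> {for z, continuous B}.
  move=> z0; have h : {for z, continuous (fun w => (sqdist c w)^-1)}.
    exact: (cvgV (lt0r_neq0 z0) (@cont_sqdist c z)).
  exact: contX.
pose w z := (k * B z + (- (k * (r ^+ 2)^-1 ^+ n))) - f z.
suff : w y <= 0 by rewrite /w subr_le0 mulrBr.
apply: (@max_principle R n i0 Om w 0) => //.
- apply/bounded_setP; exists (r + `|c|) => z [zr _].
  by rewrite -(subrK c z); apply: le_trans (ler_normD _ _) _; rewrite lerD2r ltW.
- apply: within_cont => z /clOm[zr zs]; apply: contB; last by have [] := wf z (rG z zr).
  apply: contD; last exact: cont_cst.
  by apply: contZ; apply: cB; exact: lt_le_trans zs.
- move=> z [/ltW zr zs]; have [_ lf] := wf z (rG z zr).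
  have [L L0 lL] := lap_inv_sqdist (lt_trans s0 zs).
  exists (k * L); first exact: mulr_ge0.
  have := lapB (lapD (lapZ k lL) (lap_affine 0 (- (k * (r ^+ 2)^-1 ^+ n)) z i0)) lf.
  rewrite addr0 subr0; apply: (lap_ext ltr01) => u _.
  by rewrite mul0r add0r.
move=> z [/clOm[zr zs] zOm]; rewrite /w subr_le0 -mulrBr.
have z0 : 0 < sqdist c z := lt_le_trans s0 zs.
have [zlt|rz] := ltP `|z - c| r.
  have zs' : sqdist c z = s.
    by apply/eqP; rewrite eq_le zs andbT leNgt; apply/negP => h; exact: zOm.
  apply: le_trans (fm z zr _); last by rewrite zs'.
  rewrite /B zs' /k mulrBr -mulrA -exprMn divff ?gt_eqF// expr1n mulr1 gerBl.
  by rewrite mulr_ge0// exprn_ge0// invr_ge0 sqr_ge0.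
apply: le_trans (f0 z zr); apply: mulr_ge0_le0 => //; rewrite subr_le0 /B.
have rz2 : r ^+ 2 <= sqdist c z.
  apply: le_trans (norm_sqr_le_sqdist c z).
  by rewrite lerXn2r ?nnegrE// ltW.
rewrite lerXn2r ?nnegrE ?invr_ge0 ?(ltW z0) ?sqr_ge0//.
by rewrite lef_pV2 ?posrE// exprn_gt0.
Qed.

(* At a maximum point [x] of [(r - |y - a|)^(2n) f(y)] the function stays comparable to [f x]
   on a cube of size proportional to the distance [r - |x - a|], and the power barrier
   propagates this lower bound to the centre [a]. *)
Lemma harnack_local (i0 : 'I_n) (r : R) : 0 < r -> exists2 C : R, 0 < C &
  forall G f a, weakly_harmonic G f -> (forall y, `|y - a| <= n.+2%:R * r -> G y) ->
  (forall y, `|y - a| <= n.+2%:R * r -> 0 <= f y) ->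
  forall y, `|y - a| <= r / 2 -> f y <= C * f a.
Proof.
(* [N] matches the exponent of the barrier, so that the powers of [d] cancel at the end. [kap] is
   chosen so that over a distance [kap * d] the Lipschitz bound [4 * n ^+ 2 * 2 ^+ N * M / d] costs
   at most [M / 2]. *)
move=> r0; pose N := (2 * n)%N; pose kap : R := (8 * n%:R ^+ 2 * 2 ^+ N)^-1.
have n1 : 1 <= n%:R :> R by rewrite ler1n (leq_trans _ (ltn_ord i0)).
have n0 : 0 < n%:R :> R by exact: lt_le_trans n1.
have kap0 : 0 < kap by rewrite invr_gt0 !mulr_gt0// exprn_gt0.
have kapE : 4 * n%:R ^+ 2 * 2 ^+ N * kap = 2^-1.
  have K0 : 8 * n%:R ^+ 2 * 2 ^+ N != 0 :> R by rewrite gt_eqF// !mulr_gt0// exprn_gt0.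
  by apply: (mulIf K0); rewrite /kap -[LHS]mulrA mulVf//; lra.
have kap4 : kap <= 4^-1.
  rewrite lef_pV2 ?posrE ?mulr_gt0 ?exprn_gt0//.
  have : 1 <= n%:R ^+ 2 :> R by rewrite exprn_ege1.
  have : 1 <= 2 ^+ N :> R by rewrite exprn_ege1// ler1n.
  nra.
pose bet := (n%:R * r ^+ 2)^-1 ^+ n.
have nr0 : 0 < n%:R * r ^+ 2 by rewrite mulr_gt0// exprn_gt0.
have bet0 : 0 < bet by rewrite exprn_gt0// invr_gt0.
pose C1 := 4 / (kap ^+ N * bet).
have kb0 : 0 < kap ^+ N * bet by rewrite mulr_gt0// exprn_gt0.
have C10 : 0 < C1 by rewrite divr_gt0.
pose C2 := 2 * r ^+ N.
have rN0 : 0 < r ^+ N by rewrite exprn_gt0.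
have C20 : 0 < C2 by rewrite mulr_gt0.
pose C0 := C1 + C2; have C00 : 0 < C0 by rewrite addr_gt0.
have r2N0 : 0 < (r / 2) ^+ N by rewrite exprn_gt0// divr_gt0.
exists (C0 / (r / 2) ^+ N); first exact: divr_gt0.
move=> G f a wf aG f0 y ya.
have nr : r <= n.+2%:R * r by rewrite ler_peMl ?(ltW r0)// ler1n.
have f0a y' : `|y' - a| <= r -> 0 <= f y' by move=> h; apply: f0; exact: le_trans nr.
have fa0 : 0 <= f a by apply: f0a; rewrite subrr normr0 ltW.
suff key : (r / 2) ^+ N * f y <= C0 * f a.
  by rewrite mulrAC ler_pdivlMr// mulrC.
pose F y := (r - `|y - a|) ^+ N * f y.
pose A := [set y : V | `|y - a| <= r].
have cA : compact A.
  apply: bounded_closed_compact; last by move=> x; exact: closure_norm_le.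
  apply/bounded_setP; exists (r + `|a|) => x xr.
  by rewrite -(subrK a x); apply: le_trans (ler_normD _ _) _; rewrite lerD2r.
have cF : {within A, continuous F}.
  apply: within_cont => x xA; have [cf _] := wf.2 x (aG x (le_trans xA nr)).
  apply: contM => //; apply: contX; apply: contB; first exact: cont_cst.
  apply/cont_normP => e e0; exists e => // z zx.
  by apply: le_lt_trans (ler_dist_dist _ _) _; rewrite opprB addrA subrK.
have [|x] := @EVT_max_rV _ _ F A _ cA cF.
  by exists a; rewrite /A/= subrr normr0 ltW.
rewrite inE /A/= => xr xmax.
have {}xmax z : `|z - a| <= r -> F z <= F x by move=> zr; apply: xmax; rewrite inE.
pose d := r - `|x - a|; pose M := f x.
have d0 : 0 <= d by rewrite subr_ge0.
have M0 : 0 <= M by exact: f0a.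
have yF : (r / 2) ^+ N * f y <= d ^+ N * M.
  have yr : `|y - a| <= r by apply: le_trans ya _; lra.
  apply: le_trans (xmax y yr); apply: ler_wpM2r; first exact: f0a.
  by rewrite lerXn2r ?nnegrE ?subr_ge0 ?divr_ge0 ?(ltW r0)//; lra.
apply: le_trans yF _.
have [dM|dM] := leP (d ^+ N * M) 0.
  by apply: le_trans dM _; rewrite mulr_ge0// ltW.
have {}M0 : 0 < M.
  by rewrite lt_neqAle M0 andbT; apply: contraTneq dM => <-; rewrite mulr0 ltxx.
have N0 : (0 < N)%N by rewrite muln_gt0/= (leq_trans _ (ltn_ord i0)).
have {}d0 : 0 < d.
  rewrite lt_neqAle d0 andbT; apply: contraTneq dM => <-.
  by rewrite expr0n gtn_eqF// mul0r ltxx.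
have dr : d <= r by rewrite gerBl.
have dN : 0 < d ^+ N by rewrite exprn_gt0.
(* Within [d / 2] of [x] the distance weight is still at least [d / 2], so maximality of [F] at [x]
   costs only the factor [2 ^+ N]. *)
have fup z : `|z - x| <= d / 4 + d / 4 -> `|f z| <= 2 ^+ N * M.
  move=> zx; have za : `|z - a| <= r - d / 2.
    by apply: le_trans (norm_dist_triangle zx (lexx _)) _; rewrite /d; lra.
  have zr : `|z - a| <= r by lra.
  rewrite ger0_norm ?f0a//.
  have h1 : (d / 2) ^+ N * f z <= d ^+ N * M.
    apply: le_trans (xmax z zr); apply: ler_wpM2r; first exact: f0a.
    by rewrite lerXn2r ?nnegrE ?subr_ge0 ?divr_ge0 ?(ltW d0)//; lra.
  move: h1; rewrite expr_div_n mulrAC ler_pdivrMr ?exprn_gt0// -mulrA ler_pM2l//.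
  by rewrite [2 ^+ N * M]mulrC.
have xball z (rho : R) : `|z - x| <= rho -> `|z - a| <= rho + r.
  by move=> zx; apply: le_trans (norm_dist_triangle zx (lexx _)) _; rewrite lerD2l.
have n2E : n.+2%:R = n%:R + 2 :> R by rewrite -addn2 natrD.
have d40 : 0 < d / 4 by rewrite divr_gt0.
have xG z : `|z - x| <= d / 4 + d / 4 -> G z.
  move=> /xball za; apply: aG; apply: le_trans za _; rewrite n2E; nra.
have lip := wh_lipschitz wf d40 xG fup.
have flow z : sqdist x z <= (kap * d) ^+ 2 -> M / 2 <= f z.
  move=> zk; have {}zk : `|z - x| <= kap * d.
    rewrite -(@ler_pXn2r _ 2) ?nnegrE ?mulr_ge0 ?(ltW kap0) ?(ltW d0)//.
    exact: le_trans (norm_sqr_le_sqdist x z) zk.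
  have zd : `|z - x| <= d / 4 by apply: le_trans zk _; rewrite mulrC ler_wpM2l// ltW.
  have := lip z zd.
  have -> : n%:R * (n%:R * (2 ^+ N * M) / (d / 4) * `|z - x|) =
     (4 * n%:R ^+ 2 * 2 ^+ N * M / d) * `|z - x| by field; rewrite gt_eqF.
  have : (4 * n%:R ^+ 2 * 2 ^+ N * M / d) * `|z - x| <= M / 2.
    have K0 : 0 <= 4 * n%:R ^+ 2 * 2 ^+ N * M / d.
      by rewrite divr_ge0 ?(ltW d0)// !mulr_ge0 ?sqr_ge0 ?exprn_ge0 ?(ltW M0).
    apply: le_trans (ler_wpM2l K0 zk) _.
    have -> : 4 * n%:R ^+ 2 * 2 ^+ N * M / d * (kap * d) = (4 * n%:R ^+ 2 * 2 ^+ N * kap) * M.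
      by field; rewrite gt_eqF.
    by rewrite kapE mulrC.
  by move=> h1 h2; have := le_trans h2 h1; rewrite ler_norml -/M => /andP[]; lra.
(* Since [(n + 1) ^+ 2 >= 2 * n], the constant subtracted in the barrier is at most [bet / 2], while
   [bet] bounds its main term at [a] from below. Together with [|x - a| <= r] this explains the
   radius [n.+2 * r] of the hypotheses. *)
pose Rr := n.+1%:R * r.
have Rr0 : 0 < Rr by rewrite mulr_gt0.
have n1E : n.+1%:R = n%:R + 1 :> R by rewrite -addn1 natrD.
have RrE : Rr + r = n.+2%:R * r by rewrite /Rr n2E n1E; ring.
have kd0 : 0 < (kap * d) ^+ 2 by rewrite exprn_gt0// mulr_gt0.
have ax : `|a - x| <= r by rewrite distrC.
rewrite /C0 mulrDl.
(* Either [a] already lies in the small ball where [f >= M / 2], which gives [C2], or the barrier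
   transports that bound to [a], which gives [C1]. *)
have [ak|ak] := leP (sqdist x a) ((kap * d) ^+ 2).
  have fM := flow a ak.
  apply: le_trans (_ : C2 * f a <= _); last first.
    by rewrite lerDr mulr_ge0// ltW.
  rewrite /C2 [2 * _]mulrC -mulrA.
  have dNr : d ^+ N <= r ^+ N by rewrite lerXn2r ?nnegrE ?(ltW d0) ?(ltW r0).
  by apply: le_trans (ler_wpM2r (ltW M0) dNr) _; rewrite ler_pM2l//; lra.
apply: le_trans (_ : C1 * f a <= _); last by rewrite lerDl mulr_ge0// ltW.
have := @wh_lower_barrier i0 G f x Rr ((kap * d) ^+ 2) (M / 2) wf Rr0 kd0.
move=> /(_ (divr_ge0 (ltW M0) (ler0n _ 2))).
have RG z : `|z - x| <= Rr -> `|z - a| <= n.+2%:R * r by rewrite -RrE; exact: xball.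
move=> /(_ (fun z zx => aG z (RG z zx)) (fun z zx => f0 z (RG z zx)) (fun z _ => flow z) a).
have aRr : `|a - x| < Rr by apply: le_lt_trans ax _; rewrite /Rr n1E; nra.
move=> /(_ aRr ak) fa.
have kdN : ((kap * d) ^+ 2) ^+ n = kap ^+ N * d ^+ N by rewrite -exprM exprMn.
have bet1 : bet <= (sqdist x a)^-1 ^+ n.
  have q0 : 0 < sqdist x a by exact: lt_trans kd0 ak.
  rewrite lerXn2r ?nnegrE ?invr_ge0 ?(ltW q0) ?(ltW nr0)// lef_pV2 ?posrE//.
  apply: le_trans (sqdist_le_norm_sqr _ _) _; apply: ler_wpM2l; first exact: ltW.
  by rewrite lerXn2r ?nnegrE ?(ltW r0).
have bet2 : (Rr ^+ 2)^-1 ^+ n <= bet / 2.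
  have h1 : (Rr ^+ 2)^-1 <= (n%:R * r ^+ 2)^-1 / 2.
    rewrite -invfM lef_pV2 ?posrE ?exprn_gt0 ?mulr_gt0//.
    rewrite /Rr exprMn n1E; have := sqr_ge0 (n%:R : R); have := sqr_ge0 r; nra.
  apply: le_trans (_ : ((n%:R * r ^+ 2)^-1 / 2) ^+ n <= _).
    by rewrite lerXn2r ?nnegrE ?invr_ge0 ?sqr_ge0// divr_ge0 ?invr_ge0 ?(ltW nr0).
  rewrite exprMn -/bet; apply: ler_wpM2l; first exact: ltW.
  have h2 : 0 <= 2^-1 :> R by rewrite invr_ge0.
  have h3 : 2^-1 <= 1 :> R by rewrite invf_le1// ler1n.
  by rewrite -[leRHS]expr1 ler_wiXn2l// (leq_trans _ (ltn_ord i0)).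
rewrite kdN in fa.
have fa2 : M / 2 * (kap ^+ N * d ^+ N) * (bet / 2) <= f a.
  apply: le_trans fa; apply: ler_wpM2l; last by lra.
  by rewrite !mulr_ge0 ?invr_ge0 ?exprn_ge0 ?(ltW M0) ?(ltW kap0) ?(ltW d0).
have -> : d ^+ N * M = C1 * (M / 2 * (kap ^+ N * d ^+ N) * (bet / 2)).
  have C1E : C1 * (kap ^+ N * bet) = 4 by rewrite divfK// gt_eqF.
  transitivity (C1 * (kap ^+ N * bet) * (M * d ^+ N / 4)); last by field.
  by rewrite C1E; field.
by rewrite ler_pM2l.
Qed.

(** The points near which [f] is controlled by [f a] form a nonempty, open and relatively closed
    subset of [G]. The constants precede [f], so that one of them serves a whole sequence of
    functions. *)
Theorem harnack (i0 : 'I_n) G a : open G -> connected G -> G a ->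
  forall x, G x -> exists2 C : R, 0 < C & exists2 r : R, 0 < r &
    (forall y, `|y - x| < r -> G y) /\
    forall f, weakly_harmonic G f -> (forall y, G y -> 0 <= f y) ->
    forall y, `|y - x| < r -> f y <= C * f a.
Proof.
move=> oG cG Ga.
pose good x := exists2 C : R, 0 < C & exists2 r : R, 0 < r &
    (forall y, `|y - x| < r -> G y) /\
    forall f, weakly_harmonic G f -> (forall y, G y -> 0 <= f y) ->
    forall y, `|y - x| < r -> f y <= C * f a.
(* Uniform in the centre [z] near [x]: the closedness argument uses both [x] and a neighbouring good
   point as centres. *)
have loc x : G x -> exists2 C : R, 0 < C & exists2 r : R, 0 < r &
    (forall y, `|y - x| < r -> G y) /\
    forall z, `|z - x| < r -> forall f, weakly_harmonic G f -> (forall y, G y -> 0 <= f y) ->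
    forall y, `|y - z| <= r -> f y <= C * f z.
  move=> Gx; have [rho rho0 rG] := (open_normP _).1 oG x Gx.
  pose N : R := n.+2%:R; have N1 : 1 <= N by rewrite ler1n.
  pose r := rho / (2 * N).
  have r0 : 0 < r by rewrite divr_gt0// mulr_gt0// (lt_le_trans _ N1).
  have rE : rho = 2 * N * r by rewrite /r mulrC divfK// mulf_neq0// gt_eqF// (lt_le_trans _ N1).
  have [C C0 CP] := harnack_local i0 r0.
  exists C => //; exists (r / 2); first by rewrite divr_gt0.
  have Nr : r <= N * r by rewrite ler_peMl// ltW.
  split; first by move=> y yx; apply: rG; rewrite rE; lra.
  move=> z zx f wf f0 y yz.
  have zG u : `|u - z| <= N * r -> G u.
    move=> uz; apply: rG; apply: le_lt_trans (norm_dist_triangle uz (ltW zx)) _.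
    rewrite rE; lra.
  by apply: CP wf zG (fun u uz => f0 u (zG u uz)) y yz.
suff BG : [set x | G x /\ good x] = G by move=> x Gx; have [] : [set x | G x /\ good x] x by rewrite BG.
apply: cG.
- exists a; split => //; have [C C0 [r r0 [rG CP]]] := loc a Ga.
  exists C => //; exists r => //; split => // f wf f0 y yr.
  by apply: CP => //; [rewrite subrr normr0|exact: ltW].
- exists [set x | G x /\ good x]; last by rewrite setIC; apply/seteqP; split=> x [] // [].
  apply/open_normP => x [Gx [C C0 [r r0 [rG CP]]]]; exists r => // y yx.
  split; first exact: rG.
  have sub z : `|z - y| < r - `|y - x| -> `|z - x| < r.
    by move=> zy; rewrite -(subrK y z) -addrA; apply: le_lt_trans (ler_normD _ _) _; lra.
  exists C => //; exists (r - `|y - x|); first by rewrite subr_gt0.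
  split; first by move=> z /sub; exact: rG.
  by move=> f wf f0 z /sub; exact: CP.
- exists (closure [set x | G x /\ good x]); first exact: closed_closure.
  apply/seteqP; split=> [x [Gx gx]|x [Gx cx]].
    by split => //; apply: subset_closure.
  split => //; have [C C0 [r r0 [rG CP]]] := loc x Gx.
  have [y [Gy [C' C'0 [r' r'0 [r'G C'P]]]] yx] := (closure_normP _ _).1 cx r r0.
  (* The factors come from the chain [z] to [x], [x] to the good point [y], and [y] to [a]. *)
  exists (C * (C * C')); first by rewrite !mulr_gt0.
  exists r => //; split => // f wf f0 z zx.
  have xx : `|x - x| < r by rewrite subrr normr0.
  apply: le_trans (CP x xx f wf f0 z (ltW zx)) _.
  rewrite -!mulrA ler_pM2l//.
  apply: le_trans (CP y yx f wf f0 x _) _; first by rewrite distrC ltW.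
  rewrite ler_pM2l//; apply: C'P => //; by rewrite subrr normr0.
Qed.

End Harnack.

(** * Approximation of integrable functions by continuous ones *)

Section BorelMeasures.
Variables (R : realType) (n : nat).
Local Notation V := 'rV[R]_n.
Local Notation T := (Bor R n).
Implicit Types (f g : V -> R) (m : {measure set T -> \bar R}) (D : set V).

Lemma measurable_open_Bor D : open D -> measurable (D : set T).
Proof. by move=> oD; exact: sub_sigma_algebra. Qed.

Lemma measurable_closed_Bor D : closed D -> measurable (D : set T).
Proof.
move=> cD; rewrite -[D]setCK; apply: measurableC; apply: measurable_open_Bor.
by rewrite openC.
Qed.

Lemma within_superlevel_open D f (c : R) : {within D, continuous f} ->
  exists2 U : set V, open U & D `&` [set x | c < f x] = D `&` U.
Proof.
move=> /within_normP cf.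
exists [set y | exists x d, [/\ 0 < d, `|y - x| < d & forall z, D z -> `|z - x| < d -> c < f z]].
  apply/open_normP => y [x [d [d0 yx dP]]]; exists (d - `|y - x|); first by rewrite subr_gt0.
  move=> z zy; exists x, d; split => //.
  by rewrite -(subrK y z) -addrA; apply: le_lt_trans (ler_normD _ _) _; lra.
apply/seteqP; split=> x [Dx].
  move=> /= cfx; split => //; have fc : 0 < f x - c by rewrite subr_gt0.
  have [d d0 dP] := cf x Dx _ fc.
  exists x, d; split => //; first by rewrite subrr normr0.
  by move=> z Dz /(dP z Dz); rewrite ltr_norml => /andP[]; lra.
by move=> [y [d [d0 xy dP]]]; split => //; exact: dP.
Qed.

Lemma within_superlevelP D f (c : R) : {within D, continuous f} ->
  exists U : set V, open U /\ forall x, D x -> U x <-> c < f x.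
Proof.
move=> /(within_superlevel_open c)[U oU UE]; exists U; split => // x Dx.
have E : (D `&` [set x | c < f x]) x = (D `&` U) x by rewrite UE.
split=> h; first by have [] : (D `&` [set x | c < f x]) x by rewrite E.
by have [] : (D `&` U) x by rewrite -E.
Qed.

Lemma measurable_within D f : measurable (D : set T) -> {within D, continuous f} ->
  measurable_fun (D : set T) (f : T -> R).
Proof.
move=> mD cf; apply: (@measurability _ _ T (measurableTypeR R) D f _ (RGenOInfty.measurableE R)).
move=> _ [_ [c ->] <-].
have -> : f @^-1` `]c, +oo[%classic = [set x | c < f x].
  by apply/seteqP; split=> x /=; rewrite in_itv/= andbT.
have [U oU ->] := within_superlevel_open c cf.
by apply: measurableI => //; exact: measurable_open_Bor.
Qed.

Lemma measurable_cont f : continuous f -> measurable_fun (setT : set T) (f : T -> R).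
Proof.
by move=> cf; apply: measurable_within => //; apply: within_cont => x _; exact: cf.
Qed.

(** Monotone convergence is applied to [min |f| (G k)] rather than to [G k]: the limit is then
    [|f|], which is finite, whatever the supremum of the [G k]. *)
Lemma integral_le_sup m (D : set T) f (G : nat -> V -> R) (a : \bar R) :
  measurable D -> measurable_fun D (f : T -> R) ->
  (forall k, measurable_fun D (G k : T -> R)) -> (forall k x, D x -> 0 <= G k x) ->
  (forall k x, D x -> G k x <= G k.+1 x) ->
  (forall x c, D x -> c < `|f x| -> exists k, c < G k x) ->
  (forall k, (\int[m]_(x in D) (G k x)%:E <= a)%E) ->
  (\int[m]_(x in D) (`|f x|)%:E <= a)%E.
Proof.
move=> mD mf mG G0 Gi Gs Ga.
pose g k (x : T) := (Num.min `|f x| (G k x))%:E.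
have Gh x : D x -> {homo (fun k => G k x) : k l / (k <= l)%N >-> k <= l}.
  by move=> Dx; apply/nondecreasing_seqP => k; exact: Gi.
have gh x : D x -> {homo (fun k => g k x) : k l / (k <= l)%N >-> (k <= l)%E}.
  move=> Dx k l kl; rewrite lee_fin le_min !ge_min lexx/=.
  by rewrite (Gh x Dx k l kl) orbT.
have mg k : measurable_fun D (g k).
  apply/measurable_EFinP; apply: measurable_minr => //.
  exact: measurableT_comp.
have g0 k x : D x -> (0 <= g k x)%E.
  by move=> Dx; rewrite lee_fin le_min normr_ge0 G0.
have gl x : D x -> limn (fun k => g k x) = (`|f x|)%:E.
  move=> Dx; apply/cvg_lim => //; apply: cvg_EFin; first by apply: nearW.
  apply/cvgrPdist_le => e e0.
  have [|k kP] := Gs x (`|f x| - e) Dx; first by rewrite ltrBlDr ltrDl.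
  exists k => // l /= kl; have h := le_trans (ltW kP) (Gh x Dx k l kl).
  rewrite /g/= ger0_norm ?subr_ge0 ?ge_min ?lexx//.
  by rewrite lerBlDr -lerBlDl le_min h andbT gerBl ltW.
have := @cvg_monotone_convergence _ T R m D mD g mg g0 gh.
move=> cvi; have -> : (\int[m]_(x in D) (`|f x|)%:E = \int[m]_(x in D) limn (fun k => g k x))%E.
  by apply: eq_integral => x; rewrite inE => /gl ->.
rewrite -(cvg_lim _ cvi)//; apply: lime_le; first by apply/cvg_ex; eexists; exact: cvi.
apply: nearW => k; apply: le_trans (Ga k); apply: ge0_le_integral => //.
- by move=> x Dx; exact: g0.
- by apply/measurable_EFinP.
- by move=> x Dx; rewrite lee_fin ge_min lexx orbT.
Qed.

End BorelMeasures.

(** * The functions with the Vitali-Caratheodory property form a class stable under sums and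
    monotone limits *)

Section Approximation.
Import HBNNSimple.
Variables (R : realType) (n : nat) (m : {measure set (Bor R n) -> \bar R}).
Hypothesis m_fin : (m setT < +oo)%E.
Local Notation V := 'rV[R]_n.
Local Notation T := (Bor R n).
Implicit Types (f g : V -> R).

Definition integrable_fun f := m.-integrable (setT : set T) (EFin \o (f : T -> R)).

(* [f] is dominated by an increasing sequence of continuous functions of integral at most [a]:
   a bound of the upper integral of [|f|] by lower semicontinuous functions. *)
Definition lsc_dominated f (a : R) := exists G : nat -> V -> R,
  [/\ forall k, continuous (G k), forall k x, 0 <= G k x,
      forall k x, G k x <= G k.+1 x,
      forall x c, c < `|f x| -> exists k, c < G k x &
      forall k, (\int[m]_(x in (setT : set T)) (G k x)%:E <= a%:E)%E].

(** Approximation by continuous functions in the upper integral; the error is dominated at every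
    point, with no exceptional null set. *)
Definition lsc_approximable f := forall a, 0 < a -> exists g : V -> R,
  [/\ continuous g, integrable_fun g & lsc_dominated (fun x => f x - g x) a].

Lemma lsc_dominated_le f g (a b : R) : (forall x, `|f x| <= `|g x|) -> a <= b ->
  lsc_dominated g a -> lsc_dominated f b.
Proof.
move=> fg ab [G [cG G0 Gi Gs Ga]]; exists G; split => //.
  by move=> x c cf; apply: Gs; exact: lt_le_trans (fg x).
by move=> k; apply: le_trans (Ga k) _; rewrite lee_fin.
Qed.

Lemma int_cont_ge0 (D : set T) (G : V -> R) : measurable D -> continuous G -> measurable_fun D (EFin \o (G : T -> R)).
Proof.
by move=> mD cG; apply/measurable_EFinP; apply: measurable_funS (measurable_cont cG).
Qed.

(** Countable subadditivity of the upper integral. The dominating sequence is the diagonal one: the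
    [k]-th function sums the [k]-th majorants of the first [k] terms, and so is continuous and
    increasing in [k]. *)
Lemma lsc_dominated_series (f : nat -> V -> R) h (a : nat -> R) (b : R) :
  (forall j, lsc_dominated (f j) (a j)) -> (forall k, \sum_(j < k) a j <= b) ->
  (forall x c, c < `|h x| -> exists k, c < \sum_(j < k) `|f j x|) -> lsc_dominated h b.
Proof.
move=> /choice[G GP] ab hf.
have G0 j k x : 0 <= G j k x by have [] := GP j.
have Gh j x : {homo (fun k => G j k x) : k l / (k <= l)%N >-> k <= l}.
  by apply/nondecreasing_seqP => k; have [] := GP j.
have cG k (l : nat) : continuous (fun x => \sum_(j < l) G j k x).
  elim: l => [|l IH] x.
    rewrite (_ : (fun x : V => _) = fun=> 0); first exact: cont_cst.
    by apply/funext => y; rewrite big_ord0.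
  rewrite (_ : (fun x : V => _) = fun x => \sum_(j < l) G j k x + G l k x); last first.
    by apply/funext => y; rewrite big_ord_recr.
  by apply: contD; [exact: IH|have [+ _ _ _ _] := GP l; exact].
exists (fun k x => \sum_(j < k) G j k x); split.
- by move=> k; exact: cG.
- by move=> k x; apply: sumr_ge0.
- move=> k x; rewrite big_ord_recr/= ler_wpDr//.
  by apply: ler_sum => j _; exact: Gh.
- move=> x c /hf[k]; rewrite -subr_gt0 => ck.
  set s := \sum_(j < k) _ in ck.
  have k0 : 0 < k.+1%:R :> R by [].
  (* The slack [s - c] is shared among [k] terms; dividing by [k.+1] also covers [k = 0] and keeps
     the total loss strictly below the slack. *)
  have H (j : nat) : exists l, `|f j x| - (s - c) / k.+1%:R < G j l x.
    have [_ _ _ + _] := GP j; apply.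
    by rewrite ltrBlDr ltrDl divr_gt0.
  have [K KP] := choice H.
  pose N := maxn k (\max_(j < k) K j)%N; exists N.
  apply: (@lt_le_trans _ _ (\sum_(j < k) G j N x)); last first.
    rewrite (big_ord_widen N (fun j => G j N x)) ?leq_maxl// big_mkcond/=.
    by apply: ler_sum => j _; case: ifP.
  apply: (@lt_le_trans _ _ (\sum_(j < k) (`|f j x| - (s - c) / k.+1%:R))).
    have -> : \sum_(j < k) (`|f j x| - (s - c) / k.+1%:R) = s - k%:R * ((s - c) / k.+1%:R).
      by rewrite sumrB -/s sumr_const card_ord mulr_natl.
    have : k%:R * ((s - c) / k.+1%:R) < s - c; last by rewrite ltrBrDr addrC -ltrBrDr.
    by rewrite mulrCA gtr_pMr// ltr_pdivrMr// mul1r ltr_nat.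
  apply: ler_sum => j _; apply: le_trans (ltW (KP j)) _; apply: Gh.
  by apply: leq_trans (leq_maxr k _); exact: (leq_bigmax j).
- move=> k.
  have -> : (\int[m]_(x in (setT : set T)) (\sum_(j < k) G j k x)%:E)%E =
      (\int[m]_(x in (setT : set T)) (\sum_(j < k) (G j k x)%:E))%E.
    by apply: eq_integral => x _; rewrite sumEFin.
  rewrite ge0_integral_sum//; last 2 first.
    by move=> j; apply: int_cont_ge0 => //; have [+ _ _ _ _] := GP j; exact.
    by move=> j x _; rewrite lee_fin.
  apply: (@le_trans _ _ (\sum_(j < k) (a j)%:E)%E); last by rewrite sumEFin lee_fin.
  by apply: lee_sum => j _; have [_ _ _ _] := GP j; exact.
Qed.

Lemma lsc_dominated0 : lsc_dominated (fun=> 0) 0.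
Proof.
exists (fun _ _ => 0); split => //.
- by move=> k x; exact: cont_cst.
- by move=> x c; rewrite normr0 => c0; exists 0%N.
- by move=> k; rewrite integral0.
Qed.

(** The series lemma for the sequence [f, g, 0, 0, ...]. *)
Lemma lsc_dominatedD f g h (a b : R) : lsc_dominated f a -> lsc_dominated g b ->
  (forall x, `|h x| <= `|f x| + `|g x|) -> 0 <= a -> 0 <= b -> lsc_dominated h (a + b).
Proof.
move=> fa gb hfg a0 b0.
pose F j : V -> R := if j is 0%N then f else if j is 1%N then g else fun=> 0.
pose A j : R := if j is 0%N then a else if j is 1%N then b else 0.
apply: (@lsc_dominated_series F h A).
- by move=> [|[|j]] //=; exact: lsc_dominated0.
- move=> [|[|k]]; rewrite ?big_ord0 ?big_ord_recl ?big_ord0/=.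
  + by rewrite addr_ge0.
  + by rewrite addr0 lerDl.
  + by rewrite [X in a + (b + X)]big1 ?addr0.
- move=> x c ch; exists 2%N; rewrite !big_ord_recl big_ord0/= addr0.
  exact: lt_le_trans (hfg x).
Qed.

Lemma integrable_funD f g : integrable_fun f -> integrable_fun g -> integrable_fun (fun x => f x + g x).
Proof. by move=> fi gi; exact: (integrableD _ fi gi). Qed.

Lemma integrable_funB f g : integrable_fun f -> integrable_fun g -> integrable_fun (fun x => f x - g x).
Proof. by move=> fi gi; exact: (integrableB _ fi gi). Qed.

Lemma integrable_funZ k f : integrable_fun f -> integrable_fun (fun x => k * f x).
Proof. by move=> fi; exact: (integrableZl _ k fi). Qed.

Lemma integrable_fun_norm f : integrable_fun f -> integrable_fun (fun x => `|f x|).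
Proof. by move=> fi; exact: (integrable_abse fi). Qed.

Lemma integrable_fun_measurable f : integrable_fun f -> measurable_fun (setT : set T) (f : T -> R).
Proof. by move=> /measurable_int/measurable_EFinP. Qed.

Definition Int f : R := \int[m]_(x in (setT : set T)) f x.

Lemma IntE f : integrable_fun f -> (Int f)%:E = (\int[m]_(x in (setT : set T)) (f x)%:E)%E.
Proof. by move=> fi; rewrite /Int /Rintegral fineK//; exact: integrable_fin_num. Qed.

Lemma IntD f g : integrable_fun f -> integrable_fun g -> Int (fun x => f x + g x) = Int f + Int g.
Proof. by move=> fi gi; exact: RintegralD. Qed.

Lemma IntB f g : integrable_fun f -> integrable_fun g -> Int (fun x => f x - g x) = Int f - Int g.
Proof. by move=> fi gi; exact: RintegralB. Qed.

Lemma Int_le f g : integrable_fun f -> integrable_fun g -> (forall x, f x <= g x) -> Int f <= Int g.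
Proof. by move=> fi gi fg; apply: le_Rintegral => //. Qed.

Lemma lsc_dominated_Int f a : measurable_fun (setT : set T) (f : T -> R) -> lsc_dominated f a ->
  integrable_fun f /\ Int (fun x => `|f x|) <= a.
Proof.
move=> mf [G [cG G0 Gi Gs Ga]].
have fa : (\int[m]_(x in (setT : set T)) (`|f x|)%:E <= a%:E)%E.
  apply: (integral_le_sup (G := G)) => //.
  - by move=> k; apply: measurable_cont; exact: cG.
  - by move=> x c _; exact: Gs.
have fi : integrable_fun f.
  apply/integrableP; split; first exact/measurable_EFinP.
  by apply: le_lt_trans fa _; rewrite ltry.
by split => //; rewrite -lee_fin IntE//; exact: integrable_fun_norm.
Qed.

Lemma integrable_bounded_cont f (C : R) : continuous f -> (forall x, `|f x| <= C) -> integrable_fun f.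
Proof.
move=> cf fC; apply: measurable_bounded_integrable => //; first exact: measurable_cont.
exists C; split; [exact: num_real|move=> M CM x _].
exact: le_trans (fC x) (ltW CM).
Qed.

Lemma lsc_dominated_cont g : continuous g -> integrable_fun g -> lsc_dominated g (Int (fun x => `|g x|)).
Proof.
move=> cg gi; exists (fun _ x => `|g x|); split => //.
- by move=> _ x; apply: cont_normr; exact: cg.
- by move=> _; rewrite -IntE//; exact: integrable_fun_norm.
Qed.

(** For approximable functions the upper integral of the modulus is the integral. Half of the slack
    [a - Int |f|] pays for [|f - g|], the other half for replacing [Int |f|] by [Int |g|]. *)
Lemma lsc_approximable_dominated f : integrable_fun f -> lsc_approximable f ->
  forall a, Int (fun x => `|f x|) < a -> lsc_dominated f a.
Proof.
move=> fi af a fa; pose e := (a - Int (fun x => `|f x|)) / 2.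
have e0 : 0 < e by rewrite divr_gt0// subr_gt0.
have [g [cg gi gP]] := af e e0.
have [_ fg] := lsc_dominated_Int (integrable_fun_measurable (integrable_funB fi gi)) gP.
have fgi := integrable_fun_norm (integrable_funB fi gi).
have If0 : 0 <= Int (fun x => `|g x|) by apply: Rintegral_ge0.
have := lsc_dominatedD (lsc_dominated_cont cg gi) gP _ If0 (ltW e0).
move=> /(_ f) H; apply: (lsc_dominated_le (g := f)) (H _) => //.
  have : Int (fun x => `|g x|) <= Int (fun x => `|f x| + `|f x - g x|).
    apply: Int_le => [||x]; first exact: integrable_fun_norm.
      by apply: integrable_funD => //; exact: integrable_fun_norm.
    by have := ler_normB (f x) (f x - g x); rewrite opprB addrCA subrr addr0.
  rewrite IntD//; last exact: integrable_fun_norm.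
  by rewrite /e in fg *; lra.
by move=> x; have := ler_normD (g x) (f x - g x); rewrite addrCA subrr addr0.
Qed.

Lemma lsc_approximableD f g : lsc_approximable f -> lsc_approximable g ->
  lsc_approximable (fun x => f x + g x).
Proof.
move=> af ag a a0; have a20 : 0 < a / 2 by rewrite divr_gt0.
have [f' [cf fi fP]] := af _ a20; have [g' [cg gi gP]] := ag _ a20.
exists (fun x => f' x + g' x); split.
- by move=> x; apply: contD; [exact: cf|exact: cg].
- exact: integrable_funD.
- rewrite (splitr a); apply: (lsc_dominatedD fP gP) => //; try exact: ltW.
  by move=> x; rewrite opprD addrACA; exact: ler_normD.
Qed.

Lemma lsc_approximableZ k f : lsc_approximable f -> lsc_approximable (fun x => k * f x).
Proof.
move=> af a a0; have k0 : 0 < `|k| + 1 by rewrite ltr_wpDl.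
have [g [cg gi [G [cG G0 Gi Gs Ga]]]] := af _ (divr_gt0 a0 k0).
exists (fun x => k * g x); split.
- by move=> x; apply: contZ; exact: cg.
- exact: integrable_funZ.
exists (fun j x => (`|k| + 1) * G j x); split.
- by move=> j x; apply: contZ; exact: cG.
- by move=> j x; rewrite mulr_ge0// ltW.
- by move=> j x; rewrite ler_pM2l.
- move=> x c; rewrite -mulrBr normrM => ck.
  have [|j jP] := Gs x (c / (`|k| + 1)).
    rewrite ltr_pdivrMr//; apply: lt_le_trans ck _.
    by rewrite mulrC ler_wpM2l// lerDl.
  by exists j; rewrite mulrC -ltr_pdivrMr.
- move=> j; under eq_integral do rewrite EFinM.
  rewrite ge0_integralZl_EFin ?(ltW k0)//.
  + apply: (@le_trans _ _ ((`|k| + 1)%:E * (a / (`|k| + 1))%:E)%E).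
      by apply: lee_wpmul2l; [rewrite lee_fin ltW|exact: Ga].
    by rewrite -EFinM lee_fin mulrC divfK// gt_eqF.
  + by move=> x _; rewrite lee_fin.
  + exact: int_cont_ge0.
Qed.

Lemma lsc_approximable_cont f : continuous f -> integrable_fun f -> lsc_approximable f.
Proof.
move=> cf fi a a0; exists f; split => //.
apply: lsc_dominated_le lsc_dominated0; last exact: ltW.
by move=> x; rewrite subrr.
Qed.

Lemma sum_half_le (a : R) k : 0 <= a -> \sum_(j < k) a / 2 ^+ j.+1 <= a.
Proof.
move=> a0; suff -> : \sum_(j < k) a / 2 ^+ j.+1 = a - a / 2 ^+ k.
  by rewrite gerBl divr_ge0// exprn_ge0.
elim: k => [|k IH]; first by rewrite big_ord0 expr0 divr1 subrr.
rewrite big_ord_recr/= IH exprS; field; by rewrite expf_neq0.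
Qed.

(** Monotone convergence yields [J] with [Int g - Int (f J) < a / 4]. The tail [g - f J] is the
    series of the increments, each dominated with a mass close to its integral, and [f J] itself is
    approximable. *)
Lemma lsc_approximable_nondecreasing (f : nat -> V -> R) g :
  (forall k x, 0 <= f k x) -> (forall k x, f k x <= f k.+1 x) ->
  (forall k, measurable_fun (setT : set T) (f k : T -> R)) ->
  (forall k, lsc_approximable (f k)) -> integrable_fun g ->
  (forall k x, f k x <= g x) -> (forall x c, c < g x -> exists k, c < f k x) ->
  lsc_approximable g.
Proof.
move=> f0 fi mf af gi fg fs a a0.
have fh x : {homo (fun k => f k x) : k l / (k <= l)%N >-> k <= l}.
  by apply/nondecreasing_seqP => k; exact: fi.
have g0 x : 0 <= g x by exact: le_trans (f0 0%N x) (fg 0%N x).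
have fint k : integrable_fun (f k).
  apply: (@le_integrable _ _ _ m setT measurableT _ (EFin \o (g : T -> R))) => //.
    by apply/measurable_EFinP.
  by move=> x _; rewrite lee_fin !ger0_norm.
have a40 : 0 < a / 4 by rewrite divr_gt0.
have [J JP] : exists J, Int g - a / 4 < Int (f J).
  apply: contrapT => /forallNP H.
  have H' k : Int (f k) <= Int g - a / 4 by rewrite leNgt; apply/negP; exact: H.
  have := integral_le_sup (m := m) (D := setT) (f := g) (G := f) (a := (Int g - a / 4)%:E) measurableT.
  have mg := integrable_fun_measurable gi.
  move=> /(_ mg mf (fun k x _ => f0 k x) (fun k x _ => fi k x)).
  have h1 x c : setT x -> c < `|g x| -> exists k, c < f k x.
    by move=> _; rewrite ger0_norm//; exact: fs.
  move=> /(_ h1); have h2 k : (\int[m]_(x in (setT : set T)) (f k x)%:E <= (Int g - a / 4)%:E)%E.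
    by rewrite -IntE// lee_fin.
  move=> /(_ h2); under eq_integral do rewrite ger0_norm//.
  by rewrite -IntE// lee_fin; lra.
have [h [ch hi hP]] := af J _ a40.
exists h; split => //.
pose d j x := f (J + j).+1 x - f (J + j)%N x.
have d0 j x : 0 <= d j x by rewrite subr_ge0.
have dint j : integrable_fun (d j) by exact: integrable_funB.
have dn j : Int (fun x => `|d j x|) = Int (f (J + j).+1) - Int (f (J + j)%N).
  rewrite -IntB//; congr Int; apply/funext => x; by rewrite ger0_norm.
(* The integrals of the increments telescope to at most [a / 4] by the choice of [J], and the
   geometric errors add at most [a / 4]. *)
pose b j := Int (fun x => `|d j x|) + (a / 4) / 2 ^+ j.+1.
have dP j : lsc_dominated (d j) (b j).
  apply: lsc_approximable_dominated => //.
    rewrite /d (_ : (fun x => _) = (fun x => f (J + j).+1 x + (-1) * f (J + j)%N x)); last first.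
      by apply/funext => x; rewrite mulN1r.
    by apply: lsc_approximableD => //; exact: lsc_approximableZ.
  by rewrite ltrDl divr_gt0// exprn_gt0.
have bs k : \sum_(j < k) b j <= a / 2.
  rewrite big_split/=; have := sum_half_le k (ltW a40).
  suff : \sum_(j < k) Int (fun x => `|d j x|) <= a / 4 by lra.
  have -> : \sum_(j < k) Int (fun x => `|d j x|) = Int (f (J + k)%N) - Int (f J).
    elim: k => [|k IH]; first by rewrite big_ord0 addn0 subrr.
    by rewrite big_ord_recr/= IH dn addnS; ring.
  by have := Int_le (fint (J + k)%N) gi (fg _); lra.
have gJ : lsc_dominated (fun x => g x - f J x) (a / 2).
  apply: (lsc_dominated_series dP bs) => x c; rewrite ger0_norm ?subr_ge0// => cg.
  have [|k kP] := fs x (c + f J x); first by lra.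
  exists k; suff -> : \sum_(j < k) `|d j x| = f (J + k)%N x - f J x.
    by have := fh x k (J + k)%N (leq_addl _ _); lra.
  elim: k {kP} => [|k IH]; first by rewrite big_ord0 addn0 subrr.
  by rewrite big_ord_recr/= IH ger0_norm// /d addnS; ring.
have a24 : a / 4 <= a / 2 by lra.
have hJ : lsc_dominated (fun x => f J x - h x) (a / 2) by exact: lsc_dominated_le hP.
have a20 : 0 <= a / 2 by rewrite divr_ge0// ltW.
by rewrite (splitr a); apply: (lsc_dominatedD gJ hJ) => // x; exact: ler_distD.
Qed.

Lemma integrable_indic_fun (A : set T) : measurable A -> integrable_fun (\1_A : V -> R).
Proof.
move=> mA; apply: measurable_bounded_integrable => //.
exists 1; split; [exact: num_real|move=> M M1 x _].
by rewrite /= indicE; case: (_ \in _); rewrite ?normr1 ?normr0 ltW// (lt_trans ltr01).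
Qed.

Lemma lsc_approximable_ext f g : f =1 g -> lsc_approximable f -> lsc_approximable g.
Proof. by move=> /funext ->. Qed.

(** Meaningful for nonempty [A], the infimum of the empty set being a default value; hence the
    separate cases of an empty complement and of an empty support below. *)
Definition infdist (A : set V) x : R := inf [set `|x - y| | y in A].

Section InfDist.
Variable (A : set V).
Hypothesis A0 : A !=set0.

Lemma infdist_le x y : A y -> infdist A x <= `|x - y|.
Proof. by move=> Ay; apply: ge_inf; [exists 0 => _ [z _ <-]|exists y]. Qed.

Lemma le_infdist x (c : R) : (forall y, A y -> c <= `|x - y|) -> c <= infdist A x.
Proof.
move=> H; apply: lb_le_inf; last by move=> _ [y Ay <-]; exact: H.
by have [y Ay] := A0; exists `|x - y|, y.
Qed.

Lemma infdist_ge0 x : 0 <= infdist A x.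
Proof. exact: le_infdist. Qed.

Lemma cont_infdist : continuous (infdist A).
Proof.
have lip x y : infdist A x - infdist A y <= `|x - y|.
  rewrite lerBlDr -lerBlDl; apply: le_infdist => z Az.
  by rewrite lerBlDl; apply: le_trans (infdist_le x Az) _; exact: ler_distD.
move=> x; apply/cont_normP => e e0; exists e => // y yx; apply: le_lt_trans yx.
by rewrite ler_norml lip andbT lerNl opprB distrC lip.
Qed.

Lemma infdist_gt0 x : closed A -> (0 < infdist A x) = (x \notin A).
Proof.
move=> cA; apply/idP/idP => [d0|].
  apply/negP; rewrite inE => Ax; have := infdist_le x Ax.
  by rewrite subrr normr0 leNgt d0.
rewrite notin_setE => nAx; have [r r0 rA] := (open_normP _).1 (closed_openC cA) x nAx.
apply: lt_le_trans r0 (le_infdist _) => y Ay; rewrite leNgt; apply/negP => xy.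
by apply: (rA y) => //; rewrite distrC.
Qed.

End InfDist.

Lemma min1_dist (a b : R) : `|Num.min 1 a - Num.min 1 b| <= `|a - b|.
Proof.
have := ler_norm (a - b); have := ler_norm (b - a); rewrite distrC => h1 h2.
by rewrite ler_norml; have [h3|h3] := leP 1 a; have [h4|h4] := leP 1 b; apply/andP; split; lra.
Qed.

(** The continuous functions [min 1 (k * d)], with [d] the distance to the complement, increase to
    the indicator of [U]. *)
Lemma lsc_approximable_open (U : set V) : open U -> lsc_approximable (\1_U : V -> R).
Proof.
move=> oU; have mU := measurable_open_Bor oU.
have cC (k : R) : continuous (fun _ : V => k) by move=> x; exact: cont_cst.
have [C0|/set0P C0] := eqVneq (~` U) set0.
  have -> : U = setT by rewrite -[U]setCK C0 setC0.
  rewrite indicT; apply: lsc_approximable_cont; first exact: cC.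
  by apply: (integrable_bounded_cont (C := 1)); [exact: cC|move=> x; rewrite normr1].
pose d := infdist (~` U).
have cU : closed (~` U) by exact: open_closedC.
have d0 x : 0 <= d x by exact: infdist_ge0.
have dgt x : (0 < d x) = (x \in U) by rewrite infdist_gt0// in_setC negbK.
pose f (k : nat) x : R := Num.min 1 (k%:R * d x).
have f0 k x : 0 <= f k x by rewrite le_min ler01 mulr_ge0.
have f1 k x : f k x <= 1 by rewrite ge_min lexx.
have cf k : continuous (f k).
  move=> x; have ck : {for x, continuous (fun y => k%:R * d y)}.
    by apply: contZ; exact: cont_infdist.
  apply/cont_normP => e e0; have [r r0 rP] := (cont_normP _ _).1 ck e e0.
  by exists r => // y /rP; apply: le_lt_trans; exact: min1_dist.
apply: (lsc_approximable_nondecreasing f0).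
- by move=> k x; rewrite le_min f1/= ge_min ler_wpM2r ?orbT// ler_nat.
- by move=> k; exact: measurable_cont.
- move=> k; apply: lsc_approximable_cont => //.
  by apply: (integrable_bounded_cont (C := 1)) => // x; rewrite ger0_norm.
- exact: integrable_indic_fun.
- move=> k x; rewrite indicE -dgt; case: ltP => //= dx.
  have dx0 : d x = 0 by apply/eqP; rewrite eq_le dx d0.
  by rewrite /f dx0 mulr0 ge_min lexx orbT.
- move=> x c; rewrite indicE -dgt; case: (ltP 0 (d x)) => [dx|_] /= c1; last first.
    by exists 0%N; apply: lt_le_trans (f0 _ _).
  have dV0 : 0 <= (d x)^-1 by rewrite invr_ge0.
  exists (Num.bound (d x)^-1); rewrite lt_min c1/=; apply: lt_le_trans c1 _.
  by rewrite -ler_pdivrMr// div1r ltW// archi_boundP.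
Qed.

(** Dynkin induction from the open sets, which are stable under intersection: complements by
    linearity, disjoint unions by monotone limits of partial sums. *)
Lemma lsc_approximable_indic (A : set T) : measurable A -> lsc_approximable (\1_A : V -> R).
Proof.
have cC (k : R) : continuous (fun _ : V => k) by move=> x; exact: cont_cst.
have bC (k : R) : integrable_fun (fun _ : V => k).
  by apply: (integrable_bounded_cont (C := `|k|)); [exact: cC|].
pose P := [set A : set T | measurable A /\ lsc_approximable (\1_A : V -> R)].
suff H : forall A, measurable A -> P A by move=> /H[].
apply: (@dynkin_induction _ T (@open V) P).
- by [].
- by move=> B C; exact: openI.
- by split => //; apply: lsc_approximable_open; exact: openT.
- by move=> B oB; split; [exact: measurable_open_Bor|exact: lsc_approximable_open].
- move=> B _ [mB aB]; split; first exact: measurableC.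
  have := lsc_approximableD (lsc_approximable_cont (cC 1) (bC 1)) (lsc_approximableZ (-1) aB).
  apply: lsc_approximable_ext => x; rewrite !indicE in_setC.
  by case: (x \in B); rewrite /= ?mulr1 ?mulr0 ?subrr ?addr0.
move=> F mF tF PF; have mU : measurable (\bigcup_k F k) by exact: bigcupT_measurable.
split => //; pose f k x : R := \sum_(j < k) \1_(F j) x.
have f0 k x : 0 <= f k x by apply: sumr_ge0 => j _; rewrite indicE.
have fE k x : f k x = \1_(\big[setU/set0]_(j < k) F j) x.
  elim: k => [|k IH]; first by rewrite /f !big_ord0 indic0.
  rewrite /f big_ord_recr/= -/(f k x) IH big_ord_recr/=.
  rewrite !indicE in_setU; case: (boolP (x \in F k)) => xk; last by rewrite orbF addr0.
  case: (boolP (x \in \big[_/_]_(_ < _) _)) => //; rewrite ?add0r//.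
  rewrite inE -bigcup_mkord => -[j /= jk Fj].
  have : (F j `&` F k) !=set0 by exists x; split => //; rewrite inE in xk.
  by move=> /tF jkE; move: jk; rewrite jkE// ltnn.
apply: (lsc_approximable_nondecreasing f0).
- by move=> k x; rewrite /f big_ord_recr/= lerDl indicE.
- move=> k; rewrite (_ : f k = \1_(\big[setU/set0]_(j < k) F j)); last exact/funext/fE.
  by apply: measurable_indic; exact: bigsetU_measurable.
- elim=> [|k IH].
    by apply: lsc_approximable_ext (lsc_approximable_cont (cC 0) (bC 0)) => x; rewrite /f big_ord0.
  have := lsc_approximableD IH (PF k).2.
  by apply: lsc_approximable_ext => x; rewrite /f [RHS]big_ord_recr.
- exact: integrable_indic_fun.
- move=> k x; rewrite fE !indicE ler_nat.
  case: (boolP (x \in \big[_/_]_(_ < _) _)) => //; rewrite inE -bigcup_mkord => -[j _ Fj].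
  by rewrite mem_set//; exists j.
- move=> x c; rewrite indicE; case: (boolP (x \in _)) => [xF|_] /= cx; last first.
    by exists 0%N; apply: lt_le_trans (f0 _ _).
  move: xF; rewrite inE => -[j _ Fj]; exists j.+1; rewrite fE indicE mem_set//.
  by rewrite -bigcup_mkord; exists j => //=.
Qed.

(** Increasing simple functions reach every nonnegative integrable function from indicators; the
    general case follows from the parts [(|f| + f) / 2] and [(|f| - f) / 2]. *)
Theorem integrable_lsc_approximable f : integrable_fun f -> lsc_approximable f.
Proof.
have pos g : (forall x, 0 <= g x) -> integrable_fun g -> lsc_approximable g.
  move=> g0 gi; have mg : measurable_fun (setT : set T) (EFin \o (g : T -> R)).
    by apply/measurable_EFinP; exact: integrable_fun_measurable.
  pose f_ := nnsfun_approx measurableT mg.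
  have fc x : (fun k => f_ k x) @ \oo --> g x.
    have g0' (y : T) : setT y -> (0 <= (EFin \o (g : T -> R)) y)%E by rewrite /= lee_fin.
    by have /fine_cvgP[_] := cvg_nnsfun_approx measurableT mg g0' (x := x) I.
  have fh x : {homo (fun k => f_ k x) : k l / (k <= l)%N >-> k <= l}.
    by move=> k l kl; have /lefP := nd_nnsfun_approx measurableT mg kl; exact.
  have fcvg x : cvgn (fun k => f_ k x) by apply/cvg_ex; exists (g x).
  apply: (@lsc_approximable_nondecreasing (fun k x => f_ k x)).
  - by move=> k x; exact: fun_ge0.
  - by move=> k x; exact: fh.
  - by move=> k; exact: measurable_funPT.
  - move=> k; apply: (@lsc_approximable_ext (fun x =>
      \sum_(y <- finmap.enum_fset (fset_set (range (f_ k)))) y * \1_(f_ k @^-1` [set y]) x)).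
      by move=> x; rewrite [RHS]fimfunE fsbig_finite.
    elim: finmap.enum_fset => [|y s IH].
      apply: lsc_approximable_ext (lsc_approximable_cont (f := fun=> 0) _ _).
      + by move=> x; rewrite big_nil.
      + by move=> x; exact: cont_cst.
      + by apply: (integrable_bounded_cont (C := 0)) => [x|x]; [exact: cont_cst|rewrite normr0].
    have my : measurable (f_ k @^-1` [set y] : set T).
      by rewrite -[_ @^-1` _]setTI; apply: measurable_funPT.
    apply: lsc_approximable_ext (lsc_approximableD (lsc_approximableZ y
      (lsc_approximable_indic my)) IH).
    by move=> x; rewrite [RHS]big_cons.
  - exact: gi.
  - by move=> k x; rewrite -(cvg_lim _ (fc x))//; exact: (nondecreasing_cvgn_le (fh x)).
  - move=> x c cg; have /cvgrPdist_lt/(_ (g x - c)) := fc x.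
    rewrite subr_gt0 => /(_ cg)[k _ /(_ k (leqnn k))] /=.
    by rewrite ltr_norml => /andP[_ h]; exists k; lra.
move=> fi.
have fp : integrable_fun (fun x => (`|f x| + f x) / 2).
  rewrite (_ : (fun x => _) = (fun x => 2^-1 * (`|f x| + f x))); last first.
    by apply/funext => x; rewrite mulrC.
  by apply: integrable_funZ; apply: integrable_funD => //; exact: integrable_fun_norm.
have fn : integrable_fun (fun x => (`|f x| - f x) / 2).
  rewrite (_ : (fun x => _) = (fun x => 2^-1 * (`|f x| - f x))); last first.
    by apply/funext => x; rewrite mulrC.
  by apply: integrable_funZ; apply: integrable_funB => //; exact: integrable_fun_norm.
have hp x : 0 <= (`|f x| + f x) / 2.
  by rewrite divr_ge0//; have := ler_norm (- f x); rewrite normrN; lra.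
have hn x : 0 <= (`|f x| - f x) / 2 by rewrite divr_ge0// subr_ge0 ler_norm.
have := lsc_approximableD (pos _ hp fp) (lsc_approximableZ (-1) (pos _ hn fn)).
by apply: lsc_approximable_ext => x; field.
Qed.

End Approximation.

(** * Harmonic measure *)

Section DensityChange.
Context d (X : measurableType d) (R : realType).
Variables (mu nu : {measure set X -> \bar R}) (K : set X) (q : X -> R).
Hypothesis mK : measurable K.
Hypothesis q0 : forall x, 0 <= q x.
Hypothesis mq : measurable_fun K q.
Hypothesis nuE : forall A, measurable A -> A `<=` K -> nu A = (\int[mu]_(x in A) (q x)%:E)%E.
Import HBNNSimple.

Lemma ge0_integral_density (f : X -> R) : measurable_fun K f -> (forall x, K x -> 0 <= f x) ->
  (\int[mu]_(x in K) (f x * q x)%:E = \int[nu]_(x in K) (f x)%:E)%E.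
Proof.
move=> mf f0.
have mfe : measurable_fun K (EFin \o f) by exact/measurable_EFinP.
have f0e x : K x -> (0 <= (EFin \o f) x)%E by move=> Kx; rewrite lee_fin f0.
pose f_ := nnsfun_approx mK mfe.
have fh x : {homo (fun k => f_ k x) : k l / (k <= l)%N >-> k <= l}.
  by move=> k l kl; have /lefP := nd_nnsfun_approx mK mfe kl; exact.
have fc x : K x -> (fun k => (f_ k x)%:E) @ \oo --> (f x)%:E.
  by move=> Kx; exact: (cvg_nnsfun_approx mK mfe f0e (x := x) Kx).
have step k : (\int[mu]_(x in K) (f_ k x * q x)%:E = \int[nu]_(x in K) (f_ k x)%:E)%E.
  have fE x : f_ k x = \sum_(y <- finmap.enum_fset (fset_set (range (f_ k))))
      y * \1_(f_ k @^-1` [set y]) x by rewrite fimfunE fsbig_finite.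
  have mA y : measurable (f_ k @^-1` [set y]).
    by rewrite -[_ @^-1` _]setTI; apply: measurable_funPT.
  have A0 y x : 0 <= y * \1_(f_ k @^-1` [set y]) x.
    rewrite indicE; case: (boolP (x \in _)) => [|_]; rewrite ?mulr0// mulr1.
    by rewrite inE => <-; exact: fun_ge0.
  have mI (m : {measure set X -> \bar R}) y : measurable_fun K (fun x => (y * \1_(f_ k @^-1` [set y]) x)).
    by apply: measurable_funM => //; exact: measurable_indic.
  transitivity (\sum_(y <- finmap.enum_fset (fset_set (range (f_ k))))
     \int[mu]_(x in K) (y * \1_(f_ k @^-1` [set y]) x * q x)%:E)%E.
    rewrite -ge0_integral_sum//; last 2 first.
    - move=> y; apply/measurable_EFinP; apply: measurable_funM => //; exact: mI.
    - by move=> y x _; rewrite lee_fin mulr_ge0.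
    by apply: eq_integral => x _; rewrite fE sumEFin mulr_suml.
  transitivity (\sum_(y <- finmap.enum_fset (fset_set (range (f_ k))))
     \int[nu]_(x in K) (y * \1_(f_ k @^-1` [set y]) x)%:E)%E; last first.
    rewrite -ge0_integral_sum//; last 2 first.
    - by move=> y; apply/measurable_EFinP; exact: mI.
    - by move=> y x _; rewrite lee_fin.
    by apply: eq_integral => x _; rewrite fE sumEFin.
  apply: eq_bigr => y _.
  (* The factor [y] leaves the integral only when it is nonnegative; for negative [y] the fibre of
     the nonnegative simple function is empty and both sides vanish. *)
  have [y0|y0] := ltP y 0.
    have E0 x : y * \1_(f_ k @^-1` [set y]) x = 0.
      rewrite indicE; case: (boolP (x \in _)) => [|_]; rewrite ?mulr0//.
      by rewrite inE/= => xy; move: y0; rewrite -xy ltNge fun_ge0.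
    by rewrite integral0_eq ?integral0_eq// => x _; rewrite E0 ?mul0r.
  have mq' : measurable_fun K (fun x => (\1_(f_ k @^-1` [set y]) x * q x)%:E).
    by apply/measurable_EFinP; apply: measurable_funM => //; exact: measurable_indic.
  have mi' : measurable_fun K (fun x => (\1_(f_ k @^-1` [set y]) x : R)%:E).
    by apply/measurable_EFinP; exact: measurable_indic.
  under eq_integral do rewrite -mulrA EFinM.
  under [RHS]eq_integral do rewrite EFinM.
  rewrite !ge0_integralZl_EFin//; last by move=> x _; rewrite lee_fin mulr_ge0.
  congr (_ * _)%E; rewrite integral_indic//.
  have mAK : measurable (f_ k @^-1` [set y] `&` K) by exact: measurableI.
  rewrite nuE// integral_mkcond [RHS]integral_mkcond; apply: eq_integral => x _.
  rewrite !patchE indicE in_setI; case: (x \in K); rewrite ?andbT ?andbF//.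
  by case: (x \in _); rewrite ?mul1r ?mul0r.
have L := @cvg_monotone_convergence _ X R mu K mK (fun k x => (f_ k x * q x)%:E) _ _ _.
have Rr := @cvg_monotone_convergence _ X R nu K mK (fun k x => (f_ k x)%:E) _ _ _.
have EL : (\int[mu]_(x in K) (f x * q x)%:E =
    \int[mu]_(x in K) limn (fun k => (f_ k x * q x)%:E))%E.
  apply: eq_integral => x; rewrite inE => Kx; apply/esym/cvg_lim => //.
  have /fine_cvgP[_ h] := fc x Kx; apply: cvg_EFin; first exact: nearW.
  exact: (cvgM h (cvg_cst (q x))).
have ER : (\int[nu]_(x in K) (f x)%:E = \int[nu]_(x in K) limn (fun k => (f_ k x)%:E))%E.
  by apply: eq_integral => x; rewrite inE => Kx; apply/esym/cvg_lim => //; exact: fc.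
rewrite EL ER -(cvg_lim _ (L _ _ _))//; last 3 first.
- by move=> k; apply/measurable_EFinP; apply: measurable_funM => //; exact: measurable_funTS.
- by move=> k x _; rewrite lee_fin mulr_ge0.
- by move=> x _ k l kl; rewrite lee_fin ler_wpM2r// fh.
rewrite -(cvg_lim _ (Rr _ _ _))//; last 3 first.
- by move=> k; apply/measurable_EFinP; exact: measurable_funTS.
- by move=> k x _; rewrite lee_fin.
- by move=> x _ k l kl; rewrite lee_fin fh.
by congr (limn _); apply/funext => k; exact: step.
Qed.

(** Positive and negative parts are transported separately, so the identity needs no
    integrability. *)
Lemma integral_density (f : X -> R) : measurable_fun K f ->
  (\int[mu]_(x in K) (f x * q x)%:E = \int[nu]_(x in K) (f x)%:E)%E.
Proof.
move=> mf; rewrite integralE [RHS]integralE.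
have pE (g : X -> R) : ((EFin \o g)^\+)%E = (fun x => (Num.max (g x) 0)%:E).
  by apply/funext => x; rewrite funeposE -EFin_max.
have nE (g : X -> R) : ((EFin \o g)^\-)%E = (fun x => (Num.max (- g x) 0)%:E).
  by apply/funext => x; rewrite funenegE -EFin_max.
rewrite (pE (fun x => f x * q x)) (nE (fun x => f x * q x)) pE nE.
congr (_ - _)%E.
- rewrite -ge0_integral_density.
  + by apply: eq_integral => x _; rewrite -[in LHS](mul0r (q x)) -maxr_pMl.
  + by apply: measurable_maxr => //.
  + by move=> x _; rewrite le_max lexx orbT.
- rewrite -ge0_integral_density.
  + by apply: eq_integral => x _; rewrite -mulNr -[in LHS](mul0r (q x)) -maxr_pMl.
  + by apply: measurable_maxr => //; exact: measurableT_comp.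
  + by move=> x _; rewrite le_max lexx orbT.
Qed.

End DensityChange.

(** * Harmonic measure and solutions of the Dirichlet problem *)

Section HarmonicMeasure.
Variables (R : realType) (n : nat).
Local Notation V := 'rV[R]_n.
Local Notation T := (Bor R n).
Implicit Types (x y : V) (D G : set V) (f g : V -> R) (m : {measure set T -> \bar R}).

Lemma harmonic_cst D (k : R) : open D -> harmonic_on D (fun _ : V => k).
Proof.
move=> oD; have dc (c : R) (v : V) : 'D_v (fun _ : V => c) = fun=> 0.
  by apply/funext => x; exact: derive_cst.
have cc (c : R) x : {for x, continuous (fun _ : V => c)} by exact: cont_cst.
split=> //; split=> x _; last first.
  by rewrite big1// => i _; rewrite dc; exact: derive_cst.
split; first exact: cc.
by move=> i j; split; [exact: derivable_cst|rewrite !dc; split; [exact: cc|split; [exact: derivable_cst|exact: cc]]].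
Qed.

Definition harmonic_extension D f H :=
  [/\ harmonic_on D H, {within closure D, continuous H} & forall z, bdry D z -> H z = f z].

Lemma regular_extension D f : regular_domain D -> continuous f -> exists H, harmonic_extension D f H.
Proof.
move=> [_ [_ rD]] cf; have [|H [hH [cH HE]]] := rD f; last by exists H.
by apply: within_cont => x _; exact: cf.
Qed.

Lemma harm_measure_total D x m : open D -> D x -> harm_measure_at D x m -> m (bdry D) = 1%E.
Proof.
move=> oD Dx [m0 mh]; have := mh (fun=> 1) (harmonic_cst 1 oD).
have -> : (\int[m]_(z in bdry D) 1%:E = m (bdry D))%E.
  rewrite (_ : (fun _ => 1%:E) = cst 1%E)// integral_cst ?mul1e//.
  exact: measurable_closed_Bor (closed_bdry oD).
by move=> <- //; apply: within_cont => y _; exact: cont_cst.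
Qed.

Lemma harm_measure_setT D x m : open D -> D x -> harm_measure_at D x m -> m setT = 1%E.
Proof.
move=> oD Dx hm; have mK := measurable_closed_Bor (closed_bdry oD).
rewrite -(setUv (bdry D)) measureU//; last exact: setICr; last exact: measurableC.
by rewrite [X in (_ + X)%E]hm.1 [X in (X + _)%E](harm_measure_total oD Dx hm) adde0.
Qed.

(** In dimension 0 the space is a point and every boundary is empty, against the total mass 1. This
    supplies the coordinate index that the maximum principle takes as an argument. *)
Lemma harm_measure_dim D x m : open D -> D x -> harm_measure_at D x m -> (0 < n)%N.
Proof.
move=> oD Dx hm; rewrite lt0n; apply/eqP => n0.
have K0 : bdry D = set0.
  apply/seteqP; split=> // y [_]; apply.
  by have -> : y = x by apply/rowP => i; have := ltn_ord i; rewrite {2}n0.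
have := harm_measure_total oD Dx hm; rewrite K0 measure0 => /eqP.
by rewrite eqe eq_sym oner_eq0.
Qed.

Lemma extension_le (i0 : 'I_n) D f g F H : bounded_set D -> harmonic_extension D f F ->
  harmonic_extension D g H -> (forall z, bdry D z -> f z <= g z) ->
  forall x, closure D x -> F x <= H x.
Proof.
move=> bD [hF cF Ff] [hH cH Hg] fg x /bdry_or[Dx|Kx]; last by rewrite Ff// Hg// fg.
apply: (wh_max_principle i0 bD (harmonic_weak hF) (harmonic_weak hH)) => // z Kz.
by rewrite Ff// Hg// fg.
Qed.

Lemma extension_ge0 (i0 : 'I_n) D f F : bounded_set D -> harmonic_extension D f F ->
  (forall z, bdry D z -> 0 <= f z) -> forall x, closure D x -> 0 <= F x.
Proof.
move=> bD hF f0; apply: (extension_le (f := fun=> 0) (F := fun=> 0) i0 bD _ hF) => //.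
by split => //; [have [[]] := hF; move=> oD _ _ _; exact: harmonic_cst|
  apply: within_cont => z _; exact: cont_cst].
Qed.

Lemma extension_integral D f F x m : D x -> harm_measure_at D x m -> harmonic_extension D f F ->
  (F x)%:E = (\int[m]_(z in bdry D) (f z)%:E)%E.
Proof.
move=> Dx [_ hm] [hF cF Ff]; rewrite hm//.
by apply: eq_integral => z; rewrite inE => /Ff ->.
Qed.

Lemma compact_bdry D : open D -> bounded_set D -> compact (bdry D).
Proof.
move=> oD bD; apply: (subclosed_compact (closed_bdry oD) (compact_closure_bounded bD)).
by move=> x [].
Qed.

Lemma integrable_within_compact (K : set V) f m : compact K -> closed K -> (m (K : set T) < +oo)%E ->
  {within K, continuous f} -> m.-integrable (K : set T) (EFin \o (f : T -> R)).
Proof.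
move=> kK cK mK cf; have mKm := measurable_closed_Bor cK.
apply: measurable_bounded_integrable => //; first exact: measurable_within.
have := compact_bounded (continuous_compact cf kK).
move=> [M [Mr H]]; exists M; split => // N MN x Kx; apply: H => //=.
by exists x.
Qed.

End HarmonicMeasure.

(** * Poisson integrals *)

Section Poisson.
Variables (R : realType) (n : nat).
Local Notation V := 'rV[R]_n.
Local Notation T := (Bor R n).
Variables (D : set V) (x0 : V) (mux : V -> {measure set T -> \bar R}).
Hypothesis regD : regular_domain D.
Hypothesis Dx0 : D x0.
Hypothesis hmux : forall x, D x -> harm_measure_at D x (mux x).
Implicit Types (x y : V) (f u v Psi : V -> R) (G : nat -> V -> R).

Let oD : open D := regD.1.1.
Let cD : connected D := regD.1.2.1.
Let bD : bounded_set D := regD.2.1.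
Let n0 : (0 < n)%N := harm_measure_dim oD Dx0 (hmux Dx0).
Let i0 : 'I_n := Ordinal n0.
Let cK : closed (bdry D) := closed_bdry oD.
Let mK : measurable (bdry D : set T) := measurable_closed_Bor cK.
Let kK : compact (bdry D) := compact_bdry oD bD.

Lemma mux_setT x : D x -> mux x setT = 1%E.
Proof. by move=> Dx; exact: harm_measure_setT oD Dx (hmux Dx). Qed.

Lemma mux_bdry x : D x -> mux x (bdry D) = 1%E.
Proof. by move=> Dx; exact: harm_measure_total oD Dx (hmux Dx). Qed.

(* [sup_k (G k)] is a superharmonic majorant of [|f|] on the boundary, of mass at most [a]. *)
Definition harmonic_majorant f (a : R) G :=
  [/\ forall k, harmonic_on D (G k), forall k, {within closure D, continuous (G k)},
      forall k x, closure D x -> 0 <= G k x <= G k.+1 x,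
      forall x c, bdry D x -> c < `|f x| -> exists k, c < G k x &
      forall k, G k x0 <= a].

(** Regularity of [D] extends each [g k] harmonically; the maximum principle keeps sign and
    monotonicity, and the value at [x0] is the integral of [g k]. *)
Lemma lsc_dominated_majorant f a : lsc_dominated (mux x0) f a ->
  exists G, harmonic_majorant f a G.
Proof.
move=> [g [cg g0 gi gs ga]].
have [G GP] := choice (fun k => regular_extension regD (cg k)).
exists G; split.
- by move=> k; have [] := GP k.
- by move=> k; have [] := GP k.
- move=> k x cx; apply/andP; split.
    by apply: (extension_ge0 i0 bD (GP k)) cx => z _; exact: g0.
  by apply: (extension_le i0 bD (GP k) (GP k.+1)) cx => z _; exact: gi.
- move=> x c Kx /gs[k kc]; exists k; have [_ _ ->] := GP k => //.
- move=> k; rewrite -lee_fin (extension_integral Dx0 (hmux Dx0) (GP k)).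
  apply: le_trans (ga k); apply: ge0_subset_integral => //.
  + by apply/measurable_EFinP; exact: measurable_cont.
  + by move=> x _; rewrite lee_fin.
Qed.

Lemma majorant_homo f a G x : harmonic_majorant f a G -> closure D x ->
  {homo (fun k => G k x) : k l / (k <= l)%N >-> k <= l}.
Proof.
by move=> [_ _ Gi _ _] cx; apply/nondecreasing_seqP => k; have /andP[] := Gi k x cx.
Qed.

Definition L1_bdry f := measurable_fun (bdry D : set T) (f : T -> R) /\
  (\int[mux x0]_(z in bdry D) (`|f z|)%:E < +oo)%E.

(** The approximation theory lives on the whole space, so boundary data are extended by zero. *)
Lemma L1_restrict f : L1_bdry f -> integrable_fun (mux x0) (f \_ (bdry D)).
Proof.
move=> [mf fi].
have mN : measurable_fun (bdry D : set T) (fun z : T => (`|f z|)%:E).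
  by apply/measurable_EFinP; exact: measurableT_comp.
have mfK : measurable_fun (setT : set T) (f \_ (bdry D) : T -> R).
  exact: (measurable_restrictT _ mK).1 mf.
apply/integrableP; split; first exact/measurable_EFinP.
apply: le_lt_trans fi; rewrite [leRHS]integral_mkcond; apply: ge0_le_integral => //.
- by apply/measurable_EFinP; exact: measurableT_comp.
- exact: (measurable_restrictT _ mK).1 mN.
- by move=> x _; rewrite /= !patchE; case: ifP => //; rewrite normr0.
Qed.

Lemma majorant_exists f a : L1_bdry f ->
  (\int[mux x0]_(z in bdry D) (`|f z|)%:E < a%:E)%E -> exists G, harmonic_majorant f a G.
Proof.
move=> Lf fa; have fi := L1_restrict Lf.
have mfin : (mux x0 setT < +oo)%E by rewrite mux_setT// ltry.
have := lsc_approximable_dominated fi (integrable_lsc_approximable mfin fi).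
move=> /(_ a) H; have [|G [hG cG Gi Gs Ga]] := @lsc_dominated_majorant (f \_ (bdry D)) a.
  apply: H; rewrite -lte_fin IntE; last exact: integrable_fun_norm.
  apply: le_lt_trans fa; rewrite [leRHS]integral_mkcond; apply: ge0_le_integral => //.
  - apply/measurable_EFinP; apply: measurableT_comp => //.
    exact: integrable_fun_measurable fi.
  - have mN : measurable_fun (bdry D : set T) (fun z : T => (`|f z|)%:E).
      by apply/measurable_EFinP; apply: measurableT_comp => //; exact: Lf.1.
    exact: (measurable_restrictT _ mK).1 mN.
  - by move=> x _; rewrite /= !patchE; case: ifP => //; rewrite normr0.
exists G; split => // x c Kx cf; apply: Gs => //.
by rewrite patchE mem_set.
Qed.

Definition harmonic_approximation f a Psi G := [/\ harmonic_on D Psi,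
  {within closure D, continuous Psi} & harmonic_majorant (fun x => f x - Psi x) a G].

Lemma approximation_exists f a : L1_bdry f -> 0 < a ->
  exists Psi G, harmonic_approximation f a Psi G.
Proof.
move=> Lf a0; have fi := L1_restrict Lf.
have mfin : (mux x0 setT < +oo)%E by rewrite mux_setT// ltry.
have [psi [cpsi _ /lsc_dominated_majorant[G [hG cG Gi Gs Ga]]]] := integrable_lsc_approximable mfin fi a0.
have [Psi [hPsi cPsi PsiE]] := regular_extension regD cpsi.
exists Psi, G; split => //; split => // x c Kx; rewrite PsiE// => cf; apply: Gs => //.
by rewrite patchE mem_set.
Qed.

(** Domination holds at every boundary point, hence it integrates against [mux x] for any [x], where
    the integral of [G k] is [G k x]. Integrability of [f] for [mux x] is part of the conclusion. *)
Lemma approximation_integral f a Psi G x (b : R) :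
  measurable_fun (bdry D : set T) (f : T -> R) ->
  harmonic_approximation f a Psi G -> D x -> (forall k, G k x <= b) ->
  (mux x).-integrable (bdry D : set T) (EFin \o (f : T -> R)) /\
  `|\int[mux x]_(z in (bdry D : set T)) f z - Psi x| <= b.
Proof.
move=> mf [hPsi cPsi [hG cG Gi Gs Ga]] Dx Gb.
have clK : bdry D `<=` closure D by move=> z [].
have mG k : measurable_fun (bdry D : set T) (G k : T -> R).
  by apply: measurable_within => //; exact: withinS (cG k).
have mPsi : measurable_fun (bdry D : set T) (Psi : T -> R).
  by apply: measurable_within => //; exact: withinS cPsi.
have mfP : measurable_fun (bdry D : set T) (fun z => f z - Psi z).
  exact: measurable_funB.
have fb : (\int[mux x]_(z in (bdry D : set T)) (`|f z - Psi z|)%:E <= b%:E)%E.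
  apply: (integral_le_sup (G := G) mK mfP mG).
  - by move=> k z /clK/(Gi k)/andP[].
  - by move=> k z /clK/(Gi k)/andP[].
  - by move=> z c Kz; exact: Gs.
  - move=> k; have Gk := (hmux Dx).2 (G k) (hG k) (cG k).
    by apply: (@le_trans _ _ (G k x)%:E); [rewrite Gk|rewrite lee_fin].
have iP : (mux x).-integrable (bdry D : set T) (EFin \o (Psi : T -> R)).
  apply: integrable_within_compact => //; last exact: withinS cPsi.
  by rewrite mux_bdry// ltry.
have ifP : (mux x).-integrable (bdry D : set T) (EFin \o (fun z : T => f z - Psi z)).
  apply/integrableP; split; first exact/measurable_EFinP.
  by apply: le_lt_trans fb _; rewrite ltry.
have fi : (mux x).-integrable (bdry D : set T) (EFin \o (f : T -> R)).
  have := integrableD mK ifP iP; apply: eq_integrable => // z _ /=.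
  by rewrite -EFinD subrK.
split => //.
have -> : Psi x = \int[mux x]_(z in (bdry D : set T)) Psi z.
  by rewrite /Rintegral -((hmux Dx).2 Psi hPsi cPsi).
rewrite -RintegralB//; apply: le_trans (le_normr_Rintegral mK ifP) _.
rewrite -lee_fin /Rintegral fineK//.
by apply: integrable_fin_num => //; exact: (integrable_abse ifP).
Qed.

(** Near [x] one constant serves all [k] and all majorants, so smallness at [x0] spreads locally
    uniformly. *)
Lemma majorant_harnack x : D x -> exists2 C : R, 0 < C & exists2 r : R, 0 < r &
  (forall y, `|y - x| < r -> D y) /\
  forall f a G, harmonic_majorant f a G -> forall k y, `|y - x| < r -> G k y <= C * a.
Proof.
move=> Dx; have [C C0 [r r0 [rD CP]]] := harnack i0 oD cD Dx0 Dx.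
exists C => //; exists r => //; split => // f a G [hG cG Gi _ Ga] k y yr.
apply: le_trans (CP _ (harmonic_weak (hG k)) _ y yr) _; last by rewrite ler_pM2l.
by move=> z Dz; have /andP[] := Gi k z (subset_closure Dz).
Qed.

Lemma L1_integrable f x : L1_bdry f -> D x ->
  (mux x).-integrable (bdry D : set T) (EFin \o (f : T -> R)).
Proof.
move=> Lf Dx; have [Psi [G PG]] := approximation_exists Lf ltr01.
have [C C0 [r r0 [_ CP]]] := majorant_harnack Dx.
have [] // := @approximation_integral f 1 Psi G x (C * 1) Lf.1 PG Dx.
by move=> k; have [_ _ hG] := PG; apply: CP hG _ _ _; rewrite subrr normr0.
Qed.

Variables (f : V -> R) (h : V -> R).
Hypothesis Lf : L1_bdry f.
Hypothesis hE : forall x, D x -> h x = \int[mux x]_(z in (bdry D : set T)) f z.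

Lemma approximation_dist a Psi G x (b : R) : harmonic_approximation f a Psi G ->
  D x -> (forall k, G k x <= b) -> `|h x - Psi x| <= b.
Proof.
by move=> PG Dx Gb; rewrite hE//; have [] := approximation_integral Lf.1 PG Dx Gb.
Qed.

Theorem poisson_harmonic : harmonic_on D h.
Proof.
have a0 (k : nat) : 0 < k.+1%:R^-1 :> R by rewrite invr_gt0.
have [Psi PsiP] := choice (fun k => approximation_exists Lf (a0 k)).
apply: (harmonic_limit (u := Psi) oD); first by move=> k; have [G []] := PsiP k.
move=> x Dx; have [C C0 [r r0 [rD CP]]] := majorant_harnack Dx.
exists r => // e e0; exists (Num.bound (C / e)) => k Kk y /= yr.
have [G PG] := PsiP k; rewrite distrC.
apply: (approximation_dist PG (rD y yr)) => j.
have [_ _ hG] := PG; apply: le_trans (CP _ _ _ hG j y yr) _.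
rewrite ler_pdivrMr// mulrC -ler_pdivrMr//.
have Ce : 0 <= C / e by rewrite divr_ge0// ltW.
apply: le_trans (ltW (archi_boundP Ce)) _.
by rewrite ler_nat (leq_trans Kk).
Qed.

End Poisson.

(** * Supports of measures carried by a compact set *)

Section SupportLemmas.
Variables (R : realType) (n : nat).
Local Notation V := 'rV[R]_n.
Local Notation T := (Bor R n).
Implicit Types (m : {measure set T -> \bar R}) (S : set V).

Lemma closed_msupp m : closed (msupp m).
Proof.
rewrite -openC; apply/open_normP => x.
move=> /existsNP[U /not_implyP[oU /not_implyP[Ux mU]]].
have [r r0 rU] := (open_normP _).1 oU x Ux.
by exists r => // y yr /(_ U oU (rU y yr)).
Qed.

Lemma msupp_sub m S : closed S -> m (~` S) = 0%E -> msupp m `<=` S.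
Proof.
move=> cS mS x xm; apply: contrapT => nSx.
by have := xm (~` S) (closed_openC cS) nSx; rewrite mS ltxx.
Qed.

(** Off the support every point has a null open neighbourhood. The part of [S] at distance at least
    [k.+1^-1] from the support is compact, so finitely many of these cover it, and countably many
    such parts exhaust [S] minus the support. *)
Lemma msupp_null m S : compact S -> closed S -> m (~` S) = 0%E -> m (~` msupp m) = 0%E.
Proof.
move=> kS cS mS.
have omC : open (~` msupp m) by rewrite openC; exact: closed_msupp.
have mC : measurable (~` msupp m : set T) by exact: measurable_open_Bor.
have nullU x : (~` msupp m) x -> exists2 U : set V, open U /\ U x & m U = 0%E.
  move=> /existsNP[U /not_implyP[oU /not_implyP[Ux mU]]]; exists U => //.
  by apply/eqP; rewrite eq_le measure_ge0 leNgt andbT; exact/negP.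
have H0 x : exists U : set V, (~` msupp m) x -> [/\ open U, U x & m U = 0%E].
  have [/nullU[U [oU Ux] mU]|nx] := pselect ((~` msupp m) x); first by exists U.
  by exists set0.
have [UU UP] := choice H0.
have compact_null (A : set V) : compact A -> closed A -> A `<=` ~` msupp m -> m (A : set T) = 0%E.
  move=> kA cA AN; move: kA; rewrite compact_cover => /(_ V A UU) H.
  have [||J JA AJ] := H; first by move=> x /AN/UP[].
    by move=> x Ax; exists x => //; have [] := UP x (AN x Ax).
  have mA : measurable (A : set T) by exact: measurable_closed_Bor.
  have JN (x : V) : [set` J] x -> (~` msupp m) x by move=> /= /JA/set_mem/AN.
  have mUU (x : V) : [set` J] x -> measurable (UU x : set T).
    by move=> /JN/UP[oU _ _]; exact: measurable_open_Bor.
  have := content_sub_fsum m (finite_fset J) mUU mA AJ.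
  rewrite fsbig1; last by move=> x /JN/UP[].
  by rewrite measure_le0 => /eqP.
have [E|/set0P ne] := eqVneq (msupp m) set0.
  rewrite E setC0 -(setUv S) measureU//; last exact: setICr; last first.
  - by apply: measurableC; exact: measurable_closed_Bor.
  - exact: measurable_closed_Bor.
  by rewrite [X in (_ + X)%E]mS [X in (X + _)%E]compact_null ?adde0// E setC0.
pose A (k : nat) := S `&` [set x | k.+1%:R^-1 <= infdist (msupp m) x].
have cA k : closed (A k).
  apply: closedI => // x cx /=; rewrite leNgt; apply/negP => xk.
  have [|d d0 dP] := (cont_normP _ _).1 (cont_infdist ne (x := x)) (k.+1%:R^-1 - infdist (msupp m) x).
    by rewrite subr_gt0.
  have [y /= ky yx] := (closure_normP _ _).1 cx d d0.
  have := dP y yx; rewrite ltr_norml => /andP[_] h; move: ky => /=; rewrite leNgt => /negP; apply.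
  by move: h; rewrite ltrD2r.
have A_null k : m (A k : set T) = 0%E.
  apply: compact_null => //.
    by apply: (subclosed_compact (cA k) kS) => x [].
  move=> x [_ /= kx] xm; have := infdist_le x xm.
  rewrite subrr normr0 => /(le_trans kx); rewrite leNgt invr_gt0 ltr0n.
  by [].
apply/eqP; rewrite -measure_le0.
(* Index 0 is reserved for the null set outside [S]. *)
have sub : ~` msupp m `<=` \bigcup_k (if k is k'.+1 then A k' else ~` S).
  move=> x xm; have [Sx|nSx] := pselect (S x); last by exists 0%N.
  have : 0 < infdist (msupp m) x.
    by rewrite infdist_gt0// ?notin_setE//; exact: closed_msupp.
  rewrite -invr_gt0 => d0; exists (Num.bound (infdist (msupp m) x)^-1).+1 => //.
  split => //=; rewrite -[leRHS]invrK lef_pV2 ?posrE//.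
  by apply: le_trans (ltW (archi_boundP (ltW d0))) _; rewrite ler_nat.
have mF k : measurable (if k is k'.+1 then A k' else ~` S : set T).
  case: k => [|k]; last by apply: measurable_closed_Bor.
  by apply: measurableC; exact: measurable_closed_Bor.
have := measure_sigma_subadditive m mF mC sub.
by rewrite eseries0// => -[|k] _ _ //=.
Qed.

End SupportLemmas.

(** * Boundary values and Hardy norms of Poisson integrals *)

Section Markov.
Context d (X : measurableType d) (R : realType) (m : {measure set X -> \bar R}).

Lemma markov_bound (A S : set X) (g : X -> R) (a c : R) : 0 < c -> measurable S -> measurable A ->
  A `<=` S -> measurable_fun S g -> (forall x, S x -> 0 <= g x) -> (forall x, A x -> c <= g x) ->
  (\int[m]_(x in S) (g x)%:E <= a%:E)%E -> (m A <= (a / c)%:E)%E.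
Proof.
move=> c0 mS mA AS mg g0 gc ga.
have : (c%:E * m A <= a%:E)%E.
  apply: le_trans ga; rewrite -integral_cst//.
  apply: (@le_trans _ _ (\int[m]_(x in A) (g x)%:E)%E).
    apply: ge0_le_integral => //.
    - by move=> x _; rewrite lee_fin ltW.
    - by apply/measurable_EFinP; exact: measurable_funS mg.
  by apply: ge0_subset_integral => //; exact/measurable_EFinP.
by rewrite -[X in (X <= _)%E -> _]muleC -lee_pdivlMr// -EFinM.
Qed.

End Markov.

(** * Harmonic measure of a domain with closure in [D] *)

Section Subdomain.
Variables (R : realType) (n : nat).
Local Notation V := 'rV[R]_n.
Local Notation T := (Bor R n).
Variables (D S' : set V) (x0 : V) (m : {measure set T -> \bar R}).
Hypothesis oS' : open S'.
Hypothesis hm : harm_measure_at S' x0 m.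
Hypothesis SD : closure S' `<=` D.
Implicit Types (f u F : V -> R) (G : nat -> V -> R).

Let mS : measurable (bdry S' : set T) := measurable_closed_Bor (closed_bdry oS').

Lemma bdry_subdomain : bdry S' `<=` D.
Proof. by move=> x [/SD]. Qed.

Lemma subdomain_integral F : harmonic_on D F -> (F x0)%:E = (\int[m]_(z in bdry S') (F z)%:E)%E.
Proof.
move=> hF; apply: hm.2.
  by apply: harmonic_onS oS' _ hF => x Sx; apply: SD; exact: subset_closure.
by apply: within_cont => x /SD Dx; have [+ _] := (harmonic_weak hF).2 x Dx.
Qed.

Lemma cont_on_bdry F : (forall x, D x -> {for x, continuous F}) -> {within bdry S', continuous F}.
Proof. by move=> cF; apply: within_cont => x /bdry_subdomain; exact: cF. Qed.

Lemma measurable_on_bdry F : (forall x, D x -> {for x, continuous F}) ->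
  measurable_fun (bdry S' : set T) (F : T -> R).
Proof. by move=> cF; apply: measurable_within => //; exact: cont_on_bdry. Qed.

Lemma measurable_bdry_gt F (c : R) : (forall x, D x -> {for x, continuous F}) ->
  measurable (bdry S' `&` [set x | c < F x] : set T).
Proof.
move=> cF; have [U oU ->] := within_superlevel_open c (cont_on_bdry cF).
by apply: measurableI => //; exact: measurable_open_Bor.
Qed.

Lemma msupp_bdry : msupp m `<=` bdry S'.
Proof. by apply: msupp_sub hm.1; exact: closed_bdry. Qed.

Lemma measurable_msupp_gt F (c : R) : (forall x, D x -> {for x, continuous F}) ->
  measurable ([set x | msupp m x /\ (c < F x)%R] : set T).
Proof.
move=> cF; rewrite (_ : [set x | _] = msupp m `&` (bdry S' `&` [set x | c < F x])).
  by apply: measurableI; [exact: measurable_closed_Bor (@closed_msupp _ _ m)|exact: measurable_bdry_gt].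
by apply/seteqP; split=> [x [xm cx]|x [xm [_ cx]]]//; split => //; split => //; exact: msupp_bdry.
Qed.

Lemma measurable_msupp_lt F (c : R) : (forall x, D x -> {for x, continuous F}) ->
  measurable ([set x | msupp m x /\ (F x < c)%R] : set T).
Proof.
move=> cF; rewrite (_ : [set x | _] = [set x | msupp m x /\ (- c < (fun y => - F y) x)%R]).
  by apply: measurable_msupp_gt => x Dx; apply: contN; exact: cF.
by apply/seteqP; split=> x [xm]; rewrite /= ltrN2.
Qed.

Definition super_set G (c : R) := [set x | exists k, c < G k x].

(** Markov's inequality for each [G k], whose integral is [G k x0 <= a], then continuity from below
    along the increasing superlevel sets. The bound does not involve the subdomain. *)
Lemma majorant_super_set f a G c : harmonic_majorant D x0 f a G -> 0 < c ->
  measurable (bdry S' `&` super_set G c : set T) /\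
  (m (bdry S' `&` super_set G c) <= (a / c)%:E)%E.
Proof.
move=> hG c0; have [hGk cG Gi _ Ga] := hG.
pose A k : set V := bdry S' `&` [set x | c < G k x].
have cGk k x : D x -> {for x, continuous (G k)}.
  by move=> Dx; have [+ _] := (harmonic_weak (hGk k)).2 x Dx.
have mA k : measurable (A k : set T) by exact: measurable_bdry_gt (cGk k).
have UA : bdry S' `&` super_set G c = \bigcup_k A k.
  by apply/seteqP; split=> [x [Sx [k kx]]|x [k _ [Sx kx]]]; [exists k|split => //; exists k].
have mU : measurable (\bigcup_k A k : set T) by exact: bigcupT_measurable.
rewrite UA; split => //.
have clD x : bdry S' x -> closure D x by move=> /bdry_subdomain; exact: subset_closure.
have hA : {homo (A : nat -> set T) : k l / (k <= l)%N >-> (k <= l)%O}.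
  move=> k l kl; apply/subsetPset => x [Sx kx]; split => //.
  by apply: lt_le_trans kx _; exact: (majorant_homo hG (clD x Sx) kl).
have L := @nondecreasing_cvg_mu _ T R m A mA mU hA.
rewrite -(cvg_lim _ L)//; apply: lime_le; first by apply/cvg_ex; eexists; exact: L.
apply: nearW => k /=.
apply: (@markov_bound _ T R m (A k) (bdry S') (G k) a c c0 mS (mA k)).
- by move=> x [].
- exact: measurable_on_bdry (cGk k).
- by move=> x /clD/(Gi k)/andP[].
- by move=> x [_ /ltW].
- by rewrite -subdomain_integral// lee_fin.
Qed.

End Subdomain.

Section PoissonBoundary.
Variables (R : realType) (n : nat).
Local Notation V := 'rV[R]_n.
Local Notation T := (Bor R n).
Variables (D : set V) (x0 : V) (mux : V -> {measure set T -> \bar R}).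
Hypothesis regD : regular_domain D.
Hypothesis Dx0 : D x0.
Hypothesis hmux : forall x, D x -> harm_measure_at D x (mux x).
Variables (Dr : R -> set V) (mur : R -> {measure set T -> \bar R}).
Hypothesis hDr : forall r, r < 0 -> [/\ regular_domain (Dr r), Dr r x0 &
                          harm_measure_at (Dr r) x0 (mur r)].
Hypothesis DrD : forall r, r < 0 -> closure (Dr r) `<=` D.
Implicit Types (f h Psi : V -> R) (G : nat -> V -> R).

Let oD : open D := regD.1.1.
Let mK : measurable (bdry D : set T) := measurable_closed_Bor (closed_bdry oD).

(** The function [f] itself is the strong limit along every sequence, with [j0 = 0]: the exceptional
    set is [sup_k G_k > e / 4], and off it both [|f - Psi|] on the boundary and [|h - Psi|] inside
    are at most [e / 4]. *)
Lemma poisson_boundary_values f h : L1_bdry D x0 mux f ->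
  (forall x, D x -> h x = \int[mux x]_(z in (bdry D : set T)) f z) ->
  has_boundary_values D (mux x0) mur h f.
Proof.
move=> Lf hE; have hh := poisson_harmonic regD Dx0 hmux Lf hE.
have ch x : D x -> {for x, continuous h} by move=> Dx; have [] := (harmonic_weak hh).2 x Dx.
move=> rs rs0 _ _; exists f; split; last exact: aeW.
move=> a b ab e dl e0 dl0.
pose eta := dl * e / 16.
have eta0 : 0 < eta by rewrite divr_gt0// mulr_gt0.
have [Psi [G PG]] := approximation_exists regD Dx0 hmux Lf eta0.
have [hPsi cPsi hG] := PG; have [_ cG _ Gs _] := hG.
have [U1 [oU1 E1]] := within_superlevelP (a - e / 2) cPsi.
have [U2 [oU2 E2]] := within_superlevelP (- (b + e / 2)) (withinN cPsi).
have [U3 U3P] := choice (fun k => within_superlevelP (e / 4) (cG k)).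
(* The open set must contain every support point with [a <= f < b], even where [Psi] approximates
   [f] badly; adding the open exceptional set achieves this at a small cost in measure. *)
pose U := (U1 `&` U2) `|` \bigcup_k U3 k.
have oU : open U.
  by apply: openU; [exact: openI|apply: bigcup_open => k _; have [] := U3P k].
have UE x : closure D x -> U x <-> (a - e / 2 < Psi x < b + e / 2 \/ super_set G (e / 4) x).
  move=> cx; have {E1} := E1 x cx; have := E2 x cx; rewrite ltrN2 => {}E2 E1.
  have {U3P} E3 k : U3 k x <-> e / 4 < G k x by have [_] := U3P k; exact.
  split.
    case=> [[/E1 -> /E2 ->]|[k _ /E3 kx]]; [by left|by right; exists k].
  case=> [/andP[/E1 h1 /E2 h2]|[k /E3 kx]]; [by left|by right; exists k].
exists 0%N, (U `&` closure D); split; first by exists U.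
split.
  move=> x [xm /andP[ax xb]].
  have Kx : bdry D x by apply: (msupp_bdry oD (hmux Dx0)).
  have cx : closure D x by case: Kx.
  split => //; apply/(UE x cx).
  have [sx|nsx] := pselect (super_set G (e / 4) x); [by right|left].
  have : `|f x - Psi x| <= e / 4.
    by rewrite leNgt; apply/negP => /(Gs x _ Kx)[k kx]; apply: nsx; exists k.
  by rewrite ler_norml => /andP[h1 h2]; apply/andP; split; lra.
move=> j _.
have [[[oS _] [bS _]] Sx0 hm] := hDr (rs0 j).
have SD := DrD (rs0 j).
have [mB Bm] := majorant_super_set oS hm SD hG (divr_gt0 e0 (ltr0n _ 4)).
have inB (P : V -> Prop) : (forall x, P x -> D x -> closure D x -> a - e / 2 < Psi x < b + e / 2 ->
      (forall k, G k x <= e / 4) -> False) ->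
    [set x | msupp (mur (rs j)) x /\ P x] `&` (U `&` closure D) `<=`
    bdry (Dr (rs j)) `&` super_set G (e / 4).
  move=> HP x [[xm Px] [Ux cx]].
  have Sx := msupp_bdry oS hm xm; split => //.
  apply: contrapT => nsx; have [Psix|//] := (UE x cx).1 Ux.
  have Dx : D x := bdry_subdomain SD Sx.
  apply: (HP x Px Dx cx Psix) => k; rewrite leNgt; apply/negP => kx.
  by apply: nsx; exists k.
have mUc : measurable (U `&` closure D : set T).
  by apply: measurableI; [exact: measurable_open_Bor|apply: measurable_closed_Bor; exact: closed_closure].
have bnd (A : set T) : measurable A -> A `<=` bdry (Dr (rs j)) `&` super_set G (e / 4) ->
    (mur (rs j) A <= (dl / 4)%:E)%E.
  move=> mA AB; apply: (@le_trans _ _ ((eta / (e / 4))%:E)).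
    by apply: le_trans Bm; apply: le_measure => //; rewrite inE.
  rewrite lee_fin le_eqVlt; apply/orP; left; apply/eqP.
  by rewrite /eta; field; rewrite gt_eqF.
apply: (@le_lt_trans _ _ ((dl / 4)%:E + (dl / 4)%:E)%E); last first.
  by rewrite -EFinD lte_fin; lra.
apply: leeD; apply: bnd.
- by apply: measurableI => //; exact: (measurable_msupp_lt oS hm SD).
- apply: inB => x hx Dx cx /andP[h1 h2] Gx.
  have := approximation_dist regD hmux Lf hE PG Dx Gx.
  by rewrite ler_norml => /andP[h3 h4]; lra.
- by apply: measurableI => //; exact: (measurable_msupp_gt oS hm SD).
- apply: inB => x hx Dx cx /andP[h1 h2] Gx.
  have := approximation_dist regD hmux Lf hE PG Dx Gx.
  by rewrite ler_norml => /andP[h3 h4]; lra.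
Qed.

Section Lp.
Variables (p : R) (f h : V -> R).
Hypothesis p1 : 1 < p.
Hypothesis Lpf : in_Lp (mux x0) (bdry D) p f.
Hypothesis hE : forall x, D x -> h x = \int[mux x]_(z in (bdry D : set T)) f z.

Let p0 : 0 < p. Proof. exact: lt_trans p1. Qed.

Lemma L1_powR : L1_bdry D x0 mux (fun z => `|f z| `^ p).
Proof.
have [mf fp] := Lpf; split.
  apply: (measurableT_comp (measurable_powR p)); exact: measurableT_comp.
by under eq_integral do rewrite ger0_norm ?powR_ge0//.
Qed.

Lemma Lp_L1 : L1_bdry D x0 mux f.
Proof.
have [mf fp] := Lpf; split => //.
apply: (@le_lt_trans _ _ (\int[mux x0]_(z in bdry D) (1 + `|f z| `^ p)%:E)%E).
  apply: ge0_le_integral => //.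
  - by apply/measurable_EFinP; exact: measurableT_comp.
  - apply/measurable_EFinP; apply: measurable_funD => //.
    by apply: (measurableT_comp (measurable_powR p)); exact: measurableT_comp.
  - move=> x _; rewrite lee_fin; have [f1|f1] := leP `|f x| 1.
      by apply: le_trans f1 _; rewrite lerDl powR_ge0.
    have := ler_powR (ltW f1) (ltW p1); rewrite powRr1// => h1.
    by apply: le_trans h1 _; rewrite lerDr.
under eq_integral do rewrite EFinD.
rewrite ge0_integralD//; last first.
  apply/measurable_EFinP.
  by apply: (measurableT_comp (measurable_powR p)); exact: measurableT_comp.
apply: lte_add_pinfty fp.
rewrite (_ : (fun _ => 1%:E) = cst 1%E)// integral_cst ?mul1e//.
by rewrite (mux_bdry regD hmux Dx0) ltry.
Qed.

Lemma poisson_jensen x : D x ->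
  `|h x| `^ p <= \int[mux x]_(z in (bdry D : set T)) (`|f z| `^ p).
Proof.
move=> Dx; have fi := L1_integrable regD Dx0 hmux Lp_L1 Dx.
have gi := L1_integrable regD Dx0 hmux L1_powR Dx.
have fni : (mux x).-integrable (bdry D : set T) (EFin \o (fun z : T => `|f z|)).
  exact: (integrable_abse fi).
set v := \int[mux x]_(z in _) _; set s := `|h x|.
have s0 : 0 <= s by rewrite /s normr_ge0.
have q0 : 0 < p - 1 by rewrite subr_gt0.
pose q := p / (p - 1); have qq0 : 0 < q by rewrite divr_gt0.
have pq : p^-1 + q^-1 = 1 by rewrite /q; field; rewrite !gt_eqF.
have sI : s <= \int[mux x]_(z in (bdry D : set T)) `|f z|.
  by rewrite /s hE//; exact: le_normr_Rintegral.
have sp : s `^ (p - 1) * s = s `^ p.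
  have [->|sn0] := eqVneq s 0; first by rewrite mulr0 powR0// gt_eqF.
  by rewrite -{2}(powRr1 s0) -powRD ?sn0 ?implybT// subrK.
have young z : s `^ (p - 1) * `|f z| <= p^-1 * (`|f z| `^ p) + s `^ p / q.
  have := conjugate_powR (normr_ge0 (f z)) (powR_ge0 s (p - 1)) p0 qq0 pq.
  rewrite -powRrM (_ : (p - 1) * q = p); last by rewrite /q mulrC divfK// gt_eqF.
  by rewrite mulrC [_ / p]mulrC.
have mK1 : (mux x (bdry D) < +oo)%E by rewrite (mux_bdry regD hmux Dx) ltry.
have ci : (mux x).-integrable (bdry D : set T) (EFin \o (fun _ : T => s `^ p / q)).
  apply: measurable_bounded_integrable => //.
  by exists `|s `^ p / q|; split; [exact: num_real|move=> N MN z _; exact: ltW].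
have zi : (mux x).-integrable (bdry D : set T) (EFin \o (fun z : T => p^-1 * (`|f z| `^ p))).
  exact: (integrableZl mK p^-1 gi).
have E2 : \int[mux x]_(z in (bdry D : set T)) (p^-1 * (`|f z| `^ p) + s `^ p / q)
    = p^-1 * v + s `^ p / q.
  rewrite (RintegralD mK zi ci) (RintegralZl _ mK gi) -/v; congr (_ + _).
  by rewrite (Rintegral_cst _ mK) (mux_bdry regD hmux Dx) mulr1.
have h1 : s `^ (p - 1) * \int[mux x]_(z in (bdry D : set T)) `|f z| <= p^-1 * v + s `^ p / q.
  rewrite -E2 -(RintegralZl _ mK fni); apply: (le_Rintegral mK) => //.
  - exact: (integrableZl mK (s `^ (p - 1)) fni).
  - exact: (integrableD mK zi ci).
have h2 : s `^ (p - 1) * s <= p^-1 * v + s `^ p / q.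
  by apply: le_trans h1; apply: ler_wpM2l => //; exact: powR_ge0.
rewrite sp in h2.
have -> : v = p * (p^-1 * v) by rewrite mulrA divff ?mul1r// gt_eqF.
have qE : q^-1 = 1 - p^-1 by rewrite -pq; ring.
rewrite qE in h2.
have h3 : s `^ p * p^-1 <= p^-1 * v by lra.
by rewrite -ler_pdivrMl// mulrC.
Qed.

(** The Poisson integral [v] of [|f|]^ p[is a harmonic majorant of]|h| [^ p], and its integral
    against [mur r] is [v x0] for every [r]. *)
Lemma poisson_Sp_bound r : r < 0 ->
  (\int[mur r]_(z in bdry (Dr r)) (`|h z| `^ p)%:E <=
   \int[mux x0]_(z in bdry D) (`|f z| `^ p)%:E)%E.
Proof.
move=> r0; have [[[oS _] [bS _]] Sx0 hm] := hDr r0; have SD := DrD r0.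
pose v x := \int[mux x]_(z in (bdry D : set T)) (`|f z| `^ p).
have hv : harmonic_on D v by exact: (poisson_harmonic regD Dx0 hmux L1_powR).
have hh : harmonic_on D h by exact: (poisson_harmonic regD Dx0 hmux Lp_L1 hE).
have cw w x : harmonic_on D w -> D x -> {for x, continuous w}.
  by move=> hw Dx; have [] := (harmonic_weak hw).2 x Dx.
have mS : measurable (bdry (Dr r) : set T) by apply: measurable_closed_Bor; exact: closed_bdry.
have -> : (\int[mux x0]_(z in bdry D) (`|f z| `^ p)%:E = (v x0)%:E)%E.
  rewrite /v /Rintegral fineK//; apply: integrable_fin_num => //.
  exact: (L1_integrable regD Dx0 hmux L1_powR Dx0).
rewrite (subdomain_integral oS hm SD hv).
apply: ge0_le_integral => //.
- apply/measurable_EFinP; apply: (measurableT_comp (measurable_powR p)).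
  apply: measurableT_comp => //; apply: (measurable_on_bdry oS SD) => x; exact: cw.
- by apply/measurable_EFinP; apply: (measurable_on_bdry oS SD) => x; exact: cw.
- by move=> x /(bdry_subdomain SD) Dx; rewrite lee_fin; exact: poisson_jensen.
Qed.

Lemma poisson_Sp_pow_le :
  (Sp_pow Dr mur p h <= \int[mux x0]_(z in bdry D) (`|f z| `^ p)%:E)%E.
Proof.
apply: (@le_trans _ _ (ereal_sup [set (\int[mur r]_(z in bdry (Dr r)) (`|h z| `^ p)%:E)%E | r in `]- 1, 0[])).
  by apply: ereal_inf_lbound; exists 1 => //; rewrite /= ltr01.
apply: ge_ereal_sup => _ [r /= + <-]; rewrite in_itv/= => /andP[_ r0].
exact: poisson_Sp_bound.
Qed.

End Lp.
End PoissonBoundary.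

(** * Uniqueness *)

Section Uniqueness.
Variables (R : realType) (n : nat).
Local Notation V := 'rV[R]_n.
Local Notation T := (Bor R n).
Variables (D : set V) (x0 : V) (mux : V -> {measure set T -> \bar R}).
Hypothesis regD : regular_domain D.
Hypothesis Dx0 : D x0.
Hypothesis hmux : forall x, D x -> harm_measure_at D x (mux x).
Variables (Dr : R -> set V) (mur : R -> {measure set T -> \bar R}).
Hypothesis hDr : forall r, r < 0 -> [/\ regular_domain (Dr r), Dr r x0 &
                          harm_measure_at (Dr r) x0 (mur r)].
Hypothesis DrS : forall r s, r < s -> s < 0 -> closure (Dr r) `<=` Dr s.
Hypothesis DrU : \bigcup_(r in `]-oo, 0[) Dr r = D.
Implicit Types (f h Psi : V -> R) (G : nat -> V -> R).

Let oD : open D := regD.1.1.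
Let bD : bounded_set D := regD.2.1.
Let mK : measurable (bdry D : set T) := measurable_closed_Bor (closed_bdry oD).

Lemma exhaustion_sub r : r < 0 -> Dr r `<=` D.
Proof. by move=> r0 x rx; rewrite -DrU; exists r => //=; rewrite in_itv/=. Qed.

Lemma exhaustion_closure r : r < 0 -> closure (Dr r) `<=` D.
Proof.
move=> r0; have r20 : r / 2 < 0 by lra.
by apply: (subset_trans (DrS _ r20)); [lra|exact: exhaustion_sub].
Qed.

Lemma exhaustion_mono r s : r <= s -> s < 0 -> Dr r `<=` Dr s.
Proof.
rewrite le_eqVlt => /predU1P[->|rltS] s0; first by [].
exact: (subset_trans (@subset_closure _ _) (DrS rltS s0)).
Qed.

Lemma seq_lt0 (k : nat) : - k.+1%:R^-1 < 0 :> R.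
Proof. by rewrite oppr_lt0 invr_gt0. Qed.

Lemma seq_cvg0 (r : R) : r < 0 -> exists K : nat, forall k, (K <= k)%N -> r < - k.+1%:R^-1.
Proof.
move=> r0; exists (Num.bound (- r)^-1) => k Kk.
have r0' : 0 < - r by rewrite oppr_gt0.
rewrite ltrNr -[ltRHS]invrK ltf_pV2 ?posrE ?invr_gt0//.
apply: lt_le_trans (archi_boundP _) _; first by rewrite invr_ge0 ltW.
by rewrite ler_nat (leq_trans Kk).
Qed.

Lemma measure_le (m : {measure set T -> \bar R}) (A B : set T) :
  measurable A -> measurable B -> A `<=` B -> (m A <= m B)%E.
Proof. by move=> mA mB AB; apply: le_measure => //; exact: mem_set. Qed.

(* Upper semicontinuity of the weak limit of [mur r] on closed sets, up to the factor [2]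
   lost to the cut-off level [1/2] of a superharmonic majorant of the indicator. *)
Lemma exhaustion_usc (F : set V) (b : R) : closed F -> F `<=` closure D ->
  (mux x0 (F `&` bdry D) < b%:E)%E -> exists K : nat, forall r, r < 0 -> - K.+1%:R^-1 < r ->
  (mur r (F `&` bdry (Dr r)) <= (2 * b)%:E)%E.
Proof.
move=> clF FD Fb.
have mF : measurable (F : set T) by exact: measurable_closed_Bor.
pose f : V -> R := \1_F.
have mf : measurable_fun (bdry D : set T) (f : T -> R) by exact: measurable_indic.
have fE : (\int[mux x0]_(z in bdry D) (`|f z|)%:E = mux x0 (F `&` bdry D))%E.
  rewrite -integral_indic//; apply: eq_integral => z _.
  by rewrite /f indicE ger0_norm.
have Lf : L1_bdry D x0 mux f by split => //; rewrite fE; apply: lt_trans Fb _; rewrite ltry.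
have [|G hG] := @majorant_exists _ _ D x0 mux regD Dx0 hmux f b Lf; first by rewrite fE.
have [hGk cG Gi Gs Ga] := hG.
have [U UP] := choice (fun k => within_superlevelP 2^-1 (cG k)).
(* The sets where [G k > 1 / 2] cover [F] on the boundary of [D], as the indicator is 1 there; the
   exhausting domains cover the rest. After compactness, the boundary of [Dr r] with [r] near 0
   avoids the finitely many domains and so meets [F] only where some [G k] exceeds [1 / 2]. *)
pose W (k : nat) := U k `|` Dr (- k.+1%:R^-1).
have oDr r : r < 0 -> open (Dr r) by move=> /hDr[[[]]].
have oW k : setT k -> open (W k).
  by move=> _; apply: openU; [have [] := UP k|apply: oDr; exact: seq_lt0].
have kF : compact F := subclosed_compact clF (compact_closure_bounded bD) FD.
have FW : F `<=` cover setT W.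
  move=> x Fx; have [Dx|Kx] := bdry_or (FD x Fx).
    move: Dx; rewrite -DrU => -[r /=]; rewrite in_itv/= => r0 rx.
    have [K KP] := seq_cvg0 r0; exists K => //; right.
    by apply: exhaustion_mono rx; [apply: ltW; exact: KP|exact: seq_lt0].
  have [|k kx] := Gs x 2^-1 Kx.
    by rewrite /f indicE mem_set//= normr1 invf_lt1// ltr1n.
  by exists k => //; left; apply/((UP k).2 x (FD x Fx)).
move: kF; rewrite compact_cover => /(_ _ _ _ oW FW)[J _ FJ].
exists (\max_(k <- J) k)%N => r r0 Kr.
have [[[oS _] [bS _]] Sx0 hm] := hDr r0; have SD := exhaustion_closure r0.
have h20 : 0 < 2^-1 :> R by rewrite invr_gt0.
have [mB Bm] := majorant_super_set oS hm SD hG h20.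
rewrite mulrC -[2]invrK; apply: le_trans Bm; apply: measure_le => //.
  by apply: measurableI => //; apply: measurable_closed_Bor; exact: closed_bdry.
move=> x [Fx Sx]; split => //; have [k kJ [Ux|kx]] := FJ x Fx.
  by exists k; apply/((UP k).2 x (FD x Fx)).
exfalso; have [_] := Sx; apply; apply: exhaustion_mono kx => //.
apply: le_trans (ltW Kr); rewrite lerN2 lef_pV2 ?posrE// ler_nat ltnS.
exact: leq_bigmax_seq.
Qed.

Variables (p : R) (f h u : V -> R).
Hypothesis p1 : 1 < p.
Hypothesis Lpf : in_Lp (mux x0) (bdry D) p f.
Hypothesis hE : forall x, D x -> h x = \int[mux x]_(z in (bdry D : set T)) f z.
Hypothesis hu : harmonic_on D u.
Hypothesis Su : in_Sp D Dr mur p u.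
Hypothesis bu : has_boundary_values D (mux x0) mur u f.

Let rs (j : nat) : R := - j.+1%:R^-1.
Let p0 : 0 < p. Proof. exact: lt_trans p1. Qed.
Let Lf : L1_bdry D x0 mux f := Lp_L1 regD Dx0 hmux p1 Lpf.
Let hh : harmonic_on D h := poisson_harmonic regD Dx0 hmux Lf hE.

Lemma cont_harmonic w x : harmonic_on D w -> D x -> {for x, continuous w}.
Proof. by move=> hw Dx; have [] := (harmonic_weak hw).2 x Dx. Qed.

Lemma rs_homo : {homo rs : i j / (i <= j)%N >-> i <= j}.
Proof. by move=> i j ij; rewrite lerN2 lef_pV2 ?posrE// ler_nat. Qed.

Lemma rs_cvg : rs @ \oo --> (0 : R).
Proof.
apply/cvgrPdist_lt => e e0; have [|K KP] := @seq_cvg0 (- e); first by rewrite oppr_lt0.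
exists K => // j /= /KP; rewrite ltrN2 => Kj.
by rewrite sub0r normrN ltr0_norm ?seq_lt0// opprK.
Qed.

Lemma measure_union_le (m : {measure set T -> \bar R}) (B C : set T) (b c : R) :
  measurable B -> measurable C ->
  (m B <= b%:E)%E -> (m C <= c%:E)%E -> (m (B `|` C) <= (b + c)%:E)%E.
Proof.
move=> mB mC Bb Cc; rewrite EFinD.
by apply: le_trans (leeD Bb Cc); exact: measureU2.
Qed.

Lemma measure_cover2 (m : {measure set T -> \bar R}) (A B C : set T) (b c : R) :
  measurable A -> measurable B -> measurable C -> A `<=` B `|` C ->
  (m B <= b%:E)%E -> (m C <= c%:E)%E -> (m A <= (b + c)%:E)%E.
Proof.
move=> mA mB mC ABC Bb Cc; apply: le_trans (measure_union_le mB mC Bb Cc).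
by apply: measure_le => //; exact: measurableU.
Qed.

(** The range [[- M, M)] of [f] is cut into [N] slabs of width [c]. The strong limit confines [u]
    near each slab, and continuity of [Psi] confines [Psi]; so [u] is close to [Psi], hence to [h],
    except on small sets and on the closed set [F] that no slab reaches. *)
Lemma convergence_in_measure (e dl : R) : 0 < e -> 0 < dl -> exists j0, forall j, (j0 <= j)%N ->
  (mur (rs j) (bdry (Dr (rs j)) `&` [set x | (e < `|u x - h x|)%R]) <= dl%:E)%E.
Proof.
move=> e0 dl0.
have [phis [SL aephi]] := bu seq_lt0 rs_homo rs_cvg.
(* Off the exceptional sets [u] and [Psi] lie in one interval of length [3 * c] and
   [|h - Psi| <= c], so that [|u - h| <= 4 * c < e]. *)
pose c := e / 5; have c0 : 0 < c by rewrite divr_gt0.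
(* The losses are [6 * b] from [F], [dl / 4] from all slabs together and [b] from the majorant:
   [11 * dl / 16] in all. *)
pose b := dl / 16; have b0 : 0 < b by rewrite divr_gt0.
have [Psi [G PG]] := approximation_exists regD Dx0 hmux Lf (mulr_gt0 b0 c0).
have [hPsi cPsi hG] := PG; have [_ cG Gi Gs Ga] := hG.
have [I0 I0f] : exists I0 : R, (\int[mux x0]_(z in bdry D) (`|f z|)%:E <= I0%:E)%E.
  exists (fine (\int[mux x0]_(z in bdry D) (`|f z|)%:E)%E); rewrite fineK//.
  rewrite ge0_fin_numE; first exact: Lf.2.
  by apply: integral_ge0 => z _; rewrite lee_fin.
(* By Markov's inequality the set where [|f| >= M] then has measure at most [b]. *)
pose M := (`|I0| + 1) / b.
have I01 : 0 < `|I0| + 1 by rewrite ltr_wpDl.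
have M0 : 0 < M by rewrite divr_gt0.
have IM : I0 / M <= b.
  rewrite ler_pdivrMr// /M mulrC divfK ?gt_eqF//.
  by apply: le_trans (ler_norm _) _; rewrite lerDl.
pose N := Num.bound (2 * M / c).
have NM : 2 * M < c * N%:R.
  by rewrite [ltRHS]mulrC -ltr_pdivrMr// archi_boundP// divr_ge0 ?ltW// mulr_gt0.
pose a (i : nat) := - M + i%:R * c.
have d1 : 0 < dl / 4 / N.+1%:R by rewrite !divr_gt0.
have SLi i : exists j0O : nat * set V,
    (exists U : set V, open U /\ j0O.2 = U `&` closure D) /\
    [set x | msupp (mux x0) x /\ a i <= phis x < a i + c] `<=` j0O.2 /\
    forall j : nat, (j0O.1 <= j)%N ->
      (mur (rs j) ([set x | msupp (mur (rs j)) x /\ (u x < a i - c)%R] `&` j0O.2) +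
       mur (rs j) ([set x | msupp (mur (rs j)) x /\ (a i + c + c < u x)%R] `&` j0O.2)
       < (dl / 4 / N.+1%:R)%:E)%E.
  have aic : a i < a i + c by rewrite ltrDl.
  by have [j0 [W0 HW0]] := SL _ _ aic c _ c0 d1; exists (j0, W0).
have [jO jOP] := choice SLi.
have H3 i : exists U : set V, open U /\ (jO i).2 `&` [set x | a i - c < Psi x < a i + c + c] = U `&` closure D.
  have [[U [oU ->]] _] := jOP i.
  have [U1 [oU1 E1]] := within_superlevelP (a i - c) cPsi.
  have [U2 [oU2 E2]] := within_superlevelP (- (a i + c + c)) (withinN cPsi).
  have {}E2 x : closure D x -> U2 x <-> Psi x < a i + c + c by move=> /E2; rewrite ltrN2.
  exists (U `&` (U1 `&` U2)); split; first by apply: openI => //; exact: openI.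
  apply/seteqP; split=> x.
    by move=> [[Ux cx] /andP[h1 h2]]; split => //; split => //; split; [exact/E1|exact/E2].
  by move=> [[Ux [h1 h2]] cx]; split => //=; apply/andP; split; [exact/E1|exact/E2].
have [U' U'P] := choice H3.
(* On the boundary, a point of [F] lies off the support or in the null set where [phis] and [f]
   differ, or else satisfies [|f| >= M] or [|f - Psi| >= c]; the last two sets have measure at most
   [b] each. *)
pose F := closure D `&` ~` (\bigcup_(i in [set i | (i < N)%N]) U' i).
have clF : closed F.
  apply: closedI; first exact: closed_closure.
  by rewrite closedC; apply: bigcup_open => i _; have [] := U'P i.
have FD : F `<=` closure D by move=> x [].
have mF : measurable (F : set T) by exact: measurable_closed_Bor.
have clK : bdry D `<=` closure D by move=> x [].
have muF : (mux x0 (F `&` bdry D) < (3 * b)%:E)%E.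
  have [N0 [mN0 muN0 N0P]] := aephi.
  have mS0 : measurable (~` msupp (mux x0) : set T).
    by apply: measurableC; apply: measurable_closed_Bor; exact: closed_msupp.
  have muS0 : mux x0 (~` msupp (mux x0)) = 0%E.
    exact: (msupp_null (compact_bdry oD bD) (closed_bdry oD) (hmux Dx0).1).
  have mfn : measurable_fun (bdry D : set T) ((fun z => `|f z|) : T -> R).
    by apply: measurableT_comp => //; exact: Lf.1.
  have mA1 : measurable (bdry D `&` [set x | M <= `|f x|] : set T).
    have -> : [set x : V | M <= `|f x|] = (fun z => `|f z|) @^-1` `[M, +oo[%classic.
      by apply/seteqP; split=> x /=; rewrite in_itv/= andbT.
    exact: mfn.
  have mG k : measurable_fun (bdry D : set T) (G k : T -> R).
    by apply: measurable_within => //; exact: withinS clK (cG k).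
  have mfP : measurable_fun (bdry D : set T) ((fun z => `|f z - Psi z|) : T -> R).
    apply: measurableT_comp => //; apply: measurable_funB; first exact: Lf.1.
    by apply: measurable_within => //; exact: withinS clK cPsi.
  have mA2 : measurable (bdry D `&` [set x | c <= `|f x - Psi x|] : set T).
    have -> : [set x : V | c <= `|f x - Psi x|] = (fun z => `|f z - Psi z|) @^-1` `[c, +oo[%classic.
      by apply/seteqP; split=> x /=; rewrite in_itv/= andbT.
    exact: mfP.
  have A1b : (mux x0 (bdry D `&` [set x | (M <= `|f x|)%R]) <= b%:E)%E.
    apply: (@le_trans _ _ (I0 / M)%:E); last by rewrite lee_fin.
    apply: (@markov_bound _ T R (mux x0) _ (bdry D) (fun z => `|f z|) I0 M M0 mK mA1) => //.
    by move=> x [].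
  have A2b : (mux x0 (bdry D `&` [set x | (c <= `|f x - Psi x|)%R]) <= b%:E)%E.
    apply: (@le_trans _ _ (b * c / c)%:E); last by rewrite mulfK// gt_eqF.
    apply: (@markov_bound _ T R (mux x0) _ (bdry D) (fun z => `|f z - Psi z|) (b * c) c c0 mK mA2) => //.
      by move=> x [].
    have mfP' : measurable_fun (bdry D : set T) ((fun z => f z - Psi z) : T -> R).
      apply: measurable_funB; first exact: Lf.1.
      by apply: measurable_within => //; exact: withinS clK cPsi.
    apply: (integral_le_sup mK mfP' mG).
    - by move=> k x /clK/(Gi k)/andP[].
    - by move=> k x /clK/(Gi k)/andP[].
    - by move=> x d Kx; exact: Gs.
    - move=> k; apply: (@le_trans _ _ (G k x0)%:E); last by rewrite lee_fin.
      have [hGk _ _ _ _] := hG.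
      by rewrite ((hmux Dx0).2 (G k) (hGk k) (cG k)).
  apply: (@le_lt_trans _ _ ((0 + 0) + (b + b))%:E); last by rewrite lte_fin; lra.
  have mFK : measurable (F `&` bdry D : set T) by exact: measurableI.
  apply: (measure_cover2 (B := ~` msupp (mux x0) `|` N0)
    (C := (bdry D `&` [set x | M <= `|f x|]) `|` (bdry D `&` [set x | c <= `|f x - Psi x|])) mFK).
  - exact: measurableU.
  - exact: measurableU.
  - move=> x [[cx xF] Kx]; apply: contrapT => /not_orP[/not_orP[/contrapT xm xN0] /not_orP[A1 A2]].
    have phx : phis x = f x by apply: contrapT => nx; apply: xN0; exact: N0P.
    have fM : `|f x| < M by rewrite ltNge; apply/negP => fx; apply: A1.
    have fP : `|f x - Psi x| < c by rewrite ltNge; apply/negP => fx; apply: A2.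
    move: (fM); rewrite ltr_norml => /andP[f1 f2].
    (* The slab number is the integer part of [(f x + M) / c], below [N] because [2 * M < c * N]. *)
    have [i [iN ix]] : exists i, (i < N)%N /\ a i <= f x < a i + c.
      have fM0 : 0 <= (f x + M) / c by rewrite divr_ge0 ?(ltW c0)//; lra.
      have := truncn_itv fM0; set i := Num.truncn _ => /andP[i1 i2].
      exists i; split.
        rewrite -(ltr_nat R); apply: le_lt_trans i1 _.
        rewrite ltr_pdivrMr// mulrC; lra.
      rewrite ler_pdivlMr// in i1; rewrite ltr_pdivrMr// -addn1 natrD in i2.
      by apply/andP; rewrite /a; split; lra.
    apply: xF; exists i => //.
    have [_ UE] := U'P i; have [_ [subO _]] := jOP i.
    have [] // : (U' i `&` closure D) x.
    rewrite -UE; split; first by apply: subO; split => //; rewrite phx.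
    move: ix fP; rewrite /= ltr_norml => /andP[? ?] /andP[? ?]; apply/andP; split; lra.
  - by apply: measure_union_le; rewrite ?muN0 ?muS0.
  - exact: measure_union_le.
have [K KP] := exhaustion_usc clF FD muF.
exists (maxn K.+1 (\max_(i < N) (jO i).1)%N) => j; rewrite geq_max => /andP[Kj jOj].
have rj0 : rs j < 0 := seq_lt0 j.
have [[[oS _] [bS _]] Sx0 hm] := hDr rj0; have SD := exhaustion_closure rj0.
have mS : measurable (bdry (Dr (rs j)) : set T) by apply: measurable_closed_Bor; exact: closed_bdry.
have [mB Bm] := majorant_super_set oS hm SD hG c0.
have Kr : - K.+1%:R^-1 < rs j by rewrite ltrN2 ltf_pV2 ?posrE// ltr_nat ltnS.
have mFS := KP _ rj0 Kr.
have cu x : D x -> {for x, continuous u} by exact: cont_harmonic.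
have mO i : measurable ((jO i).2 : set T).
  have [[U [oU ->]] _] := jOP i.
  by apply: measurableI; [exact: measurable_open_Bor|apply: measurable_closed_Bor; exact: closed_closure].
pose Bad i : set T := ([set x | msupp (mur (rs j)) x /\ (u x < a i - c)%R] `&` (jO i).2) `|`
  ([set x | msupp (mur (rs j)) x /\ (a i + c + c < u x)%R] `&` (jO i).2).
have mB1 i : measurable ([set x | msupp (mur (rs j)) x /\ (u x < a i - c)%R] `&` (jO i).2 : set T).
  by apply: measurableI => //; exact: (measurable_msupp_lt oS hm SD).
have mB2 i : measurable ([set x | msupp (mur (rs j)) x /\ (a i + c + c < u x)%R] `&` (jO i).2 : set T).
  by apply: measurableI => //; exact: (measurable_msupp_gt oS hm SD).
have mBad i : measurable (Bad i) by exact: measurableU.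
have BadU : (mur (rs j) (\big[setU/set0]_(i < N) Bad i) <= (dl / 4)%:E)%E.
  apply: le_trans (Boole_inequality _ (fun i _ => mBad i)) _.
  apply: (@le_trans _ _ (\sum_(i < N) (dl / 4 / N.+1%:R)%:E)%E).
    apply: lee_sum => i _; apply: le_trans (measureU2 _ (mB1 i) (mB2 i)) _.
    apply: ltW; have [_ [_]] := jOP i; apply.
    by apply: leq_trans jOj; exact: (leq_bigmax i).
  rewrite sumEFin lee_fin sumr_const card_ord -[leLHS]mulr_natl.
  rewrite mulrCA ger_pMr ?divr_gt0// ler_pdivrMr// mul1r ler_nat.
  exact: leqnSn.
have mBU : measurable (\big[setU/set0]_(i < N) Bad i) by exact: bigsetU_measurable.
have mS0 : measurable (~` msupp (mur (rs j)) : set T).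
  by apply: measurableC; apply: measurable_closed_Bor; exact: closed_msupp.
have muS0 : mur (rs j) (~` msupp (mur (rs j))) = 0%E.
  exact: (msupp_null (compact_bdry oS bS) (closed_bdry oS) hm.1).
have mE : measurable (bdry (Dr (rs j)) `&` [set x | (e < `|u x - h x|)%R] : set T).
  apply: (@measurable_bdry_gt _ _ D (Dr (rs j)) oS SD (fun x => `|u x - h x|)) => x Dx.
  by apply: cont_normr; apply: contB; exact: cont_harmonic.
have mFS' : measurable (F `&` bdry (Dr (rs j)) : set T) by exact: measurableI.
apply: (@le_trans _ _ ((0 + 2 * (3 * b)) + (dl / 4 + b * c / c))%:E); last first.
  by rewrite lee_fin mulfK ?gt_eqF// /b; lra.
apply: (measure_cover2 (B := ~` msupp (mur (rs j)) `|` (F `&` bdry (Dr (rs j))))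
  (C := (\big[setU/set0]_(i < N) Bad i) `|` (bdry (Dr (rs j)) `&` super_set G c)) mE).
- exact: measurableU.
- exact: measurableU.
- move=> x [Sx /= ex]; apply: contrapT => /not_orP[/not_orP[/contrapT xm xF] /not_orP[xB xG]].
  have Dx : D x := bdry_subdomain SD Sx.
  have cx : closure D x by exact: subset_closure.
  have Gx k : G k x <= c.
    by rewrite leNgt; apply/negP => kx; apply: xG; split => //; exists k.
  have := approximation_dist regD hmux Lf hE PG Dx Gx; rewrite ler_norml => /andP[h1 h2].
  have [i iN U'x] : exists2 i, (i < N)%N & U' i x.
    have [[i iN U'x]|nx] := pselect ((\bigcup_(i in [set i | (i < N)%N]) U' i) x).
      by exists i.
    by exfalso; apply: xF.
  have [_ UE] := U'P i.
  have [xO /andP[P1 P2]] : ((jO i).2 `&` [set x | a i - c < Psi x < a i + c + c]) x by rewrite UE.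
  have xBi : ~ Bad i x.
    by move=> Bx; apply: xB; rewrite -bigcup_mkord; exists i.
  have u1 : a i - c <= u x by rewrite leNgt; apply/negP => ux; apply: xBi; left.
  have u2 : u x <= a i + c + c by rewrite leNgt; apply/negP => ux; apply: xBi; right.
  have : `|u x - h x| <= 4 * c by rewrite ler_norml; apply/andP; split; lra.
  move=> h4; have : e < 4 * c by exact: lt_le_trans h4.
  by rewrite /c; lra.
- by apply: measure_union_le; rewrite ?muS0.
- exact: measure_union_le.
Qed.

Lemma Sp_eventual_bound : exists2 d : R, 0 < d & exists B : R, forall r, - d < r -> r < 0 ->
  (\int[mur r]_(z in bdry (Dr r)) (`|u z| `^ p)%:E <= B%:E)%E.
Proof.
have [_ [_ Sfin]] := Su.
have [_ [d /= d0 <-] dfin] := ereal_inf_lt Sfin.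
exists d => //; set s := ereal_sup _ in dfin.
have sP r : - d < r -> r < 0 ->
    (\int[mur r]_(z in bdry (Dr r)) (`|u z| `^ p)%:E <= s)%E.
  move=> dr r0; apply: ereal_sup_ubound; exists r => //=.
  by rewrite in_itv/= dr r0.
move: sP dfin; case: s => [b| |] sP //= _.
  by exists b.
by exists 0 => r dr r0; apply: le_trans (sP r dr r0) _; rewrite leNye.
Qed.

(** Three regimes: below [e], between [e] and [M], and above [M], where [|v|] is at most [|v|]^
    p[divided by]M [^ (p - 1)]. This is the source of uniform integrability. *)
Lemma powR_truncation (v e W M : R) : 0 < e -> 0 < W -> 0 < M -> M `^ (p - 1) = W ->
  `|v| <= e + M * \1_[set x : R | e < `|x|] v + W^-1 * `|v| `^ p.
Proof.
move=> e0 W0 M0 MW; have vp : 0 <= W^-1 * `|v| `^ p by rewrite mulr_ge0 ?powR_ge0// invr_ge0 ltW.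
rewrite indicE; have [ve|ev] := leP `|v| e.
  rewrite memNset/= ?mulr0 ?addr0; last by apply/negP; rewrite -leNgt.
  by apply: le_trans ve _; rewrite lerDl.
rewrite mem_set// mulr1.
have [vM|Mv] := leP `|v| M; first by lra.
have v0 : 0 < `|v| by exact: lt_trans ev.
have : `|v| <= W^-1 * `|v| `^ p.
  rewrite -ler_pdivrMl ?invr_gt0// invrK.
  have -> : `|v| `^ p = `|v| `^ (p - 1) * `|v|.
    by rewrite -{3}(powRr1 (ltW v0)) -powRD ?subrK// gt_eqF ?implybT.
  rewrite ler_pM2r// -MW; apply: ge0_ler_powR; rewrite ?nnegrE ?subr_ge0 ?ltW//.
lra.
Qed.

Lemma powR_dist_le (y z : R) : `|y - z| `^ p <= 2 `^ p * (`|y| `^ p + `|z| `^ p).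
Proof.
pose k := Num.max `|y| `|z|.
have k0 : 0 <= k by rewrite le_max normr_ge0.
have yk : `|y - z| <= 2 * k.
  apply: le_trans (ler_normB _ _) _; rewrite mulr_natl mulr2n.
  by apply: lerD; rewrite /k le_max lexx ?orbT.
apply: (@le_trans _ _ ((2 * k) `^ p)).
  by apply: ge0_ler_powR; rewrite ?nnegrE ?mulr_ge0// ltW.
rewrite powRM//; apply: ler_wpM2l; first exact: powR_ge0.
rewrite /k; have [_|_] := leP `|y| `|z|; first by rewrite lerDr powR_ge0.
by rewrite lerDl powR_ge0.
Qed.

Lemma convergence_in_L1 (e : R) : 0 < e -> exists j0, forall j, (j0 <= j)%N ->
  (\int[mur (rs j)]_(z in bdry (Dr (rs j))) (`|u z - h z|)%:E <= e%:E)%E.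
Proof.
move=> e0; have [d d0 [Bu BuP]] := Sp_eventual_bound.
have [Bh BhP] : exists Bh : R, (\int[mux x0]_(z in bdry D) (`|f z| `^ p)%:E <= Bh%:E)%E.
  exists (fine (\int[mux x0]_(z in bdry D) (`|f z| `^ p)%:E)%E); rewrite fineK//.
  rewrite ge0_fin_numE; first exact: Lpf.2.
  by apply: integral_ge0 => z _; rewrite lee_fin powR_ge0.
pose B := 2 `^ p * (`|Bu| + `|Bh|).
have B0 : 0 <= B by rewrite mulr_ge0 ?powR_ge0// addr_ge0.
pose W := 3 * B / e + 1.
have W0 : 0 < W by rewrite ltr_wpDl// divr_ge0 ?mulr_ge0 ?(ltW e0).
have BW : W^-1 * B <= e / 3.
  rewrite ler_pdivrMl// /W mulrDl mul1r.
  have -> : 3 * B / e * (e / 3) = B by field; rewrite gt_eqF.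
  by rewrite lerDl divr_ge0// ltW.
pose M := W `^ (p - 1)^-1.
have M0 : 0 < M by exact: powR_gt0.
have MW : M `^ (p - 1) = W.
  by rewrite -powRrM mulVf ?powRr1 ?ltW// gt_eqF// subr_gt0.
have e30 : 0 < e / 3 by rewrite divr_gt0.
have [j1 j1P] := convergence_in_measure e30 (divr_gt0 e30 M0).
have [j2 j2P] : exists K, forall k, (K <= k)%N -> - d < rs k by apply: seq_cvg0; rewrite oppr_lt0.
exists (maxn j1 j2) => j; rewrite geq_max => /andP[/j1P jm /j2P jd].
have rj0 : rs j < 0 := seq_lt0 j.
have [[[oS _] [bS _]] Sx0 hm] := hDr rj0; have SD := exhaustion_closure rj0.
set m := mur (rs j) in hm jm *; set S : set T := bdry (Dr (rs j)) in jm *.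
have mS : measurable S by apply: measurable_closed_Bor; exact: closed_bdry.
have mu_ : measurable_fun S (u : T -> R).
  by apply: (measurable_on_bdry oS SD) => x; exact: cont_harmonic.
have mh_ : measurable_fun S (h : T -> R).
  by apply: (measurable_on_bdry oS SD) => x; exact: cont_harmonic.
have mp g : measurable_fun S (g : T -> R) -> measurable_fun S ((fun z => `|g z| `^ p) : T -> R).
  by move=> mg; apply: (measurableT_comp (measurable_powR p)); exact: measurableT_comp.
have muh : measurable_fun S ((fun z => u z - h z) : T -> R) by exact: measurable_funB.
have mA : measurable (S `&` [set z | e / 3 < `|u z - h z|] : set T).
  apply: (@measurable_bdry_gt _ _ D (Dr (rs j)) oS SD (fun x => `|u x - h x|)) => x Dx.
  by apply: cont_normr; apply: contB; exact: cont_harmonic.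
set A : set T := S `&` _ in mA jm.
have pB : (\int[m]_(z in S) (`|u z - h z| `^ p)%:E <= B%:E)%E.
  apply: (@le_trans _ _ (\int[m]_(z in S) ((2 `^ p)%:E * ((`|u z| `^ p)%:E + (`|h z| `^ p)%:E)))%E).
    apply: ge0_le_integral => //.
    - by apply/measurable_EFinP; exact: mp muh.
    - apply: measurable_funeM; apply: emeasurable_funD; apply/measurable_EFinP; exact: mp.
    - by move=> z _; rewrite -EFinD -EFinM lee_fin powR_dist_le.
  rewrite ge0_integralZl_EFin ?powR_ge0//; last 2 first.
  - by move=> z _; rewrite adde_ge0// lee_fin powR_ge0.
  - by apply: emeasurable_funD; apply/measurable_EFinP; exact: mp.
  rewrite ge0_integralD//; last 2 first.
  - by apply/measurable_EFinP; exact: mp.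
  - by apply/measurable_EFinP; exact: mp.
  rewrite /B EFinM; apply: lee_wpmul2l; first by rewrite lee_fin powR_ge0.
  rewrite EFinD; apply: leeD.
    by apply: le_trans (BuP _ jd rj0) _; rewrite lee_fin ler_norm.
  have := poisson_Sp_bound regD Dx0 hmux hDr exhaustion_closure p1 Lpf hE rj0.
  by move=> /le_trans; apply; apply: le_trans BhP _; rewrite lee_fin ler_norm.
pose i1 : V -> R := \1_A.
have mi1 : measurable_fun S (EFin \o (i1 : T -> R)).
  by apply/measurable_EFinP; exact: measurable_indic.
apply: (@le_trans _ _ (\int[m]_(z in S) ((e / 3)%:E + (M%:E * (i1 z)%:E + (W^-1)%:E * (`|u z - h z| `^ p)%:E)))%E).
  apply: ge0_le_integral => //.
  - by apply/measurable_EFinP; exact: measurableT_comp.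
  - apply: emeasurable_funD => //; apply: emeasurable_funD; apply: measurable_funeM => //.
    by apply/measurable_EFinP; exact: mp muh.
  - move=> z Sz; rewrite -!EFinM -!EFinD lee_fin.
    have := powR_truncation (u z - h z) e30 W0 M0 MW.
    rewrite /i1 !indicE -addrA.
    suff -> : (u z - h z \in [set x : R | e / 3 < `|x|]) = (z \in A) by [].
    by apply/idP/idP => [/set_mem uz|/set_mem[_ uz]]; exact: mem_set.
have i10 z : 0 <= i1 z by rewrite /i1 indicE.
have Wp0 z : S z -> (0 <= (W^-1)%:E * (`|u z - h z| `^ p)%:E)%E.
  by move=> _; rewrite -EFinM lee_fin mulr_ge0 ?powR_ge0// invr_ge0 ltW.
have Mi0 z : S z -> (0 <= M%:E * (i1 z)%:E)%E.
  by move=> _; rewrite -EFinM lee_fin mulr_ge0// ltW.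
have mMi : measurable_fun S (fun z : T => (M%:E * (i1 z)%:E)%E) by exact: measurable_funeM.
have mpe : measurable_fun S (fun z : T => (`|u z - h z| `^ p)%:E).
  by apply/measurable_EFinP; exact: mp muh.
have mWp : measurable_fun S (fun z : T => ((W^-1)%:E * (`|u z - h z| `^ p)%:E)%E) by exact: measurable_funeM.
rewrite ge0_integralD//; last 3 first.
- by move=> z _; rewrite lee_fin ltW.
- by move=> z Sz; apply: adde_ge0; [exact: Mi0|exact: Wp0].
- exact: emeasurable_funD.
rewrite ge0_integralD// ge0_integralZl_EFin ?(ltW M0)//; last first.
  by move=> z _; rewrite lee_fin.
rewrite ge0_integralZl_EFin ?invr_ge0 ?(ltW W0)//.
have -> : (\int[m]_(z in S) (e / 3)%:E = (e / 3)%:E)%E.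
  rewrite (_ : (fun _ => _) = cst (e / 3)%:E)// integral_cst//.
  by rewrite (harm_measure_total oS Sx0 hm) mule1.
have -> : (\int[m]_(z in S) (i1 z)%:E = m A)%E.
  by rewrite integral_indic//; congr (m _); rewrite setIC setIA setIid.
have -> : e%:E = ((e / 3)%:E + ((e / 3)%:E + (e / 3)%:E))%E by rewrite -!EFinD; congr (_%:E); field.
apply: leeD => //; apply: leeD.
  apply: (@le_trans _ _ (M%:E * (e / 3 / M)%:E)%E).
    by apply: lee_wpmul2l => //; rewrite lee_fin ltW.
  by rewrite -EFinM lee_fin mulrC divfK// gt_eqF.
apply: (@le_trans _ _ ((W^-1)%:E * B%:E)%E); last by rewrite -EFinM lee_fin.
by apply: lee_wpmul2l => //; rewrite lee_fin invr_ge0 ltW.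
Qed.

(** The solution [H] in [Dr (rs j)] with boundary data [|u - h|] dominates [|u - h|] inside, and
    [H x0] is its L^1 norm there, which tends to 0. *)
Theorem harmonic_Sp_unique x : D x -> u x = h x.
Proof.
move=> Dx; have := Dx; rewrite -DrU => -[r /=]; rewrite in_itv/= => r0 rx.
have [[[oS [cS _]] [bS _]] Sx0 hm] := hDr r0.
have n0 : (0 < n)%N := harm_measure_dim oS Sx0 hm.
pose i0 : 'I_n := Ordinal n0.
(* Harnack's inequality is taken in the fixed domain [Dr r] containing [x], so [C] does not depend
   on [j]. *)
have [C C0 [r1 r10 [_ CP]]] := harnack i0 oS cS Sx0 rx.
apply/eqP; rewrite -subr_eq0 -normr_le0; apply/ler_addgt0Pr => e e0; rewrite add0r.
have [j1 j1P] := convergence_in_L1 (divr_gt0 e0 C0).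
have [j2 j2P] := seq_cvg0 r0.
pose j := maxn j1 j2.
have rj : r < rs j by apply: j2P; exact: leq_maxr.
have rj0 : rs j < 0 := seq_lt0 j.
have [[[oj _] [bj rgj]] jx0 hmj] := hDr rj0; have SD := exhaustion_closure rj0.
have wv : weakly_harmonic D (fun y => u y - h y).
  by apply: weakly_harmonicB; exact: harmonic_weak.
have cv y : D y -> {for y, continuous (fun y => u y - h y)} by move=> Dy; have [] := wv.2 y Dy.
have sj : Dr (rs j) `<=` D by exact: exhaustion_sub.
have [H [hH [cH HE]]] : exists H : V -> R, harmonic_on (Dr (rs j)) H /\
    {within closure (Dr (rs j)), continuous H} /\
    forall z, bdry (Dr (rs j)) z -> H z = `|u z - h z|.
  by apply: rgj; apply: within_norm; exact: (cont_on_bdry SD cv).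
have wvj := weakly_harmonicS oj sj wv.
have cvj : {within closure (Dr (rs j)), continuous (fun y => u y - h y)}.
  by apply: within_cont => y /SD; exact: cv.
have wH := harmonic_weak hH.
have vH : forall y, Dr (rs j) y -> u y - h y <= H y.
  apply: (wh_max_principle i0 bj wvj wH cvj cH) => z Kz.
  by rewrite HE// ler_norm.
have vH' : forall y, Dr (rs j) y -> - (u y - h y) <= H y.
  apply: (wh_max_principle i0 bj (weakly_harmonicN wvj) wH (withinN cvj) cH) => z Kz.
  by rewrite HE// -normrN ler_norm.
have rsub : Dr r `<=` Dr (rs j) by apply: exhaustion_mono => //; exact: ltW.
have H0 y : Dr (rs j) y -> 0 <= H y by move=> jy; have := vH y jy; have := vH' y jy; lra.
have Hx : H x <= C * H x0.
  apply: CP; last by rewrite subrr normr0.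
    exact: weakly_harmonicS oS rsub wH.
  by move=> y /rsub; exact: H0.
have Hx0 : H x0 <= e / C.
  rewrite -lee_fin (hmj.2 H hH cH); apply: le_trans (j1P j (leq_maxl _ _)).
  rewrite le_eqVlt; apply/orP; left; apply/eqP; apply: eq_integral => z.
  by move=> /set_mem Kz; rewrite HE.
have jx := rsub x rx.
have eC : C * H x0 <= e by rewrite mulrC -ler_pdivlMr.
by rewrite ler_norml; have := vH x jx; have := vH' x jx; move=> ? ?; apply/andP; split; lra.
Qed.

End Uniqueness.

Theorem theorem6p1 (R : realType) (n : nat) (D : set 'rV[R]_n) (x0 : 'rV[R]_n)
  (mux : 'rV[R]_n -> {measure set (Bor R n) -> \bar R})
  (P : 'rV[R]_n -> 'rV[R]_n -> R)
  (Dr : R -> set 'rV[R]_n) (mur : R -> {measure set (Bor R n) -> \bar R})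
  (p : R) (phi : 'rV[R]_n -> R) :
  regular_domain D -> D x0 ->
  (forall x, D x -> harm_measure_at D x (mux x)) ->
  (forall x z, 0 <= P x z) ->
  measurable_fun ((D `*` bdry D) : set (Bor R n * Bor R n))
    (fun xz : Bor R n * Bor R n => P xz.1 xz.2) ->
  (forall x, D x -> forall A : set (Bor R n), measurable A ->
     mux x A = (\int[mux x0]_(z in A) (P x z)%:E)%E) ->
  {ae mux x0, forall z : Bor R n, harmonic_on D (fun x => P x z)} ->
  (forall r, r < 0 -> [/\ regular_domain (Dr r), Dr r x0 &
                          harm_measure_at (Dr r) x0 (mur r)]) ->
  (forall r s, r < s -> s < 0 -> closure (Dr r) `<=` Dr s) ->
  \bigcup_(r in `]-oo, 0[) Dr r = D ->
  1 < p -> in_Lp (mux x0) (bdry D) p phi ->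
  let h := poisson_int D (mux x0) P phi in
  [/\ harmonic_on D h,
      in_Sp D Dr mur p h,
      has_boundary_values D (mux x0) mur h phi,
      (Sp_norm Dr mur p h <= Lp_norm (mux x0) (bdry D) p phi)%E &
      forall u : 'rV[R]_n -> R, harmonic_on D u -> in_Sp D Dr mur p u ->
        has_boundary_values D (mux x0) mur u phi ->
        forall x, D x -> u x = h x].
Proof.
move=> regD Dx0 hmux P0 mP muxE _ hDr DrS DrU p1 Lpf h.
have oD : open D := regD.1.1.
have mK : measurable (bdry D : set (Bor R n)).
  by apply: measurable_closed_Bor; exact: closed_bdry.
have DrD r : r < 0 -> closure (Dr r) `<=` D := exhaustion_closure DrS DrU (r := r).
have Lphi := Lp_L1 regD Dx0 hmux p1 Lpf.
(* Rewriting the kernel integral against [mux x] is what allows comparison with harmonic functions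
   continuous up to the boundary, which reproduce themselves under [mux x]. *)
have hE x : D x -> h x = \int[mux x]_(z in (bdry D : set (Bor R n))) phi z.
  move=> Dx; rewrite /h /poisson_int /Rintegral; congr fine.
  apply: integral_density => //.
  - have mpair : measurable_fun (bdry D : set (Bor R n)) (fun z : Bor R n => (x : Bor R n, z)).
      exact: measurable_funTS (pair1_measurable _).
    apply: (measurable_comp _ _ mP mpair).
    + by apply: measurableX => //; exact: measurable_open_Bor.
    + by move=> _ [z Kz <-].
  - by move=> A mA _; rewrite muxE.
  - exact: Lpf.1.
have hh : harmonic_on D h := poisson_harmonic regD Dx0 hmux Lphi hE.
have Sle := poisson_Sp_pow_le regD Dx0 hmux hDr DrD p1 Lpf hE.
split => //.
- split; first by move=> x; exact: cont_harmonic.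
  split; last by apply: le_lt_trans Sle Lpf.2.
  (* Perron's comparison for a harmonic function is the maximum principle on [G]. *)
  move=> G oG bG GD g hg cg hgb x Gx.
  have n0 := harm_measure_dim oD Dx0 (hmux _ Dx0).
  apply: (wh_max_principle (Ordinal n0) bG _ (harmonic_weak hg) _ cg hgb) => //.
  + by apply: weakly_harmonicS oG _ (harmonic_weak hh) => y Gy; apply: GD; exact: subset_closure.
  + by apply: within_cont => y /GD; exact: cont_harmonic.
- exact: (poisson_boundary_values regD Dx0 hmux hDr DrD Lphi hE).
- rewrite /Sp_norm /Lp_norm; apply: gt0_ler_poweR Sle.
  + by rewrite invr_ge0 ltW// (lt_trans ltr01).
  (* Monotonicity of [poweR] is available on nonnegative extended reals, so the limsup must be
     bounded below by 0: each supremum is at least the integral at [r = - d / 2]. *)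
  + rewrite in_itv/= leey andbT; apply: le_ereal_inf_tmp => _ [d /= d0 <-].
    have I0 : (0 <= \int[mur (- d / 2)%R]_(z in bdry (Dr (- d / 2)%R)) (`|h z| `^ p)%:E)%E.
      by apply: integral_ge0 => z _; rewrite lee_fin powR_ge0.
    apply: (le_trans I0).
    by apply: ereal_sup_ubound; exists (- d / 2) => //=; rewrite in_itv/=; apply/andP; split; lra.
  + by rewrite in_itv/= leey andbT; apply: integral_ge0 => z _; rewrite lee_fin powR_ge0.
- by move=> u hu Su bu x Dx; exact: (harmonic_Sp_unique regD Dx0 hmux hDr DrS DrU p1 Lpf hE hu Su bu Dx).
Qed.
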